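(* Let $\alpha,\beta\in W^{1,\infty}(\mathbb{R})$ be real-valued functions such that $\alpha(x)\ge\alpha_{\min}$ and $\beta(x)\ge\beta_{\min}$ for $x\in\mathbb{R}$, and $\alpha(x)=\alpha_0$, $\beta(x)=\beta_0$ for $x\in\mathbb{R}\setminus\Omega_{in}$, where $\Omega_{in}\subset\mathbb{R}$ is some open bounded interval and $\alpha_{\min},\beta_{\min},\alpha_0,\beta_0>0$ are constants. Let $u_0\in H^1(\mathbb{R})$ and $u_1\in L^2(\mathbb{R})$ be real-valued functions with $\operatorname{supp}u_0,\ \operatorname{supp}u_1\subset\Omega_0$ for some open bounded interval $\Omega_0\subset\mathbb{R}$. Let $u$ be the solution of $$\beta(x)\,\partial_t^2u(x,t)-\partial_x\big(\alpha(x)\,\partial_xu(x,t)\big)=0,\quad x\in\mathbb{R},\ t>0,\qquad u(x,0)=u_0(x),\quad \partial_tu(x,0)=u_1(x),\quad x\in\mathbb{R}.$$ Set $$t_0:=\int_{\Omega_{in}}\Big(\frac{\beta(x)}{\alpha(x)}\Big)^{1/2}dx,\qquad \gamma_0:=\frac{t_0}{4}\left\|\frac{\alpha'}{(\alpha\beta)^{1/2}}+\Big(\frac{\alpha}{\beta^3}\Big)^{1/2}\beta'\right\|_{L^\infty(\Omega_{in})},$$ $$u_\infty:=\frac{1}{2(\alpha_0\beta_0)^{1/2}}\int_{\Omega_0}u_1(x)\beta(x)\,dx,\qquad \Lambda:=\frac{\gamma_0}{2t_0}e^{-2\gamma_0}\big(1-4\gamma_0e^{-4\gamma_0}\big)^{1/2}.$$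 Then for any open bounded interval $\Omega\subset\mathbb{R}$ there exists a constant $C>0$, depending on $u_0,u_1,\alpha,\beta,|\Omega_0|,|\Omega_{in}|$ and $\Omega$ (where $|\cdot|$ denotes Lebesgue measure) but not on $t$, such that $$\|u(\cdot,t)-u_\infty\|_{H^1(\Omega)}+\|\partial_tu(\cdot,t)\|_{L^2(\Omega)}\le C e^{-\Lambda t},\qquad t\ge0.$$
   Context: $\mathbb{R}_+:=\{x\in\mathbb{R}:x\ge0\}$. Intervals are nonempty. The solution $u$ is understood in the mild (semigroup) sense: $u\in C^1(\mathbb{R}_+,L^2(\mathbb{R}))\cap C(\mathbb{R}_+,H^1(\mathbb{R}))$ is the unique function such that $\phi=(u,\partial_tu)$ is the mild solution in $X=H^1(\mathbb{R})\times L^2(\mathbb{R})$ of $\phi'(t)=G\phi(t)$, $\phi(0)=(u_0,u_1)$, where $G(w,z)=\big(z,\tfrac1\beta(\alpha w')'\big)$ with domain $H^2(\mathbb{R})\times H^1(\mathbb{R})$. That is, $\phi\in C(\mathbb{R}_+,X)$, $\int_0^t\phi(s)\,ds\in\operatorname{Dom}G$ and $\phi(t)=\phi(0)+G\int_0^t\phi(s)\,ds$ for all $t\ge0$; equivalently, $\phi$ is the orbit of $(u_0,u_1)$ under the $C_0$-semigroup generated by $G$. *)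

(* Defs.v *)
From mathcomp Require Import all_boot all_order all_algebra.
From mathcomp Require Import all_classical all_reals all_analysis.
Set Implicit Arguments.
Unset Strict Implicit.
Unset Printing Implicit Defensive.
Import Order.TTheory GRing.Theory Num.Theory.
Import numFieldNormedType.Exports.
Local Open Scope classical_set_scope.
Local Open Scope ring_scope.

(* Elements of L^p and Sobolev spaces are represented by Borel functions.
   All notions below depend only on the class of a function modulo equality
   almost everywhere (on the open set Omega under consideration), and equality
   of elements of these spaces is stated as equality almost everywhere. *)

Section Sobolev.
Context {R : realType}.
Implicit Types (Omega : set R) (f g phi : R -> R) (p : \bar R).
Local Notation mu := (@lebesgue_measure R).

Definition open_bounded_interval Omega : Prop :=
  exists a b : R, a < b /\ Omega = `]a, b[%classic.

Definition Lp_norm Omega p f : \bar R := 'N[mu]_p[EFin \o (f \_ Omega)]%E.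

Definition in_Lp Omega p f : Prop := (f \_ Omega) \in Lfun mu p.

Definition test_function Omega phi : Prop :=
  (forall (n : nat) (x : R), derivable (derive1n n phi) x 1) /\
  exists K : set R,
    [/\ compact K, K `<=` Omega & forall x, ~ K x -> phi x = 0].

Definition is_weak_deriv Omega f g : Prop :=
  [/\ locally_integrable Omega f, locally_integrable Omega g &
      forall phi, test_function Omega phi ->
        \int[mu]_(x in Omega) (f x * derive1 phi x) =
        - \int[mu]_(x in Omega) (g x * phi x)].

(* A representative of the weak derivative on Omega, which is unique up to
   equality almost everywhere on Omega (0 if f has no weak derivative). *)
Definition weak_deriv Omega f : R -> R :=
  xget (fun=> 0) [set g | is_weak_deriv Omega f g].

Definition in_W1p Omega p f : Prop :=
  in_Lp Omega p f /\ exists2 g, is_weak_deriv Omega f g & in_Lp Omega p g.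

Definition in_L2 Omega f : Prop := in_Lp Omega 2%:E f.

Definition in_H1 Omega f : Prop := in_W1p Omega 2%:E f.

Definition in_H2 Omega f : Prop :=
  in_L2 Omega f /\ exists2 g, is_weak_deriv Omega f g & in_H1 Omega g.

Definition L2_norm Omega f : \bar R := Lp_norm Omega 2%:E f.

Definition H1_norm Omega f : \bar R :=
  ((L2_norm Omega f `^ 2 + L2_norm Omega (weak_deriv Omega f) `^ 2)
     `^ 2^-1)%E.

(* Support of a class modulo equality almost everywhere: the complement of the
   largest open set on which f vanishes almost everywhere. *)
Definition ess_support f : set R :=
  [set x | forall U, nbhs x U -> ~ {ae mu, forall y, U y -> f y = 0}].

End Sobolev.

(* Calculus on [0, +oo[ for functions with values in a vector space V whose
   topology is given by a (semi)norm N. *)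
Section TimeCalculus.
Context {R : realType} {V : lmodType R}.
Variable N : V -> \bar R.
Implicit Types f g : R -> V.

Definition continuous_Rplus f : Prop :=
  forall t : R, 0 <= t ->
    N (f s - f t) @[s --> within [set s | 0 <= s] (nbhs t)] --> 0%E.

Definition is_deriv_Rplus f g : Prop :=
  forall t : R, 0 <= t ->
    N ((s - t)^-1 *: (f s - f t) - g t)
      @[s --> within [set s | 0 <= s] t^'] --> 0%E.

(* I is the Riemann integral of f over [a, b]: the limit of the Riemann sums
   over the tagged subdivisions a = s 0 <= ... <= s n = b, with tags
   s i <= xi i <= s i.+1, as the mesh tends to 0. *)
Definition is_integral f (a b : R) (I : V) : Prop :=
  forall e : R, 0 < e -> exists2 d : R, 0 < d &
    forall (n : nat) (s xi : nat -> R), s 0%N = a -> s n = b ->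
      (forall i, (i < n)%N ->
         [/\ s i <= xi i, xi i <= s i.+1 & s i.+1 - s i <= d]) ->
      (N (\sum_(i < n) (s i.+1 - s i) *: f (xi i) - I) < e%:E)%E.

End TimeCalculus.

Section Wave.
Context {R : realType}.
Local Notation mu := (@lebesgue_measure R).
Local Notation F := (R -> R^o).
Variables alpha beta : R -> R.

Definition in_X (y : F * F) : Prop := in_H1 setT y.1 /\ in_L2 setT y.2.

(* Equivalent to the Hilbert norm of H^1 x L^2; only its topology is used. *)
Definition X_norm (y : F * F) : \bar R :=
  (H1_norm setT y.1 + L2_norm setT y.2)%E.

Definition X_eq (y z : F * F) : Prop :=
  {ae mu, forall x, y.1 x = z.1 x} /\ {ae mu, forall x, y.2 x = z.2 x}.

Definition in_dom_G (y : F * F) : Prop := in_H2 setT y.1 /\ in_H1 setT y.2.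

Definition G (y : F * F) : F * F :=
  (y.2,
   fun x => (beta x)^-1 *
     weak_deriv setT (fun z => alpha z * weak_deriv setT y.1 z) x).

Definition is_mild_solution (phi : R -> F * F) (phi0 : F * F) : Prop :=
  [/\ forall t : R, 0 <= t -> in_X (phi t),
      continuous_Rplus X_norm phi,
      X_eq (phi 0) phi0 &
      forall t : R, 0 <= t -> exists Phi : F * F,
        [/\ is_integral X_norm phi 0 t Phi,
            in_dom_G Phi &
            X_eq (phi t) (phi 0 + G Phi)]].

(* u t is the function u(., t), and ut t is (d/dt u)(., t); only times t >= 0
   matter. *)
Record wave_solution (u0 u1 : R -> R) (u ut : R -> F) : Prop := {
  wave_H1 : forall t : R, 0 <= t -> in_H1 setT (u t);
  wave_cont_H1 : continuous_Rplus (H1_norm setT) u;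
  wave_ut_L2 : forall t : R, 0 <= t -> in_L2 setT (ut t);
  wave_deriv_L2 : is_deriv_Rplus (L2_norm setT) u ut;
  wave_cont_ut : continuous_Rplus (L2_norm setT) ut;
  wave_mild : is_mild_solution (fun t => (u t, ut t)) (u0, u1)
}.

Definition t0 (Omega_in : set R) : R :=
  \int[mu]_(x in Omega_in) Num.sqrt (beta x / alpha x).

Definition gamma0 (Omega_in : set R) : R :=
  t0 Omega_in / 4 *
  fine (Lp_norm Omega_in +oo%E (fun x =>
    weak_deriv setT alpha x / Num.sqrt (alpha x * beta x) +
    Num.sqrt (alpha x / beta x ^+ 3) * weak_deriv setT beta x)).

Definition u_infty (alpha0 beta0 : R) (Omega_0 : set R) (u1 : R -> R) : R :=
  (2 * Num.sqrt (alpha0 * beta0))^-1 *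
  \int[mu]_(x in Omega_0) (u1 x * beta x).

Definition Lambda (Omega_in : set R) : R :=
  let g := gamma0 Omega_in in
  g / (2 * t0 Omega_in) * expR (- (2 * g)) *
  Num.sqrt (1 - 4 * g * expR (- (4 * g))).

End Wave.

(* Main.v *)
Require Import Defs.
From mathcomp Require Import all_boot all_order all_algebra.
From mathcomp Require Import all_classical all_reals all_analysis.
From mathcomp Require Import measurable_realfun ess_sup_inf ring lra.
Set Implicit Arguments.
Unset Strict Implicit.
Unset Printing Implicit Defensive.
Import Order.TTheory GRing.Theory Num.Theory.
Import numFieldNormedType.Exports.
Local Open Scope classical_set_scope.
Local Open Scope ring_scope.

(** Let rho = sqrt(alpha beta) be the impedance, q = rho' / rho, v = d_t u and
    p = d_x u. The Riemann invariants A = rho v + alpha p and B = rho v - alpha p travel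
    to the left and to the right with speed alpha / rho and are coupled only by q, so
    that for weights w1, w2 the energy E, the integral of (w1 A^2 + w2 B^2) / alpha,
    formally satisfies
      E' = integral of (- w1' A^2 + w2' B^2 - (w1 - w2) q A B) / rho.
    A rate of decay of E thus follows from a pointwise inequality between quadratic forms
    in A and B (energy_decay).

    Let s = rho / alpha be the inverse speed. Almost everywhere |q| <= 2 kappa s with
    kappa = gamma0 / t0, and q vanishes off an interval [l, r] containing all the
    inhomogeneities. On [l, r] one takes w1 = 1 + m and w2 = 1 - m with
    m = eta - e^(-2 kappa y), where y is the travel time from l and eta is the value of
    e^(-2 kappa y) at r. Since m' = 2 kappa s e^(-2 kappa y), the terms in A^2 and B^2
    dominate the coupling term 2 m q A B and the rate is kappa eta
    (core_weight_inequality). Outside [l, r] the weights vary exponentially with the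
    travel time, in the direction that makes outgoing waves decay at the same rate. They
    can be kept bounded, since by finite propagation speed no incoming wave occurs off an
    interval [a, b] that contains the supports (no_incoming_right, no_incoming_left,
    ex_decay_weights). The weights being bounded below on [a, b], the L^2 norms of p and v
    on [a, b] decay like e^(- kappa eta t / 2) (local_energy_decay), and Lambda is at most
    kappa eta / 2 (Lambda_le).

    To identify the limit of u, the conditions A = 0 at b and B = 0 at a are integrated in
    time and added. The mean of u(a, t) and u(b, t) differs from u_infty by the integral
    of beta v over [a, b], divided by 2 rho(a) (boundary_mean), and u(., t) differs from
    this mean by at most the integral of |p| over [a, b]; both tend to 0 at the required
    rate (local_decay).

    A mild solution is not regular enough for the computation of E'. But its time
    integrals are: the flux alpha p, integrated over [0, t], is absolutely continuous in
    space with derivative beta (v(t) - v(0)) (mild_wave_data). The energy identity is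
    proved for the increments of u and of these integrals over a time step h
    (energy_rate_le), and the decay of E itself is the limit h -> 0 of the inequality for
    the increments divided by h. Weakly differentiable functions are replaced throughout
    by their absolutely continuous representatives (weak_deriv_AC).

    The constant is uniform because the weights depend only on the coefficients and on
    [a, b]: [l, r] is the smallest possible interval (ex_core_interval), and kappa is an
    essential supremum over the line. *)

(** * Lebesgue integrals and absolutely continuous functions *)
Section RealIntegrable.
Context {R : realType}.
Local Notation mu := (@lebesgue_measure R).
Local Notation TR := (measurableTypeR R).
Local Notation mset D := (@measurable _ TR D).
Local Notation mfun D f := (@measurable_fun _ _ TR R D f).
Implicit Types (D E : set R) (f g : R -> R) (a b c k : R).

Definition rint D f : Prop := mu.-integrable D (EFin \o f).

Lemma ae_imp (P Q : R -> Prop) : (forall x, P x -> Q x) ->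
  {ae mu, forall x, P x} -> {ae mu, forall x, Q x}.
Proof.
exact: (@filterS _ _ (@ae_filter_ringOfSetsType _ TR R mu)).
Qed.

Lemma ae_all (P : R -> Prop) : (forall x, P x) -> {ae mu, forall x, P x}.
Proof.
move=> h; apply: (@filterE _ _ (@ae_filter_ringOfSetsType _ TR R mu)).
exact: h.
Qed.

Lemma ae_imp2 (P Q S : R -> Prop) : (forall x, P x -> Q x -> S x) ->
  {ae mu, forall x, P x} -> {ae mu, forall x, Q x} -> {ae mu, forall x, S x}.
Proof.
exact: (@filterS2 _ _ (@ae_filter_ringOfSetsType _ TR R mu)).
Qed.

Lemma rint_measurable D f : rint D f -> mfun D f.
Proof. by move=> /integrableP[/measurable_EFinP]. Qed.

Lemma rintD D f g : mset D -> rint D f -> rint D g ->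
  rint D (fun x => f x + g x).
Proof. by move=> mD hf hg; exact: (integrableD mD hf hg). Qed.

Lemma rintB D f g : mset D -> rint D f -> rint D g ->
  rint D (fun x => f x - g x).
Proof. by move=> mD hf hg; exact: (integrableB mD hf hg). Qed.

Lemma rintZ D f k : mset D -> rint D f -> rint D (fun x => k * f x).
Proof. by move=> mD hf; exact: (integrableZl mD k hf). Qed.

Lemma rint_dominated D f g : mset D -> mfun D f -> rint D g ->
  (forall x, D x -> `|f x| <= g x) -> rint D f.
Proof.
move=> mD mf hg fg; apply: (le_integrable mD _ _ hg).
  exact/measurable_EFinP.
move=> x Dx /=; rewrite lee_fin (le_trans (fg x Dx))//; exact: ler_norm.
Qed.

Lemma rint_norm D f : rint D f -> rint D (fun x => `|f x|).
Proof. exact: integrable_norm. Qed.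

Lemma rint_bounded D f g k : mset D -> mfun D f -> rint D g ->
  (forall x, D x -> `|f x| <= k) -> rint D (fun x => f x * g x).
Proof.
move=> mD mf hg fk; have mg := rint_measurable hg.
apply: (@rint_dominated _ _ (fun x => k * `|g x|)) => //.
- exact: measurable_funM.
- exact/rintZ/rint_norm.
- by move=> x Dx; rewrite normrM ler_wpM2r// fk.
Qed.

Lemma rintS D E f : mset D -> mset E -> D `<=` E ->
  rint E f -> rint D f.
Proof. by move=> mD mE DE; exact: integrableS. Qed.

Lemma rint_cst a b k : rint `[a, b] (fun=> k).
Proof.
apply: measurable_bounded_integrable => //.
  by rewrite /= lebesgue_measure_itv/=; case: ifP => // _; exact: ltry.
exact: bounded_cst.
Qed.

Lemma ae_eq_Rintegral D f g : mset D ->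
  mfun D f -> mfun D g ->
  {ae mu, forall x, D x -> f x = g x} ->
  \int[mu]_(x in D) f x = \int[mu]_(x in D) g x.
Proof.
move=> mD mf mg fg; congr fine; apply: ae_eq_integral => //.
- exact/measurable_EFinP.
- exact/measurable_EFinP.
- by apply: ae_imp fg => x h Dx /=; rewrite h.
Qed.

Lemma ae_eq_rint D f g : mset D -> mfun D g ->
  {ae mu, forall x, D x -> f x = g x} -> rint D f -> rint D g.
Proof.
move=> mD mg fg hf; have mf := rint_measurable hf.
apply/integrableP; split; first exact/measurable_EFinP.
move/integrableP : hf => [_]; congr (_ < _)%E.
apply: ae_eq_integral => //.
- by apply/measurable_EFinP; exact: measurableT_comp.
- by apply/measurable_EFinP; exact: measurableT_comp.
- by apply: ae_imp fg => x h Dx /=; rewrite h.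
Qed.

Lemma ae_le_Rintegral D f g : mset D -> rint D f -> rint D g ->
  {ae mu, forall x, D x -> f x <= g x} ->
  \int[mu]_(x in D) f x <= \int[mu]_(x in D) g x.
Proof.
move=> mD hf hg fg.
have mf := rint_measurable hf; have mg := rint_measurable hg.
pose h x := Num.max (f x) (g x).
have mh : mfun D h by exact: measurable_maxr.
have hh : {ae mu, forall x, D x -> g x = h x}.
  by apply: ae_imp fg => x fgx Dx; rewrite /h max_r// fgx.
rewrite (ae_eq_Rintegral mD mg mh hh); apply: le_Rintegral => //.
  exact: (ae_eq_rint mD mh hh hg).
by move=> x _; rewrite /h le_max lexx.
Qed.

Lemma ge0_Rintegral_subset D E f : mset D -> mset E -> D `<=` E -> rint E f ->
  (forall x, E x -> 0 <= f x) ->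
  \int[mu]_(x in D) f x <= \int[mu]_(x in E) f x.
Proof.
move=> mD mE DE hf f0; have hfD := rintS mD mE DE hf.
apply: fine_le; [exact: integrable_fin_num|exact: integrable_fin_num|].
by apply: ge0_subset_integral => //; exact: measurable_int hf.
Qed.

(** ** Integrals over compact intervals *)

(** Measurability on the whole line is included, so that two such functions can be
    compared almost everywhere. *)
Definition lint f : Prop := mfun setT f /\ forall a b, rint `[a, b] f.

Lemma lintD f g : lint f -> lint g -> lint (fun x => f x + g x).
Proof.
move=> [mf hf] [mg hg]; split; first exact: measurable_funD.
by move=> a b; apply: rintD.
Qed.

Lemma lintB f g : lint f -> lint g -> lint (fun x => f x - g x).
Proof.
move=> [mf hf] [mg hg]; split; first exact: measurable_funB.
by move=> a b; apply: rintB.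
Qed.

Lemma lintZ f k : lint f -> lint (fun x => k * f x).
Proof.
move=> [mf hf]; split; first exact: measurable_funM.
by move=> a b; apply: rintZ.
Qed.

Lemma lint_norm f : lint f -> lint (fun x => `|f x|).
Proof.
move=> [mf hf]; split; first exact: measurableT_comp.
by move=> a b; apply: rint_norm.
Qed.

Lemma lint_cst k : lint (fun=> k).
Proof. by split => // a b; exact: rint_cst. Qed.

Lemma rint_lint f : rint setT f -> lint f.
Proof.
move=> h; split; first exact: rint_measurable h.
by move=> a b; apply: rintS h.
Qed.

Lemma lint_bounded f g k : mfun setT f -> (forall x, `|f x| <= k) ->
  lint g -> lint (fun x => f x * g x).
Proof.
move=> mf fk [mg hg]; split; first exact: measurable_funM.
by move=> a b; apply: (@rint_bounded _ _ _ k) => //; exact: measurable_funTS.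
Qed.

Lemma lint_continuousM f g : continuous f -> lint g -> lint (fun x => f x * g x).
Proof.
move=> cf [mg hg]; have mf := continuous_measurable_fun cf.
split; first exact: measurable_funM.
move=> a b; have [ab|ba] := leP a b; last first.
  by rewrite set_itv_ge ?bnd_simp -?ltNge//; exact: integrable_set0.
have cab : {within `[a, b], continuous (fun x => `|f x|)}.
  apply: continuous_subspaceT => x.
  by apply: continuous_comp; [exact: cf|exact: norm_continuous].
have [c _ fc] := EVT_max ab cab.
by apply: (@rint_bounded _ _ _ `|f c|) => //; exact: measurable_funTS.
Qed.

Lemma continuous_lint f : continuous f -> lint f.
Proof.
move=> cf; have := lint_continuousM cf (lint_cst 1); congr lint.
by apply/funext => x; rewrite mulr1.
Qed.

Lemma lint_Mcontinuous f g : lint f -> continuous g -> lint (fun x => f x * g x).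
Proof.
move=> hf cg; have := lint_continuousM cg hf; congr lint.
by apply/funext => x; rewrite mulrC.
Qed.

Lemma Iadd f a b c : lint f -> a <= b -> b <= c ->
  \int[mu]_(x in `[a, c]) f x =
  \int[mu]_(x in `[a, b]) f x + \int[mu]_(x in `[b, c]) f x.
Proof.
move=> [_ hf] ab bc.
have := @Rintegral_itvB _ f (BLeft a) (BRight c) b (hf a c).
rewrite !bnd_simp => /(_ ab bc); rewrite Rintegral_itv_obnd_cbnd.
  by move/eqP; rewrite subr_eq addrC => /eqP.
by apply: rintS (hf b c) => // x /=; rewrite !in_itv/= => /andP[/ltW-> ->].
Qed.

Lemma Ipt f a : \int[mu]_(x in `[a, a]) f x = 0.
Proof. by rewrite set_itv1 Rintegral_set1. Qed.

Lemma Icst a b k : a <= b -> \int[mu]_(x in `[a, b]) k = k * (b - a).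
Proof.
move=> ab; rewrite Rintegral_cst//= lebesgue_measure_itv/= lte_fin.
by move: ab; rewrite le_eqVlt => /predU1P[->|->//]; rewrite ltxx subrr mulr0.
Qed.

Lemma Inorm f a b : lint f ->
  `|\int[mu]_(x in `[a, b]) f x| <= \int[mu]_(x in `[a, b]) `|f x|.
Proof. by move=> [_ hf]; apply: le_normr_Rintegral => //; exact: hf. Qed.

Lemma Ile f g a b : lint f -> lint g -> (forall x, a <= x <= b -> f x <= g x) ->
  \int[mu]_(x in `[a, b]) f x <= \int[mu]_(x in `[a, b]) g x.
Proof.
move=> [_ hf] [_ hg] fg; by apply: le_Rintegral => //; [exact: hf|exact: hg].
Qed.

Lemma ae_neq c : {ae mu, forall x, x <> c}.
Proof.
exists [set c]; split => //; first exact: lebesgue_measure_set1.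
by move=> y /= /contrapT.
Qed.

Lemma int_eq0 f a b : lint f -> (forall x, a < x < b -> f x = 0) ->
  \int[mu]_(x in `[a, b]) f x = 0.
Proof.
move=> [mf _] f0; have [ab|ba] := leP a b; last by rewrite set_itv_ge ?Rintegral_set0// bnd_simp -ltNge.
rewrite -[RHS](mul0r (b - a)) -(Icst 0 ab).
apply: ae_eq_Rintegral => //; first exact: (measurable_funS measurableT (@subsetT _ _) mf).
apply: ae_imp2 (ae_neq a) (ae_neq b) => x xa xb; rewrite /= in_itv/= => /andP[ax bx].
by apply: f0; rewrite !lt_neqAle ax bx !andbT; apply/andP; split; apply/eqP => e; [apply: xa|apply: xb].
Qed.

Definition primitive f x : R :=
  if 0 <= x then \int[mu]_(t in `[0, x]) f t else - \int[mu]_(t in `[x, 0]) f t.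

Lemma primitiveB f a b : lint f -> a <= b ->
  primitive f b - primitive f a = \int[mu]_(x in `[a, b]) f x.
Proof.
move=> hf ab; rewrite /primitive; have [a0|a0] := leP 0 a.
  by rewrite (le_trans a0 ab) (Iadd hf a0 ab) addrAC subrr add0r.
have [b0|b0] := leP 0 b; first by rewrite (Iadd hf (ltW a0) b0) opprK addrC.
by rewrite (Iadd hf ab (ltW b0)) opprK addrC addrK.
Qed.

(** ** Absolutely continuous functions *)

(** The derivative is part of the relation: it is only determined almost everywhere,
    and the derivative of an explicit expression is an explicit expression. *)
Definition AC F f : Prop := lint f /\
  forall a b, a <= b -> F b - F a = \int[mu]_(x in `[a, b]) f x.

Lemma AC_primitive f : lint f -> AC (primitive f) f.
Proof. by move=> hf; split => // a b ab; rewrite primitiveB. Qed.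

Lemma AC_lint F f : AC F f -> lint f. Proof. by case. Qed.

Lemma AC_dist F f a b : AC F f -> a <= b ->
  `|F b - F a| <= \int[mu]_(x in `[a, b]) `|f x|.
Proof. by move=> [hf e] ab; rewrite e//; exact: Inorm. Qed.

Lemma AC_continuous F f : AC F f -> continuous F.
Proof.
move=> [hf e] x.
have h1 : x - 1 < x + 1 by rewrite ltrD2l; lra.
have := parameterized_integral_continuous (ltW h1) (hf.2 _ _).
move=> /(continuous_within_itvP _ h1)[+ _ _] => /(_ x).
rewrite in_itv/= ltrBlDr ltrDl ltr01 => /(_ isT) cx.
have -> : F = (fun z => F (x - 1) + (F z - F (x - 1))) by apply/funext => z; rewrite addrC subrK.
apply: cvgD; first exact: cvg_cst.
have nx : \forall z \near x, parameterized_integral mu (x - 1) z f = F z - F (x - 1).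
  near=> z; rewrite /parameterized_integral e//.
  have : z \in `](x - 1), (x + 1)[.
    by near: z; apply: near_in_itvoo; rewrite in_itv/= ltrBlDr ltrDl ltr01.
  by rewrite in_itv/= => /andP[/ltW].
rewrite e ?lerBlDr ?lerDl//.
exact: cvg_trans (near_eq_cvg nx) cx.
Unshelve. all: by end_near.
Qed.

Lemma AC_eq F f g : AC F f -> mfun setT g -> {ae mu, forall x, f x = g x} -> AC F g.
Proof.
move=> [[mf hf] e] mg fg; have fgD a b : {ae mu, forall x, [set` `[a, b]] x -> f x = g x}.
  by apply: ae_imp fg => x ->.
split; first split => //.
  by move=> a b; apply: ae_eq_rint (hf a b) => //; exact: measurable_funTS.
move=> a b ab; rewrite e//; apply: ae_eq_Rintegral => //; exact: measurable_funTS.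
Qed.

Lemma AC_cst k : AC (fun=> k) (fun=> 0).
Proof.
by split; [exact: lint_cst|move=> a b ab; rewrite subrr Icst// mul0r].
Qed.

Lemma AC_add F f G g : AC F f -> AC G g ->
  AC (fun x => F x + G x) (fun x => f x + g x).
Proof.
move=> [hf ef] [hg eg]; split; first exact: lintD.
move=> a b ab; rewrite RintegralD//; [|exact: hf.2|exact: hg.2].
by rewrite -ef// -eg//; ring.
Qed.

Lemma AC_scale F f k : AC F f -> AC (fun x => k * F x) (fun x => k * f x).
Proof.
move=> [hf ef]; split; first exact: lintZ.
by move=> a b ab; rewrite RintegralZl//; [rewrite -ef// mulrBr|exact: hf.2].
Qed.

Lemma AC_sub F f G g : AC F f -> AC G g ->
  AC (fun x => F x - G x) (fun x => f x - g x).
Proof.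
move=> [hf ef] [hg eg]; split; first exact: lintB.
move=> a b ab; rewrite RintegralB//; [|exact: hf.2|exact: hg.2].
by rewrite -ef// -eg//; ring.
Qed.

(** The partition into N pieces of equal M-increment gives the bound
    K (M b - M a) ^ 2 / N on the increment of H. *)
Lemma quadratic_increment_cst (H M : R -> R) K a b : a <= b -> M a <= M b ->
  {within `[a, b], continuous M} -> 0 <= K ->
  (forall s t, a <= s <= b -> a <= t <= b ->
     `|H t - H s| <= K * (M t - M s) ^+ 2) -> H b = H a.
Proof.
move=> ab Mab cM K0 HM; set D := M b - M a.
have D0 : 0 <= D by rewrite subr_ge0.
have key n : `|H b - H a| <= K * D ^+ 2 / n.+1%:R.
  pose v i := M a + (i%:R / n.+1%:R) * D.
  have ex i : exists x, (i <= n.+1)%N ->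
      [/\ a <= x <= b, M x = v i, i = 0%N -> x = a & i = n.+1 -> x = b].
    case: i => [|i]; first by exists a => _; rewrite lexx ab /v !mul0r addr0.
    have [->|ni] := eqVneq i n.
      by exists b => _; rewrite lexx ab /v divff ?mul1r ?pnatr_eq0// addrC subrK.
    have [iN|iN] := leqP i.+1 n.+1; last by exists a.
    have vi : Num.min (M a) (M b) <= v i.+1 <= Num.max (M a) (M b).
      rewrite min_l// max_r// /v lerDl mulr_ge0//=.
      rewrite -lerBrDl -/D ler_piMl// ler_pdivrMr ?ltr0n// mul1r ler_nat//.
    have [x xab Mx] := IVT ab cM vi.
    exists x => _; split => //.
    by move=> [] /eqP; rewrite (negbTE ni).
  have [x hx] := choice ex.
  have sb i : (i <= n.+1)%N -> `|H (x i) - H a| <= i%:R * (K * (D / n.+1%:R) ^+ 2).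
    elim: i => [|i IH] iN.
      by have [_ _ -> //] := hx 0%N iN; rewrite subrr normr0 mul0r.
    have [x1 e1 _ _] := hx _ iN; have [x0 e0 _ _] := hx _ (ltnW iN).
    rewrite -natr1 mulrDl mul1r.
    have -> : H (x i.+1) - H a = (H (x i) - H a) + (H (x i.+1) - H (x i)) by ring.
    apply: (le_trans (ler_normD _ _)); apply: lerD; first exact/IH/ltnW.
    apply: (le_trans (HM _ _ x0 x1)); rewrite e1 e0 /v.
    have -> : M a + i.+1%:R / n.+1%:R * D - (M a + i%:R / n.+1%:R * D) = D / n.+1%:R.
      by rewrite -natr1; ring.
    exact: lexx.
  have [_ _ _ /(_ erefl) xb] := hx _ (leqnn n.+1).
  have := sb _ (leqnn n.+1); rewrite xb => /le_trans; apply.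
  have : n.+1%:R != 0 :> R by rewrite pnatr_eq0.
  move: (n.+1%:R : R) => N N0.
  by rewrite le_eqVlt; apply/orP; left; apply/eqP; field.
have [C0|C0] := eqVneq (K * D ^+ 2) 0.
  by have := key 0%N; rewrite C0 mul0r normr_le0 subr_eq0 => /eqP.
have Cp : 0 < K * D ^+ 2 by rewrite lt_neqAle eq_sym C0 mulr_ge0// sqr_ge0.
apply/eqP; rewrite -subr_eq0; apply/negPn/negP => Hn0.
have Hp : 0 < `|H b - H a| by rewrite normr_gt0.
set n := Num.Def.archi_bound (K * D ^+ 2 / `|H b - H a|).
have nn : K * D ^+ 2 / `|H b - H a| < n%:R by rewrite Num.Theory.archi_boundP// divr_ge0// ltW.
have := key n; rewrite leNgt => /negP; apply.
rewrite ltr_pdivrMr ?ltr0n// -ltr_pdivrMl// mulrC (lt_trans nn)// ltr_nat//.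
Qed.

(** Chain rule. By Taylor's formula the increments of phi o F and of the primitive
    of (phi' o F) f differ by a multiple of the square of the increment of the
    primitive of |f|, so that their difference is constant. *)
Lemma AC_chain F f (phi phi' : R -> R) : AC F f -> continuous phi' ->
  (forall B, exists2 K, 0 <= K & forall y z, `|y| <= B -> `|z| <= B ->
     `|phi z - phi y - phi' y * (z - y)| <= K * `|z - y| ^+ 2 /\
     `|phi' z - phi' y| <= K * `|z - y|) ->
  AC (fun x => phi (F x)) (fun x => phi' (F x) * f x).
Proof.
move=> hF cphi' taylor; have [hf ef] := hF; have cF := AC_continuous hF.
have cE : continuous (fun x => phi' (F x)).
  by move=> x; apply: continuous_comp; [exact: cF|exact: cphi'].
have hd : lint (fun x => phi' (F x) * f x) by exact: lint_continuousM.
split => // a b ab.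
have hN := lint_norm hf.
have hA := AC_primitive hd; have hM := AC_primitive hN.
set M := primitive (fun x => `|f x|) in hM.
set P := primitive (fun x => phi' (F x) * f x) in hA.
rewrite -hA.2//.
suff : phi (F b) - P b = phi (F a) - P a by lra.
have cnF : continuous (fun x => `|F x|).
  by move=> x; apply: continuous_comp; [exact: cF|exact: norm_continuous].
have [c _ cmax] := EVT_max ab (continuous_subspaceT cnF).
have [K K0 hK] := taylor `|F c|.
have Mle (s t : R) : s <= t -> 0 <= M t - M s.
  by move=> st; rewrite hM.2//; apply: Rintegral_ge0.
have step (s t : R) : a <= s -> s <= t -> t <= b ->
    `|(phi (F t) - P t) - (phi (F s) - P s)| <= 2 * K * (M t - M s) ^+ 2.
  move=> as_ st tb; have FB x : s <= x <= t -> `|F x| <= `|F c|.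
    by move=> /andP[sx xt]; apply: cmax; rewrite in_itv/= (le_trans as_)// (le_trans xt).
  have FM x : s <= x <= t -> `|F x - F s| <= M t - M s.
    move=> /andP[sx xt]; rewrite (le_trans (AC_dist hF sx))//.
    by have := Mle _ _ xt; have := hM.2 _ _ sx; lra.
  have FBs : `|F s| <= `|F c| by rewrite FB// lexx.
  have FBt : `|F t| <= `|F c| by rewrite FB// lexx st.
  have -> : phi (F t) - P t - (phi (F s) - P s) =
      (phi (F t) - phi (F s) - phi' (F s) * (F t - F s)) +
      (phi' (F s) * (F t - F s) - (P t - P s)) by ring.
  rewrite (le_trans (ler_normD _ _))// mulrDl mulrDl mul1r lerD//.
    rewrite (le_trans (hK _ _ FBs FBt).1)//.
    by rewrite ler_wpM2l// lerXn2r ?nnegrE ?Mle// FM// lexx st.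
  have [_ /(_ s t st) ->] := hA; rewrite ef//.
  rewrite -RintegralZl//; last exact: hf.2.
  have i1 : rint `[s, t] (fun x => phi' (F s) * f x) by exact/rintZ/hf.2.
  rewrite -RintegralB//; last exact: hd.2.
  rewrite (le_trans (le_normr_Rintegral _ _))//; first exact/rintB/hd.2.
  have -> : K * (M t - M s) ^+ 2 =
      \int[mu]_(x in `[s, t]) ((K * (M t - M s)) * `|f x|).
    by rewrite RintegralZl//; [rewrite -hM.2// expr2 mulrA|exact: hN.2].
  apply: le_Rintegral => //; first exact/rint_norm/rintB/hd.2.
    exact/rintZ/hN.2.
  move=> x; rewrite /= in_itv/= => sxt.
  rewrite -mulrBl normrM ler_wpM2r// (le_trans (hK _ _ (FB _ sxt) FBs).2)//.
  by rewrite ler_wpM2l// distrC FM.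
have K20 : 0 <= 2 * K by rewrite mulr_ge0.
apply: (@quadratic_increment_cst (fun x => phi (F x) - P x) M _ _ _ ab _ _ K20).
- by rewrite -subr_ge0 Mle.
- by apply: continuous_subspaceT; exact: AC_continuous hM.
- move=> s t /andP[sa sb] /andP[ta tb]; have [st|ts] := leP s t; first exact: step.
  by rewrite distrC (le_trans (step _ _ _ (ltW ts) _))// -sqrrN opprB.
Qed.

Lemma AC_exp F f : AC F f -> AC (fun x => expR (F x)) (fun x => expR (F x) * f x).
Proof.
move=> hF; apply: AC_chain hF (@continuous_expR R) _ => B; exists (expR B); first exact: expR_ge0.
have tang (y z : R) : expR y * (z - y) <= expR z - expR y.
  have := expR_ge1Dx (z - y); rewrite -(ler_pM2l (expR_gt0 y)) -expRD.
  by rewrite [y + _]addrC subrK mulrDr mulr1; lra.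
have lip (y z : R) : y <= B -> z <= B -> `|expR z - expR y| <= expR B * `|z - y|.
  wlog yz : y z / y <= z.
    by move=> h yB zB; have [/h->//|/ltW zy] := leP y z; rewrite distrC (distrC z) h.
  move=> yB zB; rewrite !ger0_norm ?subr_ge0 ?ler_expR//.
  have := tang z y.
  have : expR z * (z - y) <= expR B * (z - y) by rewrite ler_wpM2r ?subr_ge0// ler_expR.
  lra.
move=> y z /(le_trans (ler_norm _)) yB /(le_trans (ler_norm _)) zB; split; last exact: lip.
rewrite ger0_norm; last by rewrite subr_ge0.
have h1 : expR z - expR y - expR y * (z - y) <= (expR z - expR y) * (z - y).
  by have := tang z y; lra.
by rewrite (le_trans h1)// (le_trans (ler_norm _))// normrM expr2 mulrA ler_wpM2r// lip.
Qed.

Lemma AC_sqr F f : AC F f -> AC (fun x => F x ^+ 2) (fun x => 2 * F x * f x).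
Proof.
move=> hF; apply: (AC_chain (phi := fun y => y ^+ 2) (phi' := fun y => 2 * y) hF).
  exact: mulrl_continuous.
move=> B; exists 2 => // y z _ _; split; last by rewrite -mulrBr normrM ger0_norm.
have -> : z ^+ 2 - y ^+ 2 - 2 * y * (z - y) = (z - y) ^+ 2 by ring.
by rewrite normrX mulrDl mul1r lerDl sqr_ge0.
Qed.

(** Polarization of AC_sqr. *)
Lemma AC_mul F f G g : AC F f -> AC G g ->
  AC (fun x => F x * G x) (fun x => f x * G x + F x * g x).
Proof.
move=> hF hG.
have := AC_scale 4^-1 (AC_sub (AC_sqr (AC_add hF hG)) (AC_sqr (AC_sub hF hG))).
by congr AC; apply/funext => x; field.
Qed.

(** Otherwise |G| exceeds k on an interval of length m, and its integral over this
    interval exceeds the integral over the line. *)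
Lemma integrable_small_value G k : rint setT G -> 0 < k ->
  exists2 m : R, 0 < m & forall c, exists2 x, c <= x <= c + m & `|G x| <= k.
Proof.
move=> hG k0; set J := \int[mu]_x `|G x|.
have J0 : 0 <= J by apply: Rintegral_ge0.
exists (J / k + 1); first by rewrite ltr_wpDl// divr_ge0// ltW.
move=> c; set m := J / k + 1; have m0 : 0 <= m by rewrite addr_ge0// divr_ge0// ltW.
apply: contrapT => H.
have Hk x : c <= x <= c + m -> k <= `|G x|.
  by move=> cx; rewrite leNgt; apply/negP => h; apply: H; exists x => //; exact: ltW.
have h1 : k * m <= \int[mu]_(x in `[c, c + m]) `|G x|.
  have := @Ile (fun=> k) (fun x => `|G x|) c (c + m) (lint_cst k).
  rewrite Icst ?lerDl// [c + m]addrC addrK => /(_ (lint_norm (rint_lint hG))).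
  by rewrite [m + c]addrC; apply.
have h2 : \int[mu]_(x in `[c, c + m]) `|G x| <= J.
  by apply: ge0_Rintegral_subset => //; exact: rint_norm.
have := le_trans h1 h2; rewrite /m mulrDr mulrCA divff ?gt_eqF// !mulr1; lra.
Qed.

Lemma Rintegral_cvg_dominated (f_ : nat -> R -> R) f g :
  (forall n, mfun setT (f_ n)) -> mfun setT f -> rint setT g ->
  (forall x, f_ ^~ x @ \oo --> f x) -> (forall n x, `|f_ n x| <= g x) ->
  \int[mu]_x f_ n x @[n --> \oo] --> \int[mu]_x f x.
Proof.
move=> mf_ mf hg fcv fg.
have [] := @dominated_convergence _ TR R mu setT measurableT
  (fun n x => (f_ n x)%:E) (fun x => (f x)%:E) (EFin \o g).
- by move=> n; exact/measurable_EFinP.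
- exact/measurable_EFinP.
- by apply: ae_all => x _; apply: cvg_EFin (fcv x); exact: nearW.
- exact: hg.
- by apply: ae_all => x n _ /=; rewrite lee_fin.
move=> hf _ h; apply: fine_cvg; rewrite fineK//.
exact: integrable_fin_num.
Qed.

(** G takes arbitrarily small values far to the left and far to the right, and
    the increment of G between such points tends to the integral of g. *)
Lemma Rintegral_AC_deriv_eq0 G g : AC G g -> rint setT G -> rint setT g ->
  \int[mu]_x g x = 0.
Proof.
move=> [hg eg] hG ig.
have exx n : exists p : R * R, [/\ p.1 <= - n%:R, n%:R <= p.2 &
    `|G p.2 - G p.1| <= 2 * n.+1%:R^-1].
  have n0 : 0 < n.+1%:R^-1 :> R by rewrite invr_gt0 ltr0n.
  have [m m0 hm] := integrable_small_value hG n0.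
  have [x /andP[x1 x2] Gx] := hm (- n%:R - m).
  have [y /andP[y1 y2] Gy] := hm n%:R.
  exists (x, y); split => //=; first by rewrite subrK in x2.
  by rewrite (le_trans (ler_normB _ _))// mulrDl mul1r lerD.
have [p hp] := choice exx.
pose I n := [set` `[(p n).1, (p n).2]].
have cv : \int[mu]_x (g \_ (I n)) x @[n --> \oo] --> \int[mu]_x g x.
  have mg := rint_measurable ig.
  apply: (@Rintegral_cvg_dominated _ _ (fun x => `|g x|)) => //.
  - move=> n; apply/(measurable_restrictT _ _).1; first exact: measurable_itv.
    by apply: measurable_funS mg.
  - exact: rint_norm.
  - move=> x; apply: cvg_near_cst; near=> n.
    rewrite patchE mem_set// /I /= in_itv/=; have [h1 h2 _] := hp n.
    have hn : `|x| <= n%:R by near: n; exact: nbhs_infty_ger.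
    apply/andP; split; last exact: le_trans (ler_norm _) (le_trans hn h2).
    apply: le_trans h1 _; rewrite lerNl; apply: le_trans hn; by rewrite -normrN ler_norm.
  - by move=> n x; rewrite patchE; case: ifP => // _; rewrite normr0.
have cv0 : \int[mu]_x (g \_ (I n)) x @[n --> \oo] --> (0 : R).
  apply: norm_cvg0; apply: (@squeeze_cvgr _ _ _ R (fun=> 0) (fun n => 2 * n.+1%:R^-1)).
  - apply: nearW => n; rewrite normr_ge0/=; have [h1 h2 h3] := hp n.
    rewrite -Rintegral_mkcond -eg//.
    have n0 : 0 <= n%:R :> R by [].
    by move: h1 h2 => /= h1 h2; lra.
  - exact: cvg_cst.
  - rewrite -[X in _ --> X](mulr0 2); apply: cvgMl_tmp.
    exact: cvg_harmonic.
exact: cvg_unique cv cv0.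
Unshelve. all: by end_near.
Qed.

End RealIntegrable.

(** * Test functions and weak derivatives *)
Section TestFunctions.
Context {R : realType}.
Local Notation mu := (@lebesgue_measure R).
Local Notation TR := (measurableTypeR R).
Local Notation mset D := (@measurable _ TR D).
Local Notation mfun D f := (@measurable_fun _ _ TR R D f).
Implicit Types (D E Omega : set R) (f g h F G phi : R -> R) (a b c x : R) (k : nat).

Lemma is_derive1_eq f a b x : is_derive x 1 f a -> a = b -> is_derive x 1 f b.
Proof. by move=> h <-. Qed.

Lemma is_derive1_of_derive1 f (l : R) x : derivable f x 1 -> derive1 f x = l -> is_derive x 1 f l.
Proof. by move=> d e; apply: DeriveDef => //; rewrite -derive1E. Qed.

(** The function e^(-1/x) continued by 0, multiplied by x^(-k): these functions span a
    space that is stable under derivation. *)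
Definition flat (k : nat) x : R :=
  if 0 < x then x^-1 ^+ k * expR (- x^-1) else 0.

Lemma flat_ge0 k x : 0 <= flat k x.
Proof.
rewrite /flat; case: ifP => // x0.
by rewrite mulr_ge0 ?expR_ge0// exprn_ge0// invr_ge0 ltW.
Qed.

Lemma flat_le_fact k x : flat k x <= k`!%:R.
Proof.
rewrite /flat; case: ifP => x0; last by rewrite ler0n.
have y0 : 0 <= x^-1 by rewrite invr_ge0 ltW.
rewrite expRN ler_pdivrMr ?expR_gt0//; case: k => [|k].
  by rewrite expr0 mul1r -[leLHS]expR0 ler_expR.
rewrite -ler_pdivrMl ?ltr0n ?fact_gt0// mulrC.
by apply: le_trans (expR_ge1Dxn k y0); rewrite lerDr.
Qed.

Lemma flat_quadratic k x : flat k x <= (k.+2)`!%:R * x ^+ 2.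
Proof.
have [x0|x0] := leP x 0; first by rewrite /flat ltNge x0 mulr_ge0// sqr_ge0.
have -> : flat k x = flat k.+2 x * x ^+ 2.
  by rewrite /flat x0 !exprS; field; rewrite gt_eqF.
by rewrite ler_wpM2r ?sqr_ge0// flat_le_fact.
Qed.

Lemma is_derive_flat k x :
  is_derive x 1 (flat k) (flat k.+2 x - k%:R * flat k.+1 x).
Proof.
have [x0|x0|->] := ltgtP x 0.
- have -> : flat k.+2 x - k%:R * flat k.+1 x = 0.
    by rewrite /flat ltNge ltW//= mulr0 subr0.
  apply: (@near_eq_is_derive _ _ _ (fun=> 0)) => //.
  near=> y; rewrite /flat; suff -> : (0 < y) = false by [].
  by apply/negbTE; rewrite -leNgt ltW//; near: y; exact: lt_nbhsl.
- have -> : flat k.+2 x - k%:R * flat k.+1 x =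
      x^-1 ^+ k.+2 * expR (- x^-1) - k%:R * (x^-1 ^+ k.+1 * expR (- x^-1)).
    by rewrite /flat x0.
  apply: (@near_eq_is_derive R R R (fun y : R => y^-1 ^+ k * expR (- y^-1))).
    by near=> y; rewrite /flat ifT//; near: y; exact: lt_nbhsr.
  have nx : x != 0 by rewrite gt_eqF.
  have dV : is_derive x 1 (fun y : R => y^-1) (- x ^- 2).
    by refine (is_derive1_eq (@is_deriveV _ id _ _ _ nx _) _); rewrite /= -[_ *: _]/(_ * _) mulr1.
  have dN : is_derive x 1 (fun y : R => - y^-1) (x ^- 2).
    by have := is_deriveN dV; rewrite opprK.
  have dE : is_derive x 1 (expR \o (fun y : R => - y^-1)) (expR (- x^-1) * x ^- 2).
    exact: is_derive1_comp.
  have dX : is_derive x 1 (fun y : R => y^-1 ^+ k) (- (k%:R * x^-1 ^+ k.+1)).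
    elim: k => [|k IH].
      by rewrite mul0r oppr0; have := is_derive_cst (1 : R) x 1.
    have -> : (fun y : R => y^-1 ^+ k.+1) = (fun y : R => y^-1) * (fun y : R => y^-1 ^+ k).
      by apply/funext => y; rewrite exprS.
    refine (is_derive1_eq (is_deriveM dV IH) _).
    rewrite /= -![_ *: _]/(_ * _) -natr1 -exprVn !exprS; ring.
  refine (is_derive1_eq (is_deriveM dX dE) _).
  rewrite /= -![_ *: _]/(_ * _) -exprVn; rewrite !exprS; ring.
- have e0 j : flat j 0 = 0 by rewrite /flat ltxx.
  rewrite !e0 mulr0 subr0; apply/is_derive1_caratheodory.
  exists (fun z => flat k z / z); split; last by rewrite invr0 mulr0.
    move=> z; rewrite e0 !subr0; have [->|z0] := eqVneq z 0; first by rewrite e0 !mul0r.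
    by rewrite divfK.
  rewrite /prop_for /continuous_at /= invr0 mulr0; apply: norm_cvg0.
  apply: (@squeeze_cvgr _ _ _ R (fun=> 0) (fun z => (k.+2)`!%:R * `|z|)).
  + near=> z; rewrite normr_ge0/= normrM normfV ger0_norm ?flat_ge0//.
    have [->|z0] := eqVneq z 0; first by rewrite normr0 invr0 !mulr0.
    rewrite ler_pdivrMr ?normr_gt0// (le_trans (flat_quadratic _ _))//.
    by rewrite -mulrA -normrM -expr2 ger0_norm ?sqr_ge0.
  + exact: cvg_cst.
  + rewrite -[X in _ --> X](mulr0 (k.+2)`!%:R); apply: cvgMl_tmp.
    by rewrite -[X in _ --> X](normr0 R); apply: norm_continuous.
Unshelve. all: by end_near.
Qed.

(** Linear span of the products of a rescaled flat function vanishing to the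
    left of a and one vanishing to the right of b; it is stable under
    derivation, so that all its elements are smooth. *)
Inductive bump_span a b c : (R -> R) -> Prop :=
| bump_term e (k l : nat) : bump_span a b c
    (fun x => e * (flat k (c * (x - a)) * flat l (c * (b - x))))
| bump_add f g : bump_span a b c f -> bump_span a b c g ->
    bump_span a b c (fun x => f x + g x).

Lemma bump_span_derive a b c f : bump_span a b c f ->
  exists2 g, bump_span a b c g & forall x, is_derive x 1 f (g x).
Proof.
elim=> [e k l|f1 f2 _ [g1 s1 d1] _ [g2 s2 d2]].
  exists (fun x => ((e * c) * (flat k.+2 (c * (x - a)) * flat l (c * (b - x))) +
    (- (e * c * k%:R)) * (flat k.+1 (c * (x - a)) * flat l (c * (b - x)))) +
    ((- (e * c)) * (flat k (c * (x - a)) * flat l.+2 (c * (b - x))) +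
     (e * c * l%:R) * (flat k (c * (x - a)) * flat l.+1 (c * (b - x))))).
    by do 2 apply: bump_add; apply: bump_term.
  move=> x.
  have da : is_derive x 1 (fun y : R => c * (y - a)) c.
    by apply: is_derive_eq; rewrite -![_ *: _]/(_ * _); ring.
  have db : is_derive x 1 (fun y : R => c * (b - y)) (- c).
    by apply: is_derive_eq; rewrite -![_ *: _]/(_ * _); ring.
  have dfa := @is_derive1_comp _ (flat k) (fun y => c * (y - a)) _ _ _ (is_derive_flat k _) da.
  have dfb := @is_derive1_comp _ (flat l) (fun y => c * (b - y)) _ _ _ (is_derive_flat l _) db.
  have dp := is_deriveM dfa dfb.
  refine (is_derive1_eq (is_deriveM (is_derive_cst e x 1) dp) _).
  by rewrite /= scaler0 addr0 -![_ *: _]/(_ * _); ring.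
exists (fun x => g1 x + g2 x); first exact: bump_add.
by move=> x; apply: is_deriveD.
Qed.

Lemma bump_span_derivable a b c f : bump_span a b c f ->
  forall n x, derivable (derive1n n f) x 1.
Proof.
move=> sf n x; suff [g sg <-] : exists2 g, bump_span a b c g & g = derive1n n f.
  by have [h _ dh] := bump_span_derive sg; exact: ex_derive.
elim: n => [|n [g sg eg]]; first by exists f.
rewrite derive1nS -eg; have [h sh dh] := bump_span_derive sg.
by exists h => //; apply/funext => z; rewrite derive1E derive_val.
Qed.

(** Test functions increasing to the indicator function of ]a, b[. *)
Definition bump a b (n : nat) x : R :=
  flat 0 (n.+1%:R * (x - a)) * flat 0 (n.+1%:R * (b - x)).

Lemma bump_smooth a b n : forall m x, derivable (derive1n m (bump a b n)) x 1.
Proof.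
apply: (@bump_span_derivable a b n.+1%:R).
have -> : bump a b n = (fun x => 1 * (flat 0 (n.+1%:R * (x - a)) * flat 0 (n.+1%:R * (b - x)))).
  by apply/funext => x; rewrite mul1r.
exact: bump_term.
Qed.

Lemma flat0_le1 x : flat 0 x <= 1.
Proof. exact: (flat_le_fact 0). Qed.

Lemma bump_ge0 a b n x : 0 <= bump a b n x.
Proof. by rewrite mulr_ge0 ?flat_ge0. Qed.

Lemma bump_le1 a b n x : bump a b n x <= 1.
Proof. by rewrite mulr_ile1 ?flat_ge0 ?flat0_le1. Qed.

Lemma bump_support a b n x : ~ [set` `]a, b[] x -> bump a b n x = 0.
Proof.
move=> nx; have [xa|ax] := leP x a.
  by rewrite /bump {1}/flat ltNge pmulr_rle0 ?ltr0n// subr_le0 xa mul0r.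
rewrite /bump {2}/flat ltNge pmulr_rle0 ?ltr0n// subr_le0 leNgt.
by case: ltP => //=; rewrite ?mulr0// => xb; case: nx; rewrite /= in_itv/= ax.
Qed.

Lemma bump_cvg a b x : bump a b ^~ x @ \oo --> (\1_([set` `]a, b[]) x : R).
Proof.
have [xab|nx] := pselect ([set` `]a, b[] x); last first.
  rewrite indicE memNset//; apply: cvg_near_cst; apply: nearW => n.
  exact: bump_support.
rewrite indicE mem_set//; move: xab; rewrite /= in_itv/= => /andP[ax xb].
have key (d : R) : 0 < d -> (flat 0 (n.+1%:R * d)) @[n --> \oo] --> (1 : R).
  move=> d0; have -> : (fun n : nat => flat 0 (n.+1%:R * d)) =
      (fun n : nat => expR (- (d^-1 * n.+1%:R^-1))).
    by apply/funext => n; rewrite /flat mulr_gt0// expr0 mul1r invfM mulrC.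
  have h0 : (- (d^-1 * n.+1%:R^-1)) @[n --> \oo] --> (0 : R).
    rewrite -[X in _ --> X]oppr0; apply: cvgN; rewrite -[X in _ --> X](mulr0 d^-1).
    by apply: cvgMl_tmp; exact: cvg_harmonic.
  by have := @cvg_comp _ _ _ _ expR _ _ _ h0 (@continuous_expR R 0); rewrite expR0.
rewrite -[X in _ --> X](mulr1 1); apply: cvgM; apply: key; by rewrite subr_gt0.
Qed.

Lemma bump_continuous a b n : continuous (bump a b n).
Proof.
move=> x; have := @bump_smooth a b n 0%N x.
by move=> /derivable1_diffP/differentiable_continuous.
Qed.

Lemma bump_test Omega a b n : [set` `[a, b]] `<=` Omega -> test_function Omega (bump a b n).
Proof.
move=> h; split; first exact: bump_smooth.
exists [set` `[a, b]]; split => //; first exact: segment_compact.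
move=> x nx; apply: bump_support => xab; apply: nx; exact: subset_itv_oo_cc xab.
Qed.

(** ** The fundamental lemma of the calculus of variations *)

Lemma rint_compact_support f a b : lint f ->
  (forall x, ~ [set` `[a, b]] x -> f x = 0) -> rint setT f.
Proof.
move=> [mf hf] f0.
have -> : f = f \_ [set` `[a, b]].
  by apply/funext => x; rewrite patchE; case: ifPn => // /negP nx; rewrite f0// => /mem_set.
have := (@integrable_mkcond _ TR R mu _ (EFin \o f) (measurable_itv `[a, b])).1 (hf a b).
by rewrite restrict_EFin.
Qed.

Lemma compact_sub_itv K : compact K -> exists N : R, K `<=` [set` `[- N, N]].
Proof.
move=> cK; have [N [_ hN]] := compact_bounded cK; exists (N + 1).
move=> x Kx; have := hN (N + 1) _ x Kx; rewrite ltrDl ltr01 => /(_ isT).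
by rewrite /= ler_norml in_itv.
Qed.

Lemma lint_locally_integrable f : lint f -> locally_integrable setT f.
Proof.
move=> [mf hf]; split => //; first exact: openT.
move=> K _ cK; have [N KN] := compact_sub_itv cK.
have : rint K f by apply: rintS KN (hf _ _) => //; exact: compact_measurable.
by move=> /integrableP[].
Qed.

Lemma locally_integrable_lint f : locally_integrable setT f -> lint f.
Proof.
move=> [mf _ hf]; split => // a b; apply/integrableP; split.
  by apply/measurable_EFinP; exact: measurable_funS mf.
by apply: hf => //; exact: segment_compact.
Qed.

Lemma rint_bump u a b n : lint u -> rint setT (fun x => u x * bump a b n x).
Proof.
move=> lu; apply: (@rint_compact_support _ a b).
  exact: lint_Mcontinuous lu (@bump_continuous a b n).
move=> x nx; rewrite bump_support ?mulr0// => xab; apply: nx; exact: subset_itv_oo_cc xab.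
Qed.

(** Lebesgue's differentiation theorem recovers h from its integrals. *)
Lemma ae_eq0_of_int0 h : lint h ->
  (forall a b, a <= b -> \int[mu]_(x in `[a, b]) h x = 0) ->
  {ae mu, forall x, h x = 0}.
Proof.
move=> hh h0.
have key n : {ae mu, forall x, - n%:R < x -> h x = 0}.
  have /= := FTC1 (hh.2 (- n%:R)) (lint_locally_integrable hh).
  apply: ae_imp => x hx nx; have [_ <-] := hx nx.
  rewrite derive1E (_ : (fun y => _) = cst 0) ?derive_cst//.
  apply/funext => y; have [ny|yn] := leP (- n%:R) y; first exact: h0.
  by rewrite set_itv_ge ?Rintegral_set0// bnd_simp -ltNge.
have := @ae_foralln _ TR R mu _ key; apply: ae_imp => x hx.
apply: (hx (Num.Def.archi_bound `|x|)).
rewrite ltrNl (le_lt_trans (ler_norm _))// normrN.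
by rewrite Num.Theory.archi_boundP.
Qed.

(** Dominated convergence, the test functions converging to the indicator function
    of ]a, b[. *)
Lemma int0_of_bump h a b : lint h -> a <= b ->
  (forall n, \int[mu]_x (h x * bump a b n x) = 0) ->
  \int[mu]_(x in `[a, b]) h x = 0.
Proof.
move=> hh ab h0; have mh := hh.1.
have -> : \int[mu]_(x in `[a, b]) h x = \int[mu]_x (h x * \1_([set` `]a, b[]) x).
  have [->|nab] := eqVneq a b.
    rewrite Ipt (_ : (fun _ => _) = cst 0) ?Rintegral_cst ?mul0r//.
    by apply/funext => x; rewrite set_itvoo0 indic0 mulr0.
  rewrite -(Rintegral_itv_obnd_cbnd (b := BRight b)); last first.
    by apply: rintS (hh.2 a b) => //; exact: subset_itv_oc_cc.
  rewrite -Rintegral_itv_bndo_bndc; last first.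
    by apply: rintS (hh.2 a b) => //; exact: subset_itv_oo_cc.
  rewrite Rintegral_mkcond; congr fine; congr integral; apply/funext => x.
  by rewrite patchE indicE; case: ifP; rewrite ?mulr1 ?mulr0.
have : \int[mu]_x (h x * bump a b n x) @[n --> \oo] -->
    \int[mu]_x (h x * \1_([set` `]a, b[]) x).
  apply: (@Rintegral_cvg_dominated _ _ _ (fun x => `|h x| * \1_([set` `[a, b]]) x)).
  - by move=> n; apply: measurable_funM => //; apply: continuous_measurable_fun; exact: bump_continuous.
  - by apply: measurable_funM => //; exact: measurable_indic.
  - apply: (@rint_compact_support _ a b); last by move=> x nx; rewrite indicE memNset ?mulr0.
    have := lint_bounded (k := 1) (f := \1_([set` `[a, b]]) : R -> R) _ _ (lint_norm hh).
    under [in X in _ -> X]eq_fun do rewrite mulrC; apply; first exact: measurable_indic.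
    by move=> x; rewrite indicE; case: (_ \in _); rewrite ?normr1 ?normr0.
  - by move=> x; apply: cvgMl_tmp; exact: bump_cvg.
  - move=> n x; rewrite normrM ler_wpM2l// indicE ger0_norm ?bump_ge0//.
    have [xab|xab] := pselect ([set` `[a, b]] x); first by rewrite mem_set// bump_le1.
    by rewrite memNset// bump_support// => h1; apply: xab; exact: subset_itv_oo_cc h1.
under eq_fun do rewrite h0.
move=> h1; have h2 : (0 : R) @[_ --> \oo] --> (0 : R) by exact: cvg_cst.
by apply: (@cvg_unique _ (@Rhausdorff R) _ _ _ _ h1 h2).
Qed.

Lemma ae_eq0_of_bump h : lint h ->
  (forall a b n, a <= b -> \int[mu]_x (h x * bump a b n x) = 0) ->
  {ae mu, forall x, h x = 0}.
Proof.
move=> hh h0; apply: ae_eq0_of_int0 => // a b ab.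
by apply: int0_of_bump => // n; exact: h0.
Qed.

(** ** Almost everywhere statements about continuous functions *)

Lemma ae_exists_itv (P : R -> Prop) c d : c < d -> {ae mu, forall x, P x} ->
  exists2 x, c < x < d & P x.
Proof.
move=> cd [N [mN N0 PN]]; apply: contrapT => H.
have sub : [set` `]c, d[] `<=` N.
  move=> x /=; rewrite in_itv/= => xcd; apply: PN => /= Px; apply: H; by exists x.
have : (mu [set` `]c, d[] <= mu N)%E by apply: le_measure => //; rewrite inE//; exact: measurable_itv.
rewrite N0 lebesgue_measure_itv/= lte_fin cd -EFinD lee_fin.
by rewrite subr_le0 leNgt cd.
Qed.

Lemma ae_continuous_eq0 F a b : a < b -> continuous F ->
  {ae mu, forall x, a < x < b -> F x = 0} -> forall x, a <= x <= b -> F x = 0.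
Proof.
move=> ab cF h x /andP[ax xb]; apply/eqP/negPn/negP => Fx0.
have : \forall y \near x, F y != 0.
  exact: (cvgr_neq0 _ (cF x)).
move=> [e /= e0 he].
pose c := Num.max a (x - e); pose d := Num.min b (x + e).
have cd : c < d.
  by rewrite gt_max !lt_min ab/=; apply/and3P; split; lra.
have [y /andP[]] := ae_exists_itv cd h.
rewrite gt_max lt_min => /andP[ay xey] /andP[yb yxe] /(_ _) Fy.
have := he y; rewrite /= Fy ?ay ?yb// eqxx => /(_ _)/negP; apply => //.
by rewrite /= ltr_distlC; apply/andP; split; lra.
Qed.

Lemma ae_continuous_ge F c : continuous F -> {ae mu, forall x, c <= F x} ->
  forall x, c <= F x.
Proof.
move=> cF h x; rewrite leNgt; apply/negP => Fxc.
have : \forall y \near x, F y < c := cvgr_lt _ (cF x) c Fxc.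
move=> [e /= e0 he]; have xe : x - e < x + e by lra.
have [y /andP[y1 y2]] := ae_exists_itv xe h.
have := he y; rewrite /= ltr_distlC y1 y2 => /(_ isT) Fy; lra.
Qed.

Lemma ae_continuous_eq F f g : continuous F -> continuous f -> {ae mu, forall x, g x = F x} ->
  {ae mu, forall x, g x = f x} -> forall x, F x = f x.
Proof.
move=> cF cf gF gf x.
have c0 : continuous (fun x => F x - f x) by move=> z; apply: cvgB; [exact: cF|exact: cf].
have h : {ae mu, forall y, x < y < x + 1 -> F y - f y = 0}.
  by apply: ae_imp2 gF gf => y <- -> _; rewrite subrr.
apply/eqP; rewrite -subr_eq0; apply/eqP.
by apply: (ae_continuous_eq0 _ c0 h); rewrite ?ltrDl// lexx lerDl ler01.
Qed.

(** ** Weak derivatives and absolutely continuous representatives *)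

Lemma is_derive_primitive w x : continuous w -> is_derive x 1 (primitive w) (w x).
Proof.
move=> cw; have lw : lint w := continuous_lint cw.
have x1 : x - 1 < x by rewrite ltrBlDr ltrDl.
have x2 : x < x + 1 by rewrite ltrDl.
have [dF eF] := continuous_FTC1 x2 (lw.2 (x - 1) _) x1 (cw x).
apply: (@near_eq_is_derive R R R (fun z => primitive w (x - 1) +
    \int[mu]_(t in `[x - 1, z]) w t)).
  near=> z; rewrite -primitiveB ?[_ + (_ - _)]addrC ?subrK//.
  by apply/ltW; near: z; exact: lt_nbhsr.
have dG : is_derive x 1 (fun z => \int[mu]_(t in `[x - 1, z]) w t) (w x).
  exact: is_derive1_of_derive1 dF eF.
by refine (is_derive1_eq (is_deriveD (is_derive_cst (primitive w (x - 1)) x 1) dG) _); rewrite add0r.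
Unshelve. all: by end_near.
Qed.

Lemma AC_of_derive F f : continuous f -> (forall x, is_derive x 1 F (f x)) -> AC F f.
Proof.
move=> cf dF; have lf : lint f := continuous_lint cf.
split => // a b ab; rewrite -primitiveB//.
have h : F b - primitive f b = F a - primitive f a.
  apply: (@is_derive_0_is_cst _ (fun x => F x - primitive f x)) => x.
  by refine (is_derive1_eq (is_deriveB (dF x) (is_derive_primitive x cf)) _); rewrite subrr.
by lra.
Qed.

Lemma test_function_cont Omega phi : test_function Omega phi ->
  continuous phi /\ continuous (derive1 phi).
Proof.
move=> [d _]; split=> x.
  by have /derivable1_diffP/differentiable_continuous := d 0%N x.
by have /derivable1_diffP/differentiable_continuous := d 1%N x.
Qed.

Lemma test_function_AC Omega phi : test_function Omega phi -> AC phi (derive1 phi).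
Proof.
move=> h; have [_ c1] := test_function_cont h; apply: AC_of_derive => // x.
exact: is_derive1_of_derive1 (h.1 0%N x) erefl.
Qed.

Lemma test_function_deriv0 Omega phi : test_function Omega phi ->
  exists2 K, compact K & K `<=` Omega /\
    forall x, ~ K x -> phi x = 0 /\ (derive1 phi) x = 0.
Proof.
move=> [_ [K [cK KO K0]]]; exists K => //; split => // x nK; split; first exact: K0.
rewrite derive1E (near_eq_derive (g := cst 0)) ?derive_cst//.
have : open (~` K) by apply: closed_openC; exact: compact_closed cK.
rewrite openE => /(_ x nK); apply: filterS => y; exact: K0.
Qed.

(** The derivative of F p has integral zero, since F p has compact support. *)
Lemma AC_parts_compact F f p q a b : AC F f -> AC p q -> continuous q ->
  (forall x, ~ [set` `[a, b]] x -> p x = 0 /\ q x = 0) ->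
  \int[mu]_x (F x * q x) = - \int[mu]_x (f x * p x).
Proof.
move=> hF hp cq h0; have cF := AC_continuous hF; have cp := AC_continuous hp.
have iFp : rint setT (fun x => F x * p x).
  apply: (@rint_compact_support _ a b); last by move=> x /h0[-> _]; rewrite mulr0.
  exact: lint_continuousM (continuous_lint cp).
have iFq : rint setT (fun x => F x * q x).
  apply: (@rint_compact_support _ a b); last by move=> x /h0[_ ->]; rewrite mulr0.
  exact: lint_continuousM (AC_lint hp).
have ifp : rint setT (fun x => f x * p x).
  apply: (@rint_compact_support _ a b); last by move=> x /h0[-> _]; rewrite mulr0.
  exact: lint_Mcontinuous (AC_lint hF) cp.
have := Rintegral_AC_deriv_eq0 (AC_mul hF hp) iFp (rintD measurableT ifp iFq).
by rewrite RintegralD// => /eqP; rewrite addrC addr_eq0 => /eqP.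
Qed.

Lemma AC_weak_deriv F f : AC F f -> is_weak_deriv setT F f.
Proof.
move=> hF; split.
- exact: lint_locally_integrable (continuous_lint (AC_continuous hF)).
- exact: lint_locally_integrable (AC_lint hF).
- move=> phi tphi; have [K cK [_ K0]] := test_function_deriv0 tphi.
  have [N KN] := compact_sub_itv cK.
  apply: (AC_parts_compact (a := - N) (b := N) hF (test_function_AC tphi)).
    exact: (test_function_cont tphi).2.
  by move=> x nx; apply: K0 => /KN.
Qed.

Definition smooth f := forall (n : nat) x, derivable (derive1n n f) x 1.

Lemma smooth_sub_scale f g c : smooth f -> smooth g -> smooth (fun x => f x - c * g x).
Proof.
move=> sf sg n x.
suff -> : derive1n n (fun x => f x - c * g x) =
    (fun x => derive1n n f x - c * derive1n n g x).
  by apply: derivableB; [exact: sf|apply: derivableM => //; exact: sg].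
elim: n => [//|n IH]; rewrite !derive1nS IH; apply/funext => y.
have df : is_derive y 1 (derive1n n f) (derive1 (derive1n n f) y).
  exact: is_derive1_of_derive1 (sf n y) erefl.
have dg : is_derive y 1 (derive1n n g) (derive1 (derive1n n g) y).
  exact: is_derive1_of_derive1 (sg n y) erefl.
have dcg := is_deriveM (is_derive_cst c y 1) dg.
have d := is_deriveB df dcg.
rewrite [LHS]derive1E; rewrite (@derive_val _ _ _ _ _ _ _ d) /= scaler0 addr0.
by rewrite -![_ *: _]/(_ * _).
Qed.

Lemma smooth_continuous f : smooth f -> continuous f.
Proof. by move=> sf x; have /derivable1_diffP/differentiable_continuous := sf 0%N x. Qed.

(** The primitive of w from a vanishes to the left of a, and to the right of b because
    the mean of w is zero. *)
Lemma zero_mean_test w a b : smooth w -> a <= b ->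
  (forall x, ~ [set` `[a, b]] x -> w x = 0) -> \int[mu]_x w x = 0 ->
  exists2 phi, test_function setT phi & [/\ derive1 phi = w, AC phi w &
    forall x, ~ [set` `[a, b]] x -> phi x = 0].
Proof.
move=> sw ab w0 iw; have cw := smooth_continuous sw.
have lw : lint w := continuous_lint cw.
pose phi x := primitive w x - primitive w a.
have dphi x : is_derive x 1 phi (w x).
  have := is_deriveB (is_derive_primitive x cw) (is_derive_cst (primitive w a) x 1).
  by rewrite subr0.
have ephi : derive1 phi = w by apply/funext => x; rewrite derive1E derive_val.
have phi0 x : ~ [set` `[a, b]] x -> phi x = 0.
  move=> nx; have [xa|ax] := ltP x a.
    rewrite /phi -opprB primitiveB ?(ltW xa)//.
    rewrite int_eq0 ?oppr0//.
    by move=> y /andP[_ ya]; apply: w0; rewrite /= in_itv/= leNgt ya.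
  have xb : b <= x.
    by rewrite leNgt; apply/negP => xb; apply: nx; rewrite /= in_itv/= ax ltW.
  rewrite /phi primitiveB// -[RHS]iw Rintegral_mkcond; congr fine; congr integral.
  apply/funext => y; rewrite patchE; case: ifPn => //.
  move=> /negP ny; rewrite w0// => yab; apply: ny; rewrite inE.
  by move: yab; rewrite /= !in_itv/= => /andP[-> /le_trans->].
exists phi; last by split => //; exact: AC_of_derive.
split; last by exists [set` `[a, b]]; split => //; exact: segment_compact.
case=> [|n] x; first by case: (dphi x).
by rewrite derive1Sn ephi; exact: sw.
Qed.

(** The lemma of du Bois-Reymond. The difference h of f and a primitive of g is
    orthogonal to the derivatives of the test functions, that is, to the test functions
    of zero mean. Every test function is a multiple of a fixed one, th, plus a function
    of zero mean, so that h is constant. *)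
Lemma weak_deriv_AC f g : is_weak_deriv setT f g ->
  exists2 F, AC F g & {ae mu, forall x, f x = F x}.
Proof.
move=> [lf lg fg]; have {}lf := locally_integrable_lint lf.
have {}lg := locally_integrable_lint lg.
have hG := AC_primitive lg; set G := primitive g in hG.
have cG := AC_continuous hG.
have lG : lint G := continuous_lint cG.
pose h x := f x - G x; have lh : lint h by exact: lintB.
have int_bump a b n : rint setT (bump a b n).
  have := rint_bump a b n (lint_cst 1); congr rint.
  by apply/funext => x; rewrite mul1r.
have int_cbump u a b n : lint u -> rint setT (fun x => u x * bump a b n x) := @rint_bump u a b n.
have [n I0n] : exists n, \int[mu]_x bump 0 1 n x != 0.
  apply: contrapT => H; have H0 n : \int[mu]_x bump 0 1 n x = 0.
    by apply/eqP/negPn/negP => Hn; apply: H; exists n.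
  have := @int0_of_bump (fun=> 1) 0 1 (lint_cst 1) ler01.
  rewrite Icst// subr0 mul1r => h10; have /eqP := oner_neq0 R; apply; apply: h10 => n.
  by under eq_Rintegral do rewrite mul1r.
pose th := bump 0 1 n; set I0 := \int[mu]_x _ in I0n.
(* The constant for which h - C is also orthogonal to th. *)
pose C := (\int[mu]_x (h x * th x)) / I0.
exists (fun x => G x + C).
  by have := AC_add hG (AC_cst C); congr AC; apply/funext => x; rewrite addr0.
suff : {ae mu, forall x, h x - C = 0}.
  by apply: ae_imp => x /eqP; rewrite /h subr_eq0 subr_eq addrC => /eqP.
apply: ae_eq0_of_bump; first exact: lintB lh (lint_cst C).
move=> a b m ab.
pose c := (\int[mu]_x bump a b m x) / I0; pose w x := bump a b m x - c * th x.
pose a' := Num.min a 0; pose b' := Num.max b 1.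
have a'b' : a' <= b' by rewrite le_max ge_min ab.
have w0 x : ~ [set` `[a', b']] x -> w x = 0.
  rewrite /w /th => nx; rewrite !bump_support ?mulr0 ?subr0// => xab; apply: nx; move: xab;
    rewrite /= !in_itv/= => /andP[/ltW h1 /ltW h2];
    by rewrite ge_min le_max h1 h2 ?orbT.
have sw : smooth w by apply: smooth_sub_scale; exact: bump_smooth.
have iw : \int[mu]_x w x = 0.
  rewrite /w RintegralB//; [|exact: int_bump|exact/rintZ/int_bump].
  by rewrite RintegralZl//; [rewrite -/I0 /c divfK// subrr|exact: int_bump].
have [phi tphi [ephi hphi phi0]] := zero_mean_test sw a'b' w0 iw.
have cw := smooth_continuous sw.
have e1 := fg _ tphi; rewrite ephi in e1.
have e2 : \int[mu]_x (G x * w x) = - \int[mu]_x (g x * phi x).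
  by apply: (AC_parts_compact (a := a') (b := b') hG hphi cw) => x nx; split; [exact: phi0|exact: w0].
have iu u : lint u -> rint setT (fun x => u x * w x).
  move=> lu; have -> : (fun x => u x * w x) = (fun x => u x * bump a b m x - c * (u x * th x)).
    by apply/funext => x; rewrite /w; ring.
  exact: (rintB measurableT (int_cbump u a b m lu) (rintZ c measurableT (int_cbump u 0 1 n lu))).
have e3 : \int[mu]_x (h x * w x) = 0.
  under eq_Rintegral do rewrite mulrBl.
  by rewrite RintegralB//; [rewrite e1 e2 subrr|exact: iu|exact: iu].
have e4 : \int[mu]_x (h x * w x) = \int[mu]_x (h x * bump a b m x) - c * \int[mu]_x (h x * th x).
  rewrite -RintegralZl//; last exact: int_cbump.
  rewrite -RintegralB//; [|exact: int_cbump|exact/rintZ/int_cbump].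
  by apply: eq_Rintegral => x _; rewrite /w; ring.
under eq_Rintegral do rewrite mulrBl.
rewrite RintegralB//; [|exact: int_cbump|exact/rintZ/int_bump].
rewrite RintegralZl//; last exact: int_bump.
rewrite -[RHS]e3 e4 /c /C; congr (_ - _); field.
by rewrite I0n.
Qed.

Lemma weak_deriv_restrict Omega f g : open Omega ->
  is_weak_deriv setT f g -> is_weak_deriv Omega f g.
Proof.
move=> oO [lf lg fg].
have mO : mset Omega by exact: open_measurable.
have res u : locally_integrable setT u -> locally_integrable Omega u.
  move=> [mu_ _ hu]; split => //; first exact: measurable_funS mu_.
  by move=> K _; exact: hu.
split; [exact: res|exact: res|] => phi tphi.
have [K cK [KO K0]] := test_function_deriv0 tphi.
have tphiT : test_function setT phi.
  by case: tphi => d [K' [cK' _ K'0]]; split => //; exists K'.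
have e (u v : R -> R) : (forall x, ~ K x -> v x = 0) ->
    \int[mu]_(x in Omega) (u x * v x) = \int[mu]_x (u x * v x).
  move=> v0; rewrite Rintegral_mkcond; apply: eq_Rintegral => x _.
  rewrite patchE; case: ifPn => // /negP nx.
  by rewrite v0 ?mulr0// => /KO Kx; apply: nx; rewrite inE.
by have := fg _ tphiT; rewrite !e// => x /K0[].
Qed.

Lemma weak_deriv_unique f g1 g2 : is_weak_deriv setT f g1 -> is_weak_deriv setT f g2 ->
  {ae mu, forall x, g1 x = g2 x}.
Proof.
move=> /weak_deriv_AC[F1 h1 e1] /weak_deriv_AC[F2 h2 e2].
have F12 := ae_continuous_eq (AC_continuous h1) (AC_continuous h2) e1 e2.
have [hd ed] := AC_sub h1 h2.
have : {ae mu, forall x, g1 x - g2 x = 0}.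
  by apply: ae_eq0_of_int0 => // a b ab; rewrite -ed// !F12 !subrr.
by apply: ae_imp => x /eqP; rewrite subr_eq0 => /eqP.
Qed.

(** The weak derivatives are only locally integrable near A and B; they are compared on
    each [a, b] in ]A, B[, where their difference, continued by 0, is integrable and
    orthogonal to the test functions supported in [a, b]. *)
Lemma weak_deriv_unique_itv A B f g1 g2 :
  is_weak_deriv [set` `]A, B[] f g1 -> is_weak_deriv [set` `]A, B[] f g2 ->
  {ae mu, forall x, A < x < B -> g1 x = g2 x}.
Proof.
set Omega := [set` `]A, B[] => -[_ [m1 _ l1] h1] [_ [m2 _ l2] h2].
have key a b : A < a -> b < B -> {ae mu, forall x, a <= x <= b -> g1 x = g2 x}.
  move=> Aa bB; have sub : [set` `[a, b]] `<=` Omega.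
    move=> x; rewrite /Omega /= !in_itv/= => /andP[ax xb].
    by rewrite (lt_le_trans Aa ax) (le_lt_trans xb bB).
  pose h : R -> R := (fun x => g1 x - g2 x) \_ [set` `[a, b]].
  have ii u : mfun Omega u ->
      (forall K, K `<=` Omega -> compact K -> (\int[mu]_(x in K) `|u x|%:E < +oo)%E) ->
      rint [set` `[a, b]] u.
    move=> mu_ hu; apply/integrableP; split.
      by apply/measurable_EFinP; exact: (measurable_funS (measurable_itv _) sub mu_).
    by apply: hu => //; exact: segment_compact.
  have i1 := ii _ m1 l1; have i2 := ii _ m2 l2.
  have ih : rint setT h.
    have := (@integrable_mkcond _ TR R mu _ (EFin \o (fun x => g1 x - g2 x))
      (measurable_itv `[a, b])).1 (rintB (measurable_itv _) i1 i2).
    by rewrite restrict_EFin.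
  have lh := rint_lint ih.
  have hb c d n : a <= c -> d <= b -> \int[mu]_x (h x * bump c d n x) = 0.
    move=> ac db; have scd : [set` `]c, d[] `<=` [set` `[a, b]].
      move=> x; rewrite /= !in_itv/= => /andP[cx xd].
      by rewrite (le_trans ac (ltW cx)) (le_trans (ltW xd) db).
    have tb : test_function Omega (bump c d n).
      apply: bump_test => x xcd; apply: sub; move: xcd; rewrite /= !in_itv/= => /andP[cx xd].
      by rewrite (le_trans ac cx) (le_trans xd db).
    have e u : \int[mu]_(x in Omega) (u x * bump c d n x) =
        \int[mu]_(x in `[a, b]) (u x * bump c d n x).
      rewrite Rintegral_mkcond [RHS]Rintegral_mkcond; congr fine; congr integral.
      apply/funext => x; rewrite !patchE.
      have [xab|nab] := pselect ([set` `[a, b]] x); first by rewrite !mem_set//; exact: sub.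
      rewrite [in RHS]memNset//; case: ifP => // _.
      by rewrite bump_support ?mulr0// => /scd.
    have e12 : \int[mu]_(x in `[a, b]) (g1 x * bump c d n x) =
        \int[mu]_(x in `[a, b]) (g2 x * bump c d n x).
      by rewrite -!e; apply: oppr_inj; rewrite -h1// -h2.
    have ib u : rint [set` `[a, b]] u -> rint [set` `[a, b]] (fun x => u x * bump c d n x).
      move=> iu; have -> : (fun x => u x * bump c d n x) = (fun x => bump c d n x * u x).
        by apply/funext => x; rewrite mulrC.
      apply: (@rint_bounded _ _ _ _ 1) => //.
        apply: (measurable_funS measurableT) => //.
        exact: continuous_measurable_fun (@bump_continuous c d n).
      by move=> x _; rewrite ger0_norm ?bump_ge0// bump_le1.
    transitivity (\int[mu]_(x in `[a, b]) (g1 x * bump c d n x - g2 x * bump c d n x)).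
      rewrite [RHS]Rintegral_mkcond; congr fine; congr integral.
      by apply/funext => x; rewrite /h !patchE; case: ifP => _; rewrite ?mul0r// mulrBl.
    by rewrite RintegralB//; [rewrite e12 subrr|exact: ib|exact: ib].
  have : {ae mu, forall x, h x = 0}.
    apply: ae_eq0_of_int0 => // c d cd.
    pose c' := Num.max c a; pose d' := Num.min d b.
    have sub' : [set` `[c', d']] = [set` `[c, d]] `&` [set` `[a, b]].
      apply/seteqP; split => x /=; rewrite !in_itv/= ge_max le_min.
        by move=> /andP[/andP[-> ->] /andP[-> ->]].
      by move=> [/andP[-> ->] /andP[-> ->]].
    have -> : \int[mu]_(x in `[c, d]) h x = \int[mu]_(x in `[c', d']) h x.
      rewrite sub' Rintegral_mkcondr; apply: eq_Rintegral => x _.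
      by rewrite /h !patchE; case: ifP.
    have [c'd'|d'c'] := leP c' d'; last by rewrite set_itv_ge ?Rintegral_set0// bnd_simp -ltNge.
    apply: int0_of_bump => // n; apply: hb; first by rewrite le_max lexx orbT.
    by rewrite ge_min lexx orbT.
  apply: ae_imp => x; rewrite /h patchE => hx xab; move: hx.
  by rewrite mem_set//= => /eqP; rewrite subr_eq0 => /eqP.
have := @ae_foralln _ TR R mu _ (fun n => key (A + n.+1%:R^-1) (B - n.+1%:R^-1) _ _).
move=> h; have {h} : {ae mu, forall x, forall n : nat, A + n.+1%:R^-1 <= x <= B - n.+1%:R^-1 -> g1 x = g2 x}.
  by apply: h => n; rewrite ?ltrDl ?ltrBlDr ?ltrDl invr_gt0.
apply: ae_imp => x hx /andP[Ax xB].
pose m := Num.min (x - A) (B - x); have m0 : 0 < m by rewrite lt_min !subr_gt0 Ax.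
have hn := Num.Theory.archi_boundP (ltW (_ : 0 < m^-1)).
set n := Num.Def.archi_bound _ in hn.
have {}hn : n.+1%:R^-1 <= m.
  rewrite -(invrK m) lef_pV2 ?posrE ?invr_gt0 ?ltr0n//.
  by rewrite (le_trans (ltW (hn _)))// ?invr_gt0// ler_nat.
move: hn; rewrite le_min => /andP[n1 n2].
by apply: (hx n); rewrite addrC -lerBrDr n1/= lerBrDl addrC -lerBrDl.
Qed.

End TestFunctions.

(** * Square integrable functions depending on time *)
Section SquareIntegrable.
Context {R : realType}.
Local Notation mu := (@lebesgue_measure R).
Local Notation TR := (measurableTypeR R).
Local Notation mset D := (@measurable _ TR D).
Local Notation mfun D f := (@measurable_fun _ _ TR R D f).
Implicit Types (D Omega : set R) (f g h u v w k : R -> R) (a b c x K : R).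

Definition sqint f : Prop := mfun setT f /\ rint setT (fun x => f x ^+ 2).

Definition n2 f : R := Num.sqrt (\int[mu]_x (f x ^+ 2)).

Lemma norm_mul_le_sqr a b : `|a * b| <= a ^+ 2 + b ^+ 2.
Proof.
rewrite ler_norml; apply/andP; split; first by have := sqr_ge0 (a + b); nra.
by have := sqr_ge0 (a - b); nra.
Qed.

Lemma sqint_mul f g : sqint f -> sqint g -> rint setT (fun x => f x * g x).
Proof.
move=> [mf hf] [mg hg].
apply: (@rint_dominated _ _ _ (fun x => f x ^+ 2 + g x ^+ 2)) => //.
- exact: measurable_funM.
- exact: rintD.
- by move=> x _; exact: norm_mul_le_sqr.
Qed.

Lemma sqintD f g : sqint f -> sqint g -> sqint (fun x => f x + g x).
Proof.
move=> hf hg; split; first exact: measurable_funD hf.1 hg.1.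
have -> : (fun x => (f x + g x) ^+ 2) = (fun x => (f x ^+ 2 + 2 * (f x * g x)) + g x ^+ 2).
  by apply/funext => x; ring.
by apply: rintD hg.2 => //; apply: rintD hf.2 _ => //; exact/rintZ/sqint_mul.
Qed.

Lemma sqint_bounded k K f : mfun setT k -> (forall x, `|k x| <= K) -> sqint f ->
  sqint (fun x => k x * f x).
Proof.
move=> mk kK [mf hf]; split; first exact: measurable_funM.
have -> : (fun x => (k x * f x) ^+ 2) = (fun x => k x ^+ 2 * f x ^+ 2).
  by apply/funext => x; rewrite exprMn.
apply: (@rint_bounded _ _ _ _ (K ^+ 2)) => //; first exact: measurable_funX.
move=> x _; rewrite normrX lerXn2r ?nnegrE//.
by rewrite (le_trans _ (kK x)).
Qed.

Lemma sqintZ c f : sqint f -> sqint (fun x => c * f x).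
Proof. by move=> hf; apply: (@sqint_bounded (fun=> c) `|c|). Qed.

Lemma sqintB f g : sqint f -> sqint g -> sqint (fun x => f x - g x).
Proof.
move=> hf hg; have -> : (fun x => f x - g x) = (fun x => f x + (-1) * g x).
  by apply/funext => x; rewrite mulN1r.
exact/sqintD/sqintZ.
Qed.

Lemma sqint0 : sqint (fun=> 0).
Proof.
split => //; have -> : (fun=> 0 ^+ 2) = (fun=> (0 : R)) :> (R -> R).
  by apply/funext => x; rewrite expr0n.
exact: integrable0.
Qed.

Lemma sqint_ae f g : mfun setT g -> {ae mu, forall x, f x = g x} -> sqint f -> sqint g.
Proof.
move=> mg fg [mf hf]; split => //; apply: ae_eq_rint hf => //.
  exact: measurable_funX.
by apply: ae_imp fg => x ->.
Qed.

Lemma n2_ge0 f : 0 <= n2 f. Proof. exact: sqrtr_ge0. Qed.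

Lemma sqr_n2 f : n2 f ^+ 2 = \int[mu]_x (f x ^+ 2).
Proof. by rewrite sqr_sqrtr// Rintegral_ge0// => x _; exact: sqr_ge0. Qed.

Lemma n2_ae f g : mfun setT f -> mfun setT g -> {ae mu, forall x, f x = g x} -> n2 f = n2 g.
Proof.
move=> mf mg fg; rewrite /n2; congr Num.sqrt; apply: ae_eq_Rintegral => //.
- exact: measurable_funX.
- exact: measurable_funX.
- by apply: ae_imp fg => x ->.
Qed.

Lemma n2_le f c : 0 <= c -> \int[mu]_x (f x ^+ 2) <= c ^+ 2 -> n2 f <= c.
Proof.
move=> c0 h; rewrite -(ler_pXn2r (ltn0Sn 1)) ?nnegrE ?n2_ge0//.
by rewrite sqr_n2.
Qed.

(** Cauchy-Schwarz, from the sign of the quadratic polynomial in c given by the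
    integral of (f - c g)^2. *)
Lemma Cauchy_Schwarz f g : sqint f -> sqint g ->
  `|\int[mu]_x (f x * g x)| <= n2 f * n2 g.
Proof.
move=> hf hg; set I := \int[mu]_x _.
have key c : 0 <= n2 f ^+ 2 - 2 * c * I + c ^+ 2 * n2 g ^+ 2.
  rewrite !sqr_n2 -!RintegralZl//; [|exact: sqint_mul|exact: hg.2].
  rewrite -RintegralB//; [|exact: hf.2|exact/rintZ/sqint_mul].
  rewrite -RintegralD//; [|by apply: rintB => //; [exact: hf.2|exact/rintZ/sqint_mul]|exact/rintZ/hg.2].
  apply: Rintegral_ge0 => x _; have := sqr_ge0 (f x - c * g x).
  by congr (_ <= _); ring.
have A0 := n2_ge0 f; have B0 := n2_ge0 g; clearbody I.
move: (n2 f) (n2 g) A0 B0 key => A B A0 B0 key.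
have {}key : I ^+ 2 <= A ^+ 2 * B ^+ 2.
  have [B1|B1] := eqVneq B 0.
    have [->|I0] := eqVneq I 0; first by rewrite expr0n mulr_ge0 ?sqr_ge0.
    have := key ((A ^+ 2 + 1) / I); rewrite B1 expr0n/= mulr0 addr0 -mulrA divfK//.
    by have := sqr_ge0 A; move: (A ^+ 2) => a a0 h; exfalso; lra.
  have B2 : 0 < B ^+ 2 by rewrite exprn_gt0// lt_neqAle eq_sym B1.
  have := key (I / B ^+ 2); rewrite -subr_ge0.
  have -> : A ^+ 2 - 2 * (I / B ^+ 2) * I + (I / B ^+ 2) ^+ 2 * B ^+ 2 =
     (A ^+ 2 * B ^+ 2 - I ^+ 2) / B ^+ 2 by field.
  by rewrite pmulr_lge0 ?invr_gt0.
rewrite -(ler_pXn2r (ltn0Sn 1)) ?nnegrE ?mulr_ge0// real_normK ?num_real//.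
by rewrite exprMn.
Qed.

Lemma n2_triangle f g : sqint f -> sqint g -> n2 (fun x => f x + g x) <= n2 f + n2 g.
Proof.
move=> hf hg; apply: n2_le; first by rewrite addr_ge0 ?n2_ge0.
have -> : \int[mu]_x (f x + g x) ^+ 2 =
    \int[mu]_x (f x ^+ 2) + 2 * \int[mu]_x (f x * g x) + \int[mu]_x (g x ^+ 2).
  rewrite -RintegralZl//; last exact: sqint_mul.
  rewrite -RintegralD//; [|exact: hf.2|exact/rintZ/sqint_mul].
  rewrite -RintegralD//; [|by apply: rintD => //; [exact: hf.2|exact/rintZ/sqint_mul]|exact: hg.2].
  by apply: eq_Rintegral => x _; ring.
rewrite -!sqr_n2; have := le_trans (ler_norm _) (Cauchy_Schwarz hf hg).
rewrite sqrrD -[n2 f * n2 g *+ 2]mulr_natl; lra.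
Qed.

Lemma n2Z c f : sqint f -> n2 (fun x => c * f x) = `|c| * n2 f.
Proof.
move=> hf; rewrite /n2 -sqrtr_sqr -sqrtrM ?sqr_ge0//; congr Num.sqrt.
rewrite -RintegralZl//; last exact: hf.2.
by apply: eq_Rintegral => x _; rewrite exprMn.
Qed.

Lemma n2N f : sqint f -> n2 (fun x => - f x) = n2 f.
Proof.
by move=> hf; rewrite /n2; congr Num.sqrt; apply: eq_Rintegral => x _; rewrite sqrrN.
Qed.

Lemma n2B f g : sqint f -> sqint g -> n2 (fun x => f x - g x) <= n2 f + n2 g.
Proof.
move=> hf hg; rewrite -(n2N hg); apply: n2_triangle => //.
by have := sqintZ (-1) hg; congr sqint; apply/funext => x; rewrite mulN1r.
Qed.

Lemma n2_0 : n2 (fun=> 0) = 0.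
Proof.
rewrite /n2 (_ : \int[mu]_x _ = 0) ?sqrtr0//.
transitivity (\int[mu]_x (0 : R)); last by rewrite Rintegral_cst// mul0r.
by apply: eq_Rintegral => x _; rewrite expr0n.
Qed.

Lemma sqint_sum (I : Type) (r : seq I) (P : pred I) (F : I -> R -> R) :
  (forall i, P i -> sqint (F i)) -> sqint (fun x => \sum_(i <- r | P i) F i x).
Proof.
move=> h; elim: r => [|i r IH].
  by have := sqint0; congr sqint; apply/funext => x; rewrite big_nil.
have [Pi|Pi] := boolP (P i).
  by have := sqintD (h i Pi) IH; congr sqint; apply/funext => x; rewrite big_cons Pi.
by have := IH; congr sqint; apply/funext => x; rewrite big_cons (negbTE Pi).
Qed.

Lemma n2_sum (I : Type) (r : seq I) (P : pred I) (F : I -> R -> R) :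
  (forall i, P i -> sqint (F i)) ->
  n2 (fun x => \sum_(i <- r | P i) F i x) <= \sum_(i <- r | P i) n2 (F i).
Proof.
move=> h; elim: r => [|i r IH].
  rewrite big_nil (_ : (fun _ => _) = (fun=> 0)) ?n2_0//.
  by apply/funext => x; rewrite big_nil.
rewrite big_cons; have [Pi|Pi] := boolP (P i).
  have -> : (fun x => \sum_(j <- i :: r | P j) F j x) =
      (fun x => F i x + \sum_(j <- r | P j) F j x).
    by apply/funext => x; rewrite big_cons Pi.
  rewrite (le_trans (n2_triangle (h i Pi) (sqint_sum _ h)))// lerD2l//.
rewrite (_ : (fun _ => _) = (fun x => \sum_(j <- r | P j) F j x))//.
by apply/funext => x; rewrite big_cons (negbTE Pi).
Qed.

(** ** Bounded bilinear forms *)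

Definition bil k f g : R := \int[mu]_x (k x * (f x * g x)).

Lemma bil_rint k K f g : mfun setT k -> (forall x, `|k x| <= K) ->
  sqint f -> sqint g -> rint setT (fun x => k x * (f x * g x)).
Proof.
by move=> mk kK hf hg; apply: (@rint_bounded _ _ _ _ K) => //; exact: sqint_mul.
Qed.

Lemma bil_le k K f g : mfun setT k -> (forall x, `|k x| <= K) ->
  sqint f -> sqint g -> `|bil k f g| <= K * (n2 f * n2 g).
Proof.
move=> mk kK hf hg; have K0 : 0 <= K by apply: le_trans (kK 0).
have hkf := sqint_bounded mk kK hf.
rewrite /bil (_ : \int[mu]_x _ = \int[mu]_x ((k x * f x) * g x)); last first.
  by apply: eq_Rintegral => x _; rewrite mulrA.
rewrite (le_trans (Cauchy_Schwarz hkf hg))// mulrA ler_wpM2r ?n2_ge0//.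
apply: n2_le; first by rewrite mulr_ge0 ?n2_ge0.
rewrite exprMn sqr_n2 -RintegralZl//; last exact: hf.2.
apply: le_Rintegral => //; [exact: hkf.2|exact/rintZ/hf.2|].
move=> x _; rewrite exprMn ler_wpM2r ?sqr_ge0// -[leLHS]real_normK ?num_real//.
by rewrite lerXn2r ?nnegrE// (le_trans _ (kK x)).
Qed.

Section BilinearExpansion.
Variables (k : R -> R) (K : R).
Hypotheses (mk : mfun setT k) (kK : forall x, `|k x| <= K).

Lemma bilDl f g h : sqint f -> sqint g -> sqint h ->
  bil k (fun x => f x + g x) h = bil k f h + bil k g h.
Proof.
move=> hf hg hh; rewrite /bil -RintegralD//; [|exact: bil_rint kK _ _|exact: bil_rint kK _ _].
by apply: eq_Rintegral => x _; ring.
Qed.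

Lemma bilZl c f h : sqint f -> sqint h -> bil k (fun x => c * f x) h = c * bil k f h.
Proof.
move=> hf hh; rewrite /bil -RintegralZl//; last exact: bil_rint kK _ _.
by apply: eq_Rintegral => x _; ring.
Qed.

Lemma bilC f g : bil k f g = bil k g f.
Proof. by apply: eq_Rintegral => x _; ring. Qed.

End BilinearExpansion.

(** ** The norms of the statement *)

Lemma setT_restrict f : f \_ setT = f.
Proof. by apply/funext => x; rewrite patchE in_setT. Qed.

Lemma Lnorm2E f : 'N[mu]_2%:E[EFin \o f]%E = ((\int[mu]_x (f x ^+ 2)%:E) `^ 2^-1)%E.
Proof.
rewrite unlock /Lnorm; congr (_ `^ _)%E; apply: eq_integral => x _ /=.
by rewrite powR_mulrn// -normrX ger0_norm ?sqr_ge0.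
Qed.

Lemma sqint_integral f : sqint f ->
  (\int[mu]_x (f x ^+ 2)%:E)%E = (\int[mu]_x (f x ^+ 2))%:E.
Proof. by move=> [_ hf]; rewrite /Rintegral fineK//; exact: integrable_fin_num. Qed.

Lemma Lnorm2_sqint f : sqint f -> 'N[mu]_2%:E[EFin \o f]%E = (n2 f)%:E.
Proof.
move=> hf; rewrite Lnorm2E sqint_integral// poweR_EFin powR12_sqrt//.
by rewrite Rintegral_ge0// => x _; exact: sqr_ge0.
Qed.

Lemma in_L2P f : in_L2 setT f <-> sqint f.
Proof.
rewrite /in_L2 /in_Lp setT_restrict; split.
  move=> /[dup] h; rewrite inE => /andP[]; rewrite inE => mf _; split => //.
  exact: (Lfun2_integrable_sqr h).
move=> hf; rewrite inE; apply/andP; split; first by rewrite inE; exact: hf.1.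
by rewrite inE /= /finite_norm Lnorm2_sqint// ltry.
Qed.

Lemma L2_norm_restrict Omega f : sqint (f \_ Omega) -> L2_norm Omega f = (n2 (f \_ Omega))%:E.
Proof. by move=> hf; rewrite /L2_norm /Lp_norm Lnorm2_sqint. Qed.

Lemma L2_normE f : sqint f -> L2_norm setT f = (n2 f)%:E.
Proof. by move=> hf; rewrite L2_norm_restrict setT_restrict. Qed.

Lemma L2_norm_ge0 Omega f : (0 <= L2_norm Omega f)%E.
Proof. exact: Lnorm_ge0. Qed.

Lemma le_hypot_l (x y : \bar R) : (0 <= x)%E -> (0 <= y)%E ->
  (x <= (x `^ 2 + y `^ 2) `^ 2^-1)%E.
Proof.
move=> x0 y0; apply: (@le_trans _ _ ((x `^ 2) `^ 2^-1)%E).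
  by rewrite -poweRrM divff ?poweRe1// pnatr_eq0.
apply: gt0_ler_poweR => //.
- by rewrite in_itv/= leey poweR_ge0.
- by rewrite in_itv/= leey adde_ge0 ?poweR_ge0.
- by rewrite leeDl// poweR_ge0.
Qed.

Lemma L2_norm_weak_deriv_le_H1 Omega f :
  (L2_norm Omega (weak_deriv Omega f) <= H1_norm Omega f)%E.
Proof. by rewrite /H1_norm addeC; apply: le_hypot_l; exact: L2_norm_ge0. Qed.

Lemma H1_norm_le Omega f (x y : R) :
  0 <= x -> 0 <= y -> (L2_norm Omega f <= x%:E)%E ->
  (L2_norm Omega (weak_deriv Omega f) <= y%:E)%E -> (H1_norm Omega f <= (x + y)%:E)%E.
Proof.
move=> x0 y0 hx hy; rewrite /H1_norm.
have sq (u : \bar R) (z : R) : (0 <= u)%E -> 0 <= z -> (u <= z%:E)%E -> (u `^ 2 <= (z ^+ 2)%:E)%E.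
  move=> u0 z0 uz; apply: (@le_trans _ _ (z%:E `^ 2)%E); last by rewrite poweR_EFin powR_mulrn.
  by apply: gt0_ler_poweR => //; rewrite in_itv/= ?u0 ?lee_fin ?z0 leey.
apply: (@le_trans _ _ (((x + y) ^+ 2)%:E `^ 2^-1)%E); last first.
  rewrite poweR_EFin powR12_sqrt ?sqr_ge0// sqrtr_sqr ger0_norm// addr_ge0//.
apply: gt0_ler_poweR => //.
- by rewrite in_itv/= adde_ge0 ?poweR_ge0// leey.
- by rewrite in_itv/= lee_fin sqr_ge0 leey.
- apply: (@le_trans _ _ ((x ^+ 2)%:E + (y ^+ 2)%:E)%E).
    by apply: leeD; apply: sq => //; exact: L2_norm_ge0.
  rewrite -EFinD lee_fin; have := mulr_ge0 x0 y0; nra.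
Qed.

(** ** Riemann integrals of square integrable functions *)

Local Notation F := (R -> R^o).
Local Notation L2n := (L2_norm setT : F -> \bar R).

Lemma fctsumE (I : Type) (r : seq I) (c : I -> R) (f : I -> F) :
  (\sum_(i <- r) c i *: f i : F) = (fun x => \sum_(i <- r) c i * f i x).
Proof.
apply/funext => x; elim: r => [|i r IH]; first by rewrite !big_nil.
by rewrite !big_cons -IH.
Qed.

(** The increment of the integral over [a, b] is compared with (b - a) w by means
    of a subdivision of [0, b] that contains a. *)
Lemma integral_increment (f : R -> F) (Ia Ib w : F) a b eps :
  0 <= a -> a <= b -> (forall t, 0 <= t -> sqint (f t)) -> sqint Ia -> sqint Ib ->
  sqint w -> is_integral L2n f 0 a Ia -> is_integral L2n f 0 b Ib ->
  (forall t, a <= t <= b -> n2 (fun x => f t x - w x) <= eps) ->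
  n2 (fun x => Ib x - Ia x - (b - a) * w x) <= (b - a) * eps.
Proof.
move=> a0 ab hf hIa hIb hw fa fb fw.
apply/ler_addgt0Pr => e e0.
have e20 : 0 < e / 2 by rewrite divr_gt0.
have [da da0 {}fa] := fa _ e20; have [db db0 {}fb] := fb _ e20.
pose d := Num.min da db; have d0 : 0 < d by rewrite lt_min da0.
have b0 := le_trans a0 ab.
pose n := Num.Def.archi_bound (b / d).
have hn : b / d < n%:R by rewrite Num.Theory.archi_boundP// divr_ge0// ltW.
have n0 : 0 < n%:R :> R by rewrite (le_lt_trans _ hn)// divr_ge0// ltW.
have nN : n%:R != 0 :> R by rewrite gt_eqF.
have bd : b / n%:R <= d by rewrite ler_pdivrMr// -ler_pdivrMl// mulrC ltW.
pose s i : R := if (i <= n)%N then a * (i%:R / n%:R)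
  else a + (b - a) * ((i - n)%N%:R / n%:R).
have s1 i : (i <= n)%N -> s i = a * (i%:R / n%:R) by rewrite /s => ->.
have s2 i : s (n + i)%N = a + (b - a) * (i%:R / n%:R).
  rewrite /s; case: ifP; last by rewrite addKn.
  rewrite -{2}[n]addn0 leq_add2l leqn0 => /eqP->.
  by rewrite addn0 divff// !mul0r mulr0 addr0 mulr1.
have ds1 i : (i < n)%N -> s i.+1 - s i = a / n%:R.
  move=> ni; rewrite s1// s1 ?(ltnW ni)// -natr1; field; exact: nN.
have ds2 i : s (n + i).+1 - s (n + i)%N = (b - a) / n%:R.
  rewrite -addnS !s2 -natr1; field; exact: nN.
have adn : 0 <= a / n%:R by rewrite divr_ge0.
have bdn : 0 <= (b - a) / n%:R by rewrite divr_ge0// subr_ge0.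
have le_ad : a / n%:R <= d by rewrite (le_trans _ bd)// ler_wpM2r// invr_ge0.
have le_bd : (b - a) / n%:R <= d.
  by rewrite (le_trans _ bd)// ler_wpM2r// ?invr_ge0// lerBlDr lerDl.
have smono i : (i < n + n)%N -> 0 <= s i.+1 - s i <= d.
  move=> ni; have [h|h] := ltnP i n; first by rewrite ds1// adn.
  by rewrite -(subnKC h) ds2 bdn.
have Ha := fa n s s; have Hb := fb (n + n)%N s s.
have {}Ha : n2 (fun x => \sum_(i < n) (s i.+1 - s i) * f (s i) x - Ia x) < e / 2.
  have sq : sqint (fun x => \sum_(i < n) (s i.+1 - s i) * f (s i) x - Ia x).
    apply: sqintB => //; apply: sqint_sum => i _; apply/sqintZ/hf.
    by rewrite s1 ?mulr_ge0 ?divr_ge0// ltnW.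
  rewrite -lte_fin -L2_normE//.
  have -> : (fun x => \sum_(i < n) (s i.+1 - s i) * f (s i) x - Ia x) =
     (\sum_(i < n) (s i.+1 - s i) *: f (s i) - Ia : F).
    by rewrite fctsumE.
  apply: Ha; [by rewrite s1// mul0r mulr0|by rewrite s1// divff// mulr1|].
  move=> i ni; have /andP[h1 h2] := smono i (leq_trans ni (leq_addr _ _)).
  by split => //; [rewrite -subr_ge0|rewrite (le_trans h2)// ge_min lexx].
have {}Hb : n2 (fun x => \sum_(i < n + n) (s i.+1 - s i) * f (s i) x - Ib x) < e / 2.
  have sq : sqint (fun x => \sum_(i < n + n) (s i.+1 - s i) * f (s i) x - Ib x).
    apply: sqintB => //; apply: sqint_sum => i _; apply/sqintZ/hf.
    have [h|h] := leqP i n; first by rewrite s1 ?mulr_ge0 ?divr_ge0.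
    by rewrite -(subnKC (ltnW h)) s2 addr_ge0// mulr_ge0 ?divr_ge0// subr_ge0.
  rewrite -lte_fin -L2_normE//.
  have -> : (fun x => \sum_(i < n + n) (s i.+1 - s i) * f (s i) x - Ib x) =
     (\sum_(i < n + n) (s i.+1 - s i) *: f (s i) - Ib : F).
    by rewrite fctsumE.
  apply: Hb; [by rewrite s1// mul0r mulr0|by rewrite s2 divff// mulr1 addrC subrK|].
  move=> i ni; have /andP[h1 h2] := smono i ni.
  by split => //; [rewrite -subr_ge0|rewrite (le_trans h2)// ge_min lexx orbT].
pose u i x : R := (b - a) / n%:R * (f (s (n + i)%N) x - w x).
have hs t : 0 <= t -> sqint (fun x => f t x - w x) by move=> t0; apply: sqintB => //; exact: hf.
have s2ab i : (i < n)%N -> a <= s (n + i)%N <= b.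
  move=> ni; have i1 : i%:R / n%:R <= 1 :> R by rewrite ler_pdivrMr// mul1r ler_nat ltnW.
  have i0 : 0 <= i%:R / n%:R :> R by rewrite divr_ge0.
  rewrite s2; move: (i%:R / n%:R) i1 i0 => r r1 r0; apply/andP; split; nra.
have hu (i : 'I_n) : sqint (u i).
  by apply/sqintZ/hs; have /andP[h _] := s2ab _ (ltn_ord i); exact: le_trans h.
have sS (m : nat) : (m <= n + n)%N -> sqint (fun x => \sum_(i < m) (s i.+1 - s i) * f (s i) x).
  move=> mn; apply: sqint_sum => i _; apply/sqintZ/hf.
  have [h|h] := leqP i n; first by rewrite s1 ?mulr_ge0 ?divr_ge0.
  by rewrite -(subnKC (ltnW h)) s2 addr_ge0// mulr_ge0 ?divr_ge0// subr_ge0.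
have -> : (fun x => Ib x - Ia x - (b - a) * w x) =
   (fun x => (\sum_(i < n) (s i.+1 - s i) * f (s i) x - Ia x)
     - (\sum_(i < n + n) (s i.+1 - s i) * f (s i) x - Ib x) + \sum_(i < n) u i x).
  apply/funext => x; rewrite big_split_ord/=.
  have -> : \sum_(i < n) u i x =
     \sum_(i < n) (s (n + i).+1 - s (n + i)%N) * f (s (n + i)%N) x - (b - a) * w x.
    under eq_bigr do rewrite /u mulrBr.
    rewrite big_split/= sumrN sumr_const card_ord; congr (_ - _).
      by apply: eq_bigr => i _; rewrite ds2.
    by rewrite -mulr_natl; field; exact: nN.
  by ring.
have hA := sqintB (sS n (leq_addr _ _)) hIa.
have hB := sqintB (sS (n + n)%N (leqnn _)) hIb.
apply: (le_trans (n2_triangle (sqintB hA hB) (sqint_sum _ (fun i _ => hu i)))).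
have hsum : n2 (fun x => \sum_(i < n) u i x) <= (b - a) * eps.
  apply: (le_trans (n2_sum _ (fun i _ => hu i))).
  apply: (@le_trans _ _ (\sum_(i < n) (b - a) / n%:R * eps)).
    apply: ler_sum => i _; have h := s2ab _ (ltn_ord i).
    rewrite /u n2Z; last by apply: hs; have /andP[h' _] := h; exact: le_trans h'.
    by rewrite ger0_norm// ler_wpM2l// fw.
  by rewrite sumr_const card_ord -mulr_natl le_eqVlt; apply/orP; left; apply/eqP; field; exact: nN.
have hAB := n2B hA hB.
move: Ha Hb hAB hsum; lra.
Qed.

(** ** Differentiability in time of bilinear expressions *)

Definition L2_deriv_at (f : R -> R -> R) (t : R) (g : R -> R) : Prop :=
  forall e : R, 0 < e -> exists2 d : R, 0 < d & forall s, 0 <= s -> `|s - t| < d ->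
    n2 (fun x => f s x - f t x - (s - t) * g x) <= e * `|s - t|.

Definition deriv_at (q : R -> R) (t l : R) : Prop :=
  forall e : R, 0 < e -> exists2 d : R, 0 < d & forall s, 0 <= s -> `|s - t| < d ->
    `|q s - q t - (s - t) * l| <= e * `|s - t|.

Definition L2_continuous (f : R -> R -> R) : Prop := forall t e : R, 0 <= t -> 0 < e ->
  exists2 d : R, 0 < d & forall s, 0 <= s -> `|s - t| < d ->
    n2 (fun x => f s x - f t x) <= e.

(** The fundamental theorem of calculus for Riemann integrals with values in L^2. *)
Lemma integral_L2_deriv (f : R -> F) (I : R -> F) :
  (forall t, 0 <= t -> sqint (f t)) -> (forall t, 0 <= t -> sqint (I t)) ->
  (forall t, 0 <= t -> is_integral L2n f 0 t (I t)) -> L2_continuous f ->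
  forall t, 0 <= t -> L2_deriv_at I t (f t).
Proof.
move=> hf hI fI cf t t0 e e0; have [d d0 hd] := cf t e t0 e0.
exists d => // s s0 st; have [ts|st'] := leP t s.
  rewrite ger0_norm ?subr_ge0// mulrC.
  apply: (@integral_increment f (I t) (I s) (f t) t s e t0 ts hf (hI _ t0) (hI _ s0) (hf _ t0) (fI _ t0) (fI _ s0)).
  move=> r /andP[tr rs]; have r0 := le_trans t0 tr; apply: hd => //.
  by rewrite (le_lt_trans _ st)// !ger0_norm ?subr_ge0// lerD2r.
rewrite ltr0_norm ?subr_lt0// opprB mulrC.
have := @integral_increment f (I s) (I t) (f t) s t e s0 (ltW st') hf (hI _ s0) (hI _ t0) (hf _ t0) (fI _ s0) (fI _ t0).
rewrite -(n2N (sqintB (sqintB (hI _ s0) (hI _ t0)) (sqintZ (s - t) (hf _ t0)))).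
have -> : (fun x => - (I s x - I t x - (s - t) * f t x)) = (fun x => I t x - I s x - (t - s) * f t x).
  by apply/funext => x; ring.
apply => r /andP[sr rt]; apply: hd; first exact: le_trans sr.
rewrite (le_lt_trans _ st)// distrC [leRHS]distrC !ger0_norm ?subr_ge0//; first by rewrite lerD2l lerN2.
exact: ltW.
Qed.

Lemma L2_deriv_shift (f : R -> R -> R) (h t : R) (g : R -> R) : 0 <= h ->
  L2_deriv_at f (t + h) g -> L2_deriv_at (fun s => f (s + h)) t g.
Proof.
move=> h0 hf e e0; have [d d0 hd] := hf e e0; exists d => // s s0 st.
have := hd (s + h); rewrite opprD addrACA subrr addr0; apply => //.
by rewrite addr_ge0.
Qed.

Lemma L2_deriv_sub (f1 f2 : R -> R -> R) (t : R) (g1 g2 : R -> R) :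
  0 <= t ->
  (forall s, 0 <= s -> sqint (f1 s)) -> (forall s, 0 <= s -> sqint (f2 s)) ->
  sqint g1 -> sqint g2 ->
  L2_deriv_at f1 t g1 -> L2_deriv_at f2 t g2 ->
  L2_deriv_at (fun s x => f1 s x - f2 s x) t (fun x => g1 x - g2 x).
Proof.
move=> t0 s1 s2 hg1 hg2 h1 h2 e e0; have e20 : 0 < e / 2 by rewrite divr_gt0.
have [d1 d10 hd1] := h1 _ e20; have [d2 d20 hd2] := h2 _ e20.
exists (Num.min d1 d2); first by rewrite lt_min d10.
move=> s s0; rewrite lt_min => /andP[/(hd1 _ s0) k1 /(hd2 _ s0) k2].
have -> : (fun x => f1 s x - f2 s x - (f1 t x - f2 t x) - (s - t) * (g1 x - g2 x)) =
  (fun x => (f1 s x - f1 t x - (s - t) * g1 x) - (f2 s x - f2 t x - (s - t) * g2 x)).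
  by apply/funext => x; ring.
have sq (f : R -> R -> R) g : (forall s, 0 <= s -> sqint (f s)) -> sqint g -> sqint (fun x => f s x - f t x - (s - t) * g x).
  by move=> sf sg; apply/sqintB/sqintZ/sg/sqintB; apply: sf.
apply: (le_trans (n2B (sq _ _ s1 hg1) (sq _ _ s2 hg2))).
move: (`|s - t|) k1 k2 => r k1 k2; lra.
Qed.

(** Leibniz' rule; the remainder is bounded by the inequality of Cauchy and Schwarz. *)
Lemma bil_deriv k K (f g : R -> R -> R) (t : R) (f' g' : R -> R) :
  mfun setT k -> (forall x, `|k x| <= K) -> 0 <= t ->
  (forall s, 0 <= s -> sqint (f s)) -> (forall s, 0 <= s -> sqint (g s)) ->
  sqint f' -> sqint g' -> L2_deriv_at f t f' -> L2_deriv_at g t g' ->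
  deriv_at (fun s => bil k (f s) (g s)) t (bil k f' (g t) + bil k (f t) g').
Proof.
move=> mk kK t0 sf sg sf' sg' df dg e e0.
have K0 : 0 <= K by apply: le_trans (kK 0).
set A := n2 f'; set B := n2 g'; set M := n2 (f t); set N := n2 (g t).
have A0 : 0 <= A := n2_ge0 _; have B0 : 0 <= B := n2_ge0 _.
have M0 : 0 <= M := n2_ge0 _; have N0 : 0 <= N := n2_ge0 _.
pose C := K * (N + (B + 1) + M + A * (B + 1)) + 1.
have C0 : 0 < C by rewrite ltr_wpDl// mulr_ge0// !addr_ge0// mulr_ge0// addr_ge0.
pose r := Num.min 1 (e / C); have r0 : 0 < r by rewrite lt_min ltr01 divr_gt0.
have r1 : r <= 1 by rewrite ge_min lexx.
have rC : r * C <= e by rewrite -ler_pdivlMr// ge_min lexx orbT.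
clearbody r.
have [d1 d10 h1] := df r r0; have [d2 d20 h2] := dg r r0.
exists (Num.min (Num.min d1 d2) r); first by rewrite !lt_min d10 d20 r0.
move=> s s0; rewrite !lt_min => /andP[/andP[/(h1 _ s0) k1 /(h2 _ s0) k2] sr].
pose u x := f s x - f t x - (s - t) * f' x; pose v x := g s x - g t x - (s - t) * g' x.
have su : sqint u by apply/sqintB/sqintZ/sf'/sqintB; apply: sf.
have sv : sqint v by apply/sqintB/sqintZ/sg'/sqintB; apply: sg.
have sgd : sqint (fun x => g s x - g t x) by apply: sqintB; apply: sg.
set T := `|s - t| in k1 k2 sr *; have T0 : 0 <= T by exact: normr_ge0.
have gd : n2 (fun x => g s x - g t x) <= T * (B + 1).
  have -> : (fun x => g s x - g t x) = (fun x => v x + (s - t) * g' x).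
    by apply/funext => x; rewrite /v subrK.
  apply: (le_trans (n2_triangle sv (sqintZ _ sg'))); rewrite n2Z// -/T -/B.
  rewrite -/v in k2; nra.
have gs : n2 (g s) <= N + (B + 1).
  have -> : g s = (fun x => g t x + (g s x - g t x)) by apply/funext => x; rewrite addrC subrK.
  apply: (le_trans (n2_triangle (sg _ t0) sgd)); rewrite -/N; nra.
have -> : bil k (f s) (g s) - bil k (f t) (g t) - (s - t) * (bil k f' (g t) + bil k (f t) g') =
   bil k u (g s) + bil k (f t) v + (s - t) * bil k f' (fun x => g s x - g t x).
  have -> : bil k (f s) (g s) = bil k u (g s) + bil k (f t) (g s) + (s - t) * bil k f' (g s).
    rewrite -(bilZl mk kK)//; [|exact: sg].
    rewrite -(bilDl mk kK) //; [|exact: sf|exact: sg].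
    rewrite -(bilDl mk kK) //; [|exact/sqintD/sf|exact: sqintZ|exact: sg].
    by congr (bil k _ _); apply/funext => x; rewrite /u; ring.
  have e2 : bil k (f t) v = bil k (f t) (g s) - bil k (f t) (g t) - (s - t) * bil k (f t) g'.
    have -> : bil k (f t) (g s) = bil k (f t) v + bil k (f t) (g t) + (s - t) * bil k (f t) g'.
      rewrite ![bil k (f t) _]bilC -(bilZl mk kK)//; [|exact: sf].
      rewrite -(bilDl mk kK) //; [|exact: sg|exact: sf].
      rewrite -(bilDl mk kK) //; [|exact/sqintD/sg|exact: sqintZ|exact: sf].
      by congr (bil k _ _); apply/funext => x; rewrite /v; ring.
    by ring.
  have e3 : bil k f' (fun x => g s x - g t x) = bil k f' (g s) - bil k f' (g t).
    have -> : bil k f' (g s) = bil k f' (fun x => g s x - g t x) + bil k f' (g t).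
      rewrite ![bil k f' _]bilC -(bilDl mk kK) //; [|exact: sg].
      by congr (bil k _ _); apply/funext => x; ring.
    by ring.
  by rewrite e2 e3; ring.
have b1 := bil_le mk kK su (sg _ s0); have b2 := bil_le mk kK (sf _ t0) sv.
have b3 := bil_le mk kK sf' sgd.
apply: (le_trans (ler_normD _ _)).
apply: (@le_trans _ _ (K * (r * T * (N + (B + 1))) + K * (M * (r * T)) + T * (K * (A * (r * (B + 1)))))); last first.
  have -> : K * (r * T * (N + (B + 1))) + K * (M * (r * T)) + T * (K * (A * (r * (B + 1)))) =
    T * (r * (C - 1)) by rewrite /C; ring.
  rewrite mulrC ler_wpM2r//; have := ltW r0; lra.
apply: lerD; [apply: (le_trans (ler_normD _ _)); apply: lerD|].
- apply: (le_trans b1); rewrite ler_wpM2l// ler_pM ?n2_ge0//.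
- by apply: (le_trans b2); rewrite ler_wpM2l// ler_wpM2l.
- rewrite normrM -/T ler_wpM2l// (le_trans b3)// ler_wpM2l// ler_wpM2l//.
  by rewrite (le_trans gd)// ler_wpM2r ?addr_ge0// ltW.
Qed.

Lemma deriv_atD (p q : R -> R) (t l m : R) : deriv_at p t l -> deriv_at q t m ->
  deriv_at (fun s => p s + q s) t (l + m).
Proof.
move=> hp hq e e0; have e20 : 0 < e / 2 by rewrite divr_gt0.
have [d1 d10 h1] := hp _ e20; have [d2 d20 h2] := hq _ e20.
exists (Num.min d1 d2); first by rewrite lt_min d10.
move=> s s0; rewrite lt_min => /andP[/(h1 _ s0) k1 /(h2 _ s0) k2].
have -> : p s + q s - (p t + q t) - (s - t) * (l + m) =
   (p s - p t - (s - t) * l) + (q s - q t - (s - t) * m) by ring.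
apply: (le_trans (ler_normD _ _)); move: (`|s - t|) k1 k2 => r; lra.
Qed.

(** Gronwall's inequality: e^(L t) q(t) has a nonpositive derivative. *)
Lemma deriv_at_decay (q : R -> R) (L : R) :
  (forall t, 0 <= t -> exists2 l, deriv_at q t l & l <= - (L * q t)) ->
  forall t, 0 <= t -> q t <= expR (- (L * t)) * q 0.
Proof.
move=> hq t; rewrite le_eqVlt => /predU1P[<-|t0].
  by rewrite mulr0 oppr0 expR0 mul1r.
have dq (s : R) : 0 < s -> exists2 l : R, is_derive s 1 q l & l <= - (L * q s).
  move=> s0; have [l hl lL] := hq s (ltW s0); exists l => //.
  apply/is_derive1_caratheodory.
  exists (fun z => if z == s then l else (q z - q s) / (z - s)); split; last by rewrite eqxx.
    move=> z; case: eqVneq => [->|zs]; first by rewrite !subrr mulr0.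
    by rewrite divfK// subr_eq0.
  rewrite /prop_for /continuous_at eqxx; apply/cvgrPdist_le => e e0.
  have [d d0 hd] := hl e e0; near=> z.
  have zs : `|z - s| < d by rewrite distrC; near: z; exact: cvgr_dist_lt.
  have z0 : 0 <= z by apply/ltW; near: z; exact: lt_nbhsr.
  case: eqVneq => [_|nzs]; first by rewrite subrr normr0 ltW.
  have zsn : 0 < `|z - s| by rewrite normr_gt0 subr_eq0.
  rewrite -(ler_pM2r zsn) -normrM mulrBl divfK ?subr_eq0//.
  by have := hd z z0 zs; rewrite distrC [l * _]mulrC.
pose p s := expR (L * s) * q s.
have dp (s : R) : 0 < s -> exists2 l : R, is_derive s 1 p l & l <= 0.
  move=> s0; have [l hl lL] := dq s s0.
  have dL : is_derive s 1 (fun s => L * s) L.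
    by apply: is_derive_eq; rewrite -![_ *: _]/(_ * _); ring.
  have dE := @is_derive1_comp _ expR (fun s => L * s) _ _ _ (is_derive_expR _) dL.
  have dP := is_deriveM dE hl.
  exists (expR (L * s) * (L * q s + l)).
    refine (is_derive1_eq dP _); rewrite /= -![_ *: _]/(_ * _); ring.
  by rewrite pmulr_rle0 ?expR_gt0//; lra.
have cp : {within `[0, t], continuous p}.
  apply/continuous_within_itvP => //.
  have cE (s : R) : continuous_at s (fun s => expR (L * s)).
    by apply: continuous_comp; [exact: mulrl_continuous|exact: continuous_expR].
  have c1 (s : R) : 0 < s -> continuous_at s p.
    move=> s0; have [l hl _] := dp s s0.
    by apply: differentiable_continuous; apply/derivable1_diffP; case: hl.
  split.
  - by move=> s; rewrite in_itv/= => /andP[s0 _]; exact: c1.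
  - apply: cvgM; first by apply: cvg_at_right_filter; exact: cE.
    apply/cvgrPdist_le => e e0.
    have [l hl _] := hq 0 (lexx _); have [d d0 hd] := hl 1 ltr01.
    near=> z.
    have z0 : 0 <= z by [].
    have zd : z < d by near: z; exact: nbhs_right_lt.
    have zl : z < e / (1 + `|l|).
      by near: z; apply: nbhs_right_lt; rewrite divr_gt0// ltr_wpDr.
    have := hd z z0; rewrite subr0 ger0_norm// => /(_ zd); rewrite mul1r => h.
    rewrite distrC (le_trans (_ : _ <= z * (1 + `|l|)))//; last first.
      by rewrite -ler_pdivlMr ?ltr_wpDr// ltW.
    have -> : q z - q 0 = (q z - q 0 - z * l) + z * l by rewrite subrK.
    by rewrite (le_trans (ler_normD _ _))// mulrDr mulr1 lerD// normrM ger0_norm.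
  - by apply: cvg_at_left_filter; exact: c1.
have := @ler0_derive1_le_cc _ p 0 t _ _ cp t 0.
rewrite !in_itv/= !lexx (ltW t0) => /(_ _ _ isT isT isT) hp.
have {}hp : p t <= p 0.
  apply: hp => s; rewrite in_itv/= => /andP[/dp[l hl l0] _].
    by case: hl.
  by rewrite derive1E (@derive_val _ _ _ _ _ _ _ hl).
move: hp; rewrite /p mulr0 expR0 mul1r expRN => hp.
by rewrite -ler_pdivrMl ?invr_gt0 ?expR_gt0// invrK.
Unshelve. all: by end_near.
Qed.

End SquareIntegrable.

(** * First order form of the wave equation *)
Section FirstOrderForm.
Context {R : realType}.
Local Notation mu := (@lebesgue_measure R).
Local Notation TR := (measurableTypeR R).
Local Notation mset D := (@measurable _ TR D).
Local Notation mfun D f := (@measurable_fun _ _ TR R D f).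
Local Notation F := (R -> R^o).
Local Notation L2n := (L2_norm setT : F -> \bar R).
Implicit Types (D Omega : set R) (f g h v w k : R -> R) (a b c x K M : R).

(** ** Bounded functions with a bounded weak derivative *)

Lemma mu_setT_gt0 : (0 < mu setT)%E.
Proof.
apply: (@lt_le_trans _ _ (mu [set` `[(0 : R), 1]])).
  by rewrite lebesgue_measure_itv/= lte_fin ltr01 -EFinD subr0 lte_fin.
apply: le_measure => //; rewrite inE//; exact: measurable_itv.
Qed.

Lemma Linfty_bound Omega f : in_Lp Omega +oo%E f ->
  mfun setT (f \_ Omega) /\
  (Lp_norm Omega +oo%E f = (fine (Lp_norm Omega +oo%E f))%:E /\
  {ae mu, forall x, `|(f \_ Omega) x| <= fine (Lp_norm Omega +oo%E f)}).
Proof.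
rewrite /in_Lp inE => /andP[]; rewrite inE => mf; rewrite inE /= /finite_norm.
rewrite /Lp_norm => fy; split => //; rewrite -/(Lp_norm Omega +oo%E f).
have e : Lp_norm Omega +oo%E f = (fine (Lp_norm Omega +oo%E f))%:E.
  by rewrite fineK// ge0_fin_numE// Lnorm_ge0.
split => //.
have := @ess_sup_ge _ TR R mu (abse \o (EFin \o (f \_ Omega))).
have -> : ess_sup mu (abse \o (EFin \o (f \_ Omega))) = Lp_norm Omega +oo%E f.
  by rewrite /Lp_norm unlock /= mu_setT_gt0.
by rewrite e; apply: ae_imp => x /=; rewrite lee_fin.
Qed.

Lemma weak_derivP Omega f g : is_weak_deriv Omega f g ->
  is_weak_deriv Omega f (weak_deriv Omega f).
Proof. by move=> h; apply: (@xgetPex _ _ [set g | is_weak_deriv Omega f g]); exists g. Qed.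

Lemma weak_deriv_mfun f g : is_weak_deriv setT f g -> mfun setT f /\ mfun setT g.
Proof. by case=> [[mf _ _] [mg _ _] _]. Qed.

Lemma weak_deriv_of_AC f G g : mfun setT f -> AC G g -> {ae mu, forall x, f x = G x} ->
  is_weak_deriv setT f g.
Proof.
move=> mf hG fG; have [lG lg h] := AC_weak_deriv hG.
have lf : lint f.
  have [mG iG] := locally_integrable_lint lG; split => // a b.
  apply: ae_eq_rint (iG a b) => //; first exact: (measurable_funS measurableT).
  by apply: ae_imp fG => x ->.
split => //; first exact: lint_locally_integrable.
move=> phi tphi; rewrite -h//; have [c1 c2] := test_function_cont tphi.
have mphi : mfun setT (derive1 phi) by exact: continuous_measurable_fun.
apply: ae_eq_Rintegral => //; [exact: measurable_funM| |].
  by apply: measurable_funM => //; case: lG.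
by apply: ae_imp fG => x ->.
Qed.

Lemma weak_deriv_lin f f' g g' c : is_weak_deriv setT f g -> is_weak_deriv setT f' g' ->
  is_weak_deriv setT (fun x => c * f x + f' x) (fun x => c * g x + g' x).
Proof.
move=> h h'; have [mf mg] := weak_deriv_mfun h; have [mf' mg'] := weak_deriv_mfun h'.
have [G hG e] := weak_deriv_AC h; have [G' hG' e'] := weak_deriv_AC h'.
apply: (weak_deriv_of_AC _ (AC_add (AC_scale c hG) hG')).
  by apply: measurable_funD => //; exact: measurable_funM.
by apply: ae_imp2 e e' => x -> ->.
Qed.

Lemma weak_deriv_sum (I : Type) (r : seq I) (c : I -> R) (f g : I -> R -> R) f0 g0 :
  is_weak_deriv setT f0 g0 -> (forall i, is_weak_deriv setT (f i) (g i)) ->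
  is_weak_deriv setT (fun x => \sum_(i <- r) c i * f i x + f0 x)
    (fun x => \sum_(i <- r) c i * g i x + g0 x).
Proof.
move=> h0 h; elim: r => [|i r IH].
  have := h0; congr is_weak_deriv; apply/funext => x; by rewrite big_nil add0r.
have := weak_deriv_lin (c i) (h i) IH; congr is_weak_deriv;
  by apply/funext => x; rewrite big_cons addrA.
Qed.

Record W1inf_rep f G g M : Prop := {
  rep_AC : AC G g;
  rep_bound : forall x, `|G x| <= M;
  rep_bound' : forall x, `|g x| <= M;
  rep_ae : {ae mu, forall x, f x = G x};
  rep_weak : {ae mu, forall x, weak_deriv setT f x = g x} }.

Lemma W1inf_repP f : in_W1p setT +oo%E f -> exists G g M, W1inf_rep f G g M.
Proof.
move=> [/Linfty_bound[]]; rewrite setT_restrict => mf [_ fM] [g0 wg].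
move=> /Linfty_bound[]; rewrite setT_restrict => mg0 [_ gM].
set Mf := fine _ in fM; set Mg := fine _ in gM.
pose M := Num.max (Num.max Mf Mg) 0.
have MfM : Mf <= M by rewrite !le_max lexx.
have MgM : Mg <= M by rewrite !le_max lexx orbT.
have M0 : 0 <= M by rewrite le_max lexx orbT.
have [G hG fG] := weak_deriv_AC wg.
pose g x := if `|g0 x| <= M then g0 x else 0.
have mg : mfun setT g.
  apply: measurable_fun_ifT => //.
  by apply: measurable_fun_ler => //; exact: measurableT_comp.
have g0g : {ae mu, forall x, g0 x = g x}.
  by apply: ae_imp gM => x hx; rewrite /g (le_trans hx).
have hGg := AC_eq hG mg g0g.
exists G, g, M; split => //.
- have cG := AC_continuous hG.
  have h1 : {ae mu, forall x, - M <= G x}.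
    apply: ae_imp2 fM fG => x hx <-; have := le_trans hx MfM.
    by rewrite ler_norml => /andP[].
  have h2 : {ae mu, forall x, - M <= - G x}.
    apply: ae_imp2 fM fG => x hx <-; have := le_trans hx MfM.
    by rewrite ler_norml lerN2 => /andP[].
  move=> x; rewrite ler_norml (ae_continuous_ge cG h1) /=.
  have cNG : continuous (fun x => - G x) by move=> z; apply: cvgN; exact: cG.
  by have := ae_continuous_ge cNG h2 x; rewrite lerN2.
- by move=> x; rewrite /g; case: ifP => //; rewrite normr0.
- have := weak_deriv_unique (weak_derivP wg) wg.
  by move=> h; apply: ae_imp2 h g0g => x -> ->.
Qed.

(** ** Reduction of a mild solution to a first order system *)

Lemma in_H1_weak_deriv f : in_H1 setT f ->
  [/\ sqint f, is_weak_deriv setT f (weak_deriv setT f) & sqint (weak_deriv setT f)].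
Proof.
move=> [/in_L2P hf [g wg /in_L2P hg]]; have w := weak_derivP wg.
split => //; apply: sqint_ae hg; first exact: (weak_deriv_mfun w).2.
exact: weak_deriv_unique wg w.
Qed.

Lemma cvge0_lt (T : Type) (Ft : set_system T) (FF : Filter Ft) (f : T -> \bar R) e :
  f @ Ft --> 0%E -> 0 < e -> \forall s \near Ft, (f s < e%:E)%E.
Proof.
move=> h e0; apply: (h [set y | (y < e%:E)%E]); apply: open_nbhs_nbhs.
by split; [exact: open_ereal_lt_ereal|rewrite /= lte_fin].
Qed.

Lemma continuous_Rplus_epsdelta (N : F -> \bar R) (f : R -> F) : continuous_Rplus N f ->
  forall t e : R, 0 <= t -> 0 < e -> exists2 d : R, 0 < d & forall s, 0 <= s -> `|s - t| < d ->
   (N (f s - f t)%R < e%:E)%E.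
Proof.
move=> cf t e t0 e0; have := cvge0_lt _ (cf t t0) e0.
rewrite near_withinE => -[d /= d0 hd]; exists d => // s s0 st.
by apply: hd => //=; rewrite distrC.
Qed.

Lemma is_integral_ae (f : R -> F) (t : R) (I J : F) : 
  (forall s, 0 <= s -> sqint (f s)) -> sqint I -> sqint J -> {ae mu, forall x, I x = J x} ->
  is_integral L2n f 0 t I -> is_integral L2n f 0 t J.
Proof.
move=> hf hI hJ IJ fI e e0; have [d d0 hd] := fI e e0; exists d => // n s xi s0 sn hs.
have := hd n s xi s0 sn hs; congr (_ < _)%E.
have xi0 (i : 'I_n) : 0 <= xi i.
  have si (j : nat) : (j <= n)%N -> 0 <= s j.
    elim: j => [|j IH] jn; first by rewrite s0.
    have [h1 h2 _] := hs j jn; exact: le_trans (IH (ltnW jn)) (le_trans h1 h2).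
  by have [h1 _ _] := hs i (ltn_ord i); apply: le_trans h1; apply: si; exact: ltnW.
have sS : sqint (fun x => \sum_(i < n) (s i.+1 - s i) * f (xi i) x).
  by apply: sqint_sum => i _; exact/sqintZ/hf.
have eI (I' : F) : sqint I' -> L2n (\sum_(i < n) (s i.+1 - s i) *: f (xi i) - I') =
   (n2 (fun x => \sum_(i < n) (s i.+1 - s i) * f (xi i) x - I' x))%:E.
  by move=> hI'; rewrite -L2_normE; [rewrite fctsumE|exact: sqintB].
rewrite !eI//; congr EFin; apply: n2_ae.
- exact: (sqintB sS hI).1.
- exact: (sqintB sS hJ).1.
- by apply: ae_imp IJ => x ->.
Qed.

(** U t is the continuous representative of the solution u t, P t its derivative in space
    and v t the derivative in time. The time integral Pi t of P represents the derivative
    in space of the time integral of u, and S t is the continuous representative of the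
    integrated flux al * Pi t. *)
Record wave_data (al be u0 u1 : R -> R) (u v P U Pi S : R -> R -> R) : Prop := {
  data_u : forall t, 0 <= t -> {ae mu, forall x, u t x = U t x};
  data_mu : forall t, 0 <= t -> mfun setT (u t);
  data_P : forall t, 0 <= t -> sqint (P t);
  data_v : forall t, 0 <= t -> sqint (v t);
  data_sU : forall t, 0 <= t -> sqint (U t);
  data_U : forall t, 0 <= t -> AC (U t) (P t);
  data_cP : L2_continuous P;
  data_cv : L2_continuous v;
  data_Pi : forall t, 0 <= t -> sqint (Pi t);
  data_iP : forall t, 0 <= t -> is_integral L2n (P : R -> F) 0 t (Pi t);
  data_iv : forall t, 0 <= t ->
    is_integral L2n (v : R -> F) 0 t (fun x => U t x - U 0 x);
  data_S : forall t, 0 <= t -> AC (S t) (fun x => be x * (v t x - v 0 x));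
  data_SPi : forall t, 0 <= t -> {ae mu, forall x, S t x = al x * Pi t x};
  data_u0 : {ae mu, forall x, U 0 x = u0 x};
  data_u1 : {ae mu, forall x, v 0 x = u1 x} }.

Lemma data_dPi (al be u0 u1 : R -> R) (u v P U Pi S : R -> R -> R) :
  wave_data al be u0 u1 u v P U Pi S -> forall t, 0 <= t -> L2_deriv_at Pi t (P t).
Proof.
move=> data; exact: (@integral_L2_deriv _ P Pi (data_P data) (data_Pi data) (data_iP data)
  (data_cP data)).
Qed.

Lemma data_dU (al be u0 u1 : R -> R) (u v P U Pi S : R -> R -> R) :
  wave_data al be u0 u1 u v P U Pi S -> forall t, 0 <= t -> L2_deriv_at U t (v t).
Proof.
move=> data t t0 e e0.
have sU (r : R) : 0 <= r -> sqint (fun x => U r x - U 0 x).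
  by move=> r0; apply: sqintB; apply: (data_sU data).
have [r r0 hr] := @integral_L2_deriv _ v (fun t x => U t x - U 0 x) (data_v data) sU
  (data_iv data) (data_cv data) t t0 e e0.
exists r => // z z0 zt; have := hr z z0 zt; congr (n2 _ <= _).
by apply/funext => x; ring.
Qed.

Lemma data_Pi0 (al be u0 u1 : R -> R) (u v P U Pi S : R -> R -> R) :
  wave_data al be u0 u1 u v P U Pi S -> n2 (Pi 0) = 0.
Proof.
move=> data; apply/eqP; rewrite eq_le n2_ge0 andbT; apply/ler_addgt0Pr => e e0; rewrite add0r.
have [r r0 hr] := data_iP data (lexx 0) e0.
(* The subdivision of [0, 0] without any interval. *)
have := hr 0%N (fun=> 0) (fun=> 0) erefl erefl (fun i hi =>
  False_ind _ (Bool.diff_false_true (etrans (esym (ltn0 i)) hi))).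
rewrite big_ord0 sub0r.
have -> : (- (Pi 0 : F) : F) = (fun x => - Pi 0 x) by [].
have sN : sqint (fun x => - Pi 0 x).
  by have := sqintZ (-1) (data_Pi data (lexx 0)); congr sqint; apply/funext => x; exact: mulN1r.
by rewrite L2_normE// lte_fin n2N//; [move/ltW|exact: (data_Pi data)].
Qed.

Lemma ex_forall_t (T : Type) (t0 : T) (Q : R -> T -> Prop) :
  (forall t : R, 0 <= t -> exists y, Q t y) -> exists f : R -> T, forall t : R, 0 <= t -> Q t (f t).
Proof.
move=> h; have h' t : exists y, 0 <= t -> Q t y.
  have [t0'|_] := leP 0 t; first by have [y hy] := h t t0'; exists y.
  by exists t0.
by have [f hf] := choice h'; exists f.
Qed.

Lemma fst_sum (n : nat) (c : 'I_n -> R) (f g : 'I_n -> F) (I : F * F) :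
  (\sum_(i < n) c i *: (f i, g i) - I).1 = \sum_(i < n) c i *: f i - I.1.
Proof. by rewrite /= (big_morph fst (id1 := 0) (op1 := +%R)). Qed.

Lemma snd_sum (n : nat) (c : 'I_n -> R) (f g : 'I_n -> F) (I : F * F) :
  (\sum_(i < n) c i *: (f i, g i) - I).2 = \sum_(i < n) c i *: g i - I.2.
Proof. by rewrite /= (big_morph snd (id1 := 0) (op1 := +%R)). Qed.

Lemma X_norm_ge1 (y : F * F) : (L2n (weak_deriv setT y.1) <= X_norm y)%E.
Proof.
apply: (le_trans (L2_norm_weak_deriv_le_H1 setT y.1)).
by rewrite /X_norm leeDl// L2_norm_ge0.
Qed.

Lemma X_norm_ge2 (y : F * F) : (L2n y.2 <= X_norm y)%E.
Proof. by rewrite /X_norm leeDr// /H1_norm poweR_ge0. Qed.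

(** The second component of the mild equation says that the integrated flux belongs to
    H^1 and has the derivative beta (v t - v 0). *)
Lemma mild_wave_data (alpha beta al be al' be' : R -> R) Ma Mb (u0 u1 : R -> R) (u ut : R -> F) :
  mfun setT alpha -> W1inf_rep alpha al al' Ma -> W1inf_rep beta be be' Mb ->
  (forall x, 0 < beta x) ->
  wave_solution alpha beta u0 u1 u ut ->
  exists U Pi S, wave_data al be u0 u1 u ut (fun t => weak_deriv setT (u t)) U Pi S.
Proof.
move=> ma ra rb b0 [uH1 ucont vL2 _ vcont [_ _ X0 mild]].
pose P t := weak_deriv setT (u t).
have hv t : 0 <= t -> sqint (ut t) by move=> /vL2/in_L2P.
have hu t : 0 <= t -> [/\ sqint (u t), is_weak_deriv setT (u t) (P t) & sqint (P t)].
  by move=> t0; exact/in_H1_weak_deriv/uH1.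
have [U hU] : exists U : R -> R -> R, forall t, 0 <= t -> AC (U t) (P t) /\ {ae mu, forall x, u t x = U t x}.
  apply: (@ex_forall_t _ (fun=> 0) (fun t G => AC G (P t) /\ {ae mu, forall x, u t x = G x})) => t t0; have [_ w _] := hu t t0.
  by have [G h1 h2] := weak_deriv_AC w; exists G.
have hsU t : 0 <= t -> sqint (U t).
  move=> t0; have [hAC e] := hU t t0; have [su _ _] := hu t t0.
  apply: sqint_ae su => //.
  exact: (continuous_measurable_fun (AC_continuous hAC)).
have mb : mfun setT be := continuous_measurable_fun (AC_continuous (rep_AC rb)).
have [D hD] : exists D : R -> (R -> R) * (R -> R), forall t, 0 <= t ->
   [/\ sqint (D t).1, is_integral L2n P 0 t (D t).1,
     is_integral L2n ut 0 t (fun x => U t x - U 0 x),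
     AC (D t).2 (fun x => be x * (ut t x - ut 0 x)) &
     {ae mu, forall x, (D t).2 x = al x * (D t).1 x}].
  apply: (@ex_forall_t _ (fun=> 0, fun=> 0) (fun t (D : (R -> R) * (R -> R)) =>
   [/\ sqint D.1, is_integral L2n P 0 t D.1,
     is_integral L2n ut 0 t (fun x => U t x - U 0 x),
     AC D.2 (fun x => be x * (ut t x - ut 0 x)) &
     {ae mu, forall x, D.2 x = al x * D.1 x}])) => t t0.
  have [Phi [iPhi [H2 H1] [e1 e2]]] := mild t t0.
  have w1 : is_weak_deriv setT Phi.1 (weak_deriv setT Phi.1).
    by case: H2 => _ [g wg _]; exact: weak_derivP wg.
  have [g wg [hg1 [g' wg' hg']]] : exists2 g, is_weak_deriv setT Phi.1 g & in_H1 setT g.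
    by case: H2.
  have [G hG gG] := weak_deriv_AC wg'.
  have sg : sqint g by apply/in_L2P.
  have sG : sqint G by apply: sqint_ae sg => //; exact: (continuous_measurable_fun (AC_continuous hG)).
  have DG : {ae mu, forall x, weak_deriv setT Phi.1 x = G x}.
    by have := weak_deriv_unique w1 wg => h; apply: ae_imp2 h gG => x -> ->.
  have sD : sqint (weak_deriv setT Phi.1).
    apply: sqint_ae sG; first exact: (weak_deriv_mfun w1).2.
    by apply: ae_imp DG => x ->.
  have iD : is_integral L2n P 0 t (weak_deriv setT Phi.1).
    move=> e e0; have [d d0 hd] := iPhi e e0; exists d => // n s xi s0 sn hs.
    have := hd n s xi s0 sn hs; apply: le_lt_trans.
    apply: le_trans (X_norm_ge1 _).
    rewrite (fst_sum (fun i : 'I_n => s i.+1 - s i) (fun i : 'I_n => u (xi i)) (fun i : 'I_n => ut (xi i))).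
    have xi0 (i : 'I_n) : 0 <= xi i.
      have si (j : nat) : (j <= n)%N -> 0 <= s j.
        elim: j => [|j IH] jn; first by rewrite s0.
        have [h1 h2 _] := hs j jn; exact: le_trans (IH (ltnW jn)) (le_trans h1 h2).
      by have [h1 _ _] := hs i (ltn_ord i); apply: le_trans h1; apply: si; exact: ltnW.
    have wP (i : 'I_n) : is_weak_deriv setT (u (xi i)) (P (xi i)) by case: (hu _ (xi0 i)).
    have wN : is_weak_deriv setT (fun x => - Phi.1 x) (fun x => - weak_deriv setT Phi.1 x).
      have := weak_deriv_lin (-2) w1 w1; congr is_weak_deriv; apply/funext => x; ring.
    have wS := weak_deriv_sum (index_enum 'I_n) (fun i : 'I_n => s i.+1 - s i) wN wP.
    have sS : sqint (fun x => \sum_(i < n) (s i.+1 - s i) * P (xi i) x - weak_deriv setT Phi.1 x).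
      by apply: sqintB => //; apply: sqint_sum => i _; apply: sqintZ; case: (hu _ (xi0 i)).
    rewrite !fctsumE.
    have eS := weak_deriv_unique wS (weak_derivP wS).
    have mW := (weak_deriv_mfun (weak_derivP wS)).2.
    rewrite [leLHS]L2_normE// [leRHS]L2_normE; last exact: sqint_ae mW eS sS.
    by rewrite lee_fin le_eqVlt; apply/orP; left; apply/eqP/n2_ae => //; exact: sS.1.
  have iv : is_integral L2n ut 0 t Phi.2.
    move=> e e0; have [d d0 hd] := iPhi e e0; exists d => // n s xi s0 sn hs.
    have := hd n s xi s0 sn hs; apply: le_lt_trans.
    apply: le_trans (X_norm_ge2 _).
    by rewrite (snd_sum (fun i : 'I_n => s i.+1 - s i) (fun i : 'I_n => u (xi i)) (fun i : 'I_n => ut (xi i))).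
  have [U0 eU0] := hU 0 (lexx 0); have [Ut eUt] := hU t t0.
  exists (weak_deriv setT Phi.1, fun x => al x * G x); split => //.
  - apply: is_integral_ae iv => //.
    + by case: H1 => /in_L2P.
    + by apply: sqintB; apply: hsU.
    + have := ae_imp2 (fun x (p : u t x = U t x) (q : u 0 x = U 0 x) => conj p q) eUt eU0.
      move=> h; apply: ae_imp2 h e1 => x [<- <-] /= ->.
      by rewrite addrAC subrr add0r.
  - have hS := AC_mul (rep_AC ra) hG.
    have mS : mfun setT (fun x => alpha x * weak_deriv setT Phi.1 x).
      by apply: measurable_funM => //; exact: sD.1.
    have eS : {ae mu, forall x, alpha x * weak_deriv setT Phi.1 x = al x * G x}.
      by apply: ae_imp2 (rep_ae ra) DG => x -> ->.
    have wS := weak_deriv_of_AC mS hS eS.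
    have eW := weak_deriv_unique (weak_derivP wS) wS.
    apply: AC_eq hS _ _.
      by apply: measurable_funM => //; apply: measurable_funB; [exact: (hv t t0).1|exact: (hv 0 (lexx 0)).1].
    apply: (ae_imp2 _ eW (ae_imp2 (fun x p q => conj p q) e2 (rep_ae rb))) => x <- [/= -> <-].
    rewrite addrAC subrr add0r mulrA divff ?mul1r// gt_eqF//.
  - by apply: ae_imp DG => x /= ->.
exists U, (fun t => (D t).1), (fun t => (D t).2); split => //.
- by move=> t t0; case: (hU t t0).
- by move=> t t0; case: (hu t t0) => -[].
- by move=> t t0; case: (hu t t0).
- by move=> t t0; case: (hU t t0).
- move=> t e t0 e0; have [d d0 hd] := continuous_Rplus_epsdelta ucont t0 e0.
  exists d => // s s0 /(hd s s0); have [_ wt st] := hu t t0; have [_ ws ss] := hu s s0.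
  have wd : is_weak_deriv setT (u s - u t : F) (fun x => P s x - P t x).
    have := weak_deriv_lin (-1) wt ws; congr is_weak_deriv; apply/funext => x.
      by rewrite mulN1r addrC.
    by rewrite mulN1r addrC.
  have sd := sqintB ss st; have wd' := weak_derivP wd.
  have ed := weak_deriv_unique wd wd'; have md := (weak_deriv_mfun wd').2.
  move=> /(le_lt_trans (L2_norm_weak_deriv_le_H1 _ _)).
  rewrite L2_normE; last exact: sqint_ae md ed sd.
  by rewrite lte_fin (n2_ae sd.1 md ed) => /ltW.
- move=> t e t0 e0; have [d d0 hd] := continuous_Rplus_epsdelta vcont t0 e0.
  exists d => // s s0 /(hd s s0).
  by rewrite L2_normE ?lte_fin; [move=> /ltW|apply: sqintB; apply: hv].
- by move=> t t0; case: (hD t t0).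
- by move=> t t0; case: (hD t t0).
- by move=> t t0; case: (hD t t0).
- by move=> t t0; case: (hD t t0).
- by move=> t t0; case: (hD t t0).
- have [_ eU0] := hU 0 (lexx 0); case: X0 => /= X1 _.
  by apply: ae_imp2 eU0 X1 => x -> ->.
- by case: X0.
Qed.

End FirstOrderForm.

(** * Weighted energies *)
Section WeightedEnergy.
Context {R : realType}.
Local Notation mu := (@lebesgue_measure R).
Local Notation TR := (measurableTypeR R).
Local Notation mset D := (@measurable _ TR D).
Local Notation mfun D f := (@measurable_fun _ _ TR R D f).
Local Notation F := (R -> R^o).
Local Notation L2n := (L2_norm setT : F -> \bar R).
Implicit Types (f g v w k : R -> R) (a b c x K M : R).

Lemma AC_mfun f g : AC f g -> mfun setT f.
Proof. by move=> /AC_continuous; exact: continuous_measurable_fun. Qed.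

Lemma AC_mfun' f g : AC f g -> mfun setT g.
Proof. by case=> [[]]. Qed.

Lemma continuous_inv f : continuous f -> (forall x, 0 < f x) -> continuous (fun x => (f x)^-1).
Proof. by move=> cf f0 x; apply: cvgV; [rewrite gt_eqF|exact: cf]. Qed.

(** rho is the impedance sqrt(al be), and q its logarithmic derivative, the reflection
    coefficient per unit length. *)
Record coefficients (al be al' be' rho q : R -> R) (d M : R) : Prop := {
  c_al : AC al al';
  c_be : AC be be';
  c_d : 0 < d;
  c_ald : forall x, d <= al x <= M;
  c_bed : forall x, d <= be x <= M;
  c_rho : AC rho (fun x => rho x * q x);
  c_rho_inv : AC (fun x => (rho x)^-1) (fun x => - ((rho x)^-1 * q x));
  c_rho0 : forall x, 0 < rho x;
  c_rho2 : forall x, rho x ^+ 2 = al x * be x;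
  c_qE : forall x, q x = (al' x / al x + be' x / be x) / 2;
  c_q : forall x, `|q x| <= M / d;
  c_mq : mfun setT q }.

(** The impedance is built as the exponential of the primitive of q, and its
    square is identified because al * be / rho^2 has a vanishing derivative. *)
Lemma ex_coefficients (al be al' be' : R -> R) (d M : R) : 0 < d ->
  AC al al' -> AC be be' -> (forall x, d <= al x <= M) -> (forall x, d <= be x <= M) ->
  (forall x, `|al' x| <= M) -> (forall x, `|be' x| <= M) ->
  exists rho q, coefficients al be al' be' rho q d M.
Proof.
move=> d0 ha hb ad bd a'M b'M.
have a0 x : 0 < al x by case/andP: (ad x) => h _; exact: lt_le_trans h.
have b0 x : 0 < be x by case/andP: (bd x) => h _; exact: lt_le_trans h.
pose q x := (al' x / al x + be' x / be x) / 2.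
have mq : mfun setT q.
  have mi f g : AC f g -> (forall x, 0 < f x) -> mfun setT (fun x => g x / f x).
    move=> h f0; apply: measurable_funM; first exact: (AC_mfun' h).
    by apply: continuous_measurable_fun; exact: continuous_inv (AC_continuous h) f0.
  by apply: measurable_funM => //; apply: measurable_funD; apply: mi.
have quo (x y : R) : `|x| <= M -> d <= y -> `|x / y| <= M / d.
  move=> xM dy; have y0 : 0 < y by exact: lt_le_trans dy.
  rewrite normrM normfV (gtr0_norm y0) ler_pM ?invr_ge0 ?(ltW y0)//.
  by rewrite lef_pV2.
have qM x : `|q x| <= M / d.
  rewrite normrM [`|2^-1|]ger0_norm// ler_pdivrMr//.
  apply: (le_trans (ler_normD _ _)); rewrite mulr_natr mulr2n.
  by apply: lerD; apply: quo => //; [case/andP: (ad x)|case/andP: (bd x)].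
have lq : lint q.
  have := lint_bounded mq qM (lint_cst 1); congr lint.
  by apply/funext => x; rewrite mulr1.
pose c := ln (al 0 * be 0) / 2.
have hl : AC (fun x => primitive q x + c) q.
  by have := AC_add (AC_primitive lq) (AC_cst c); congr AC; apply/funext => x; rewrite addr0.
pose l x := primitive q x + c; rewrite -/l in hl.
have hr := AC_exp hl.
have hri := AC_exp (AC_scale (-1) hl).
have hr2 := AC_exp (AC_scale (-2) hl).
have hab := AC_mul (AC_mul ha hb) hr2.
have l0 : expR (-2 * l 0) = (al 0 * be 0)^-1.
  rewrite /l /primitive lexx Ipt add0r /c.
  have -> : -2 * (ln (al 0 * be 0) / 2) = - ln (al 0 * be 0) by field.
  by rewrite expRN lnK// posrE mulr_gt0.
have e1 x : al x * be x * expR (-2 * l x) = 1.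
  have key y z : y <= z -> al z * be z * expR (-2 * l z) = al y * be y * expR (-2 * l y).
    move=> yz; apply/eqP; rewrite -subr_eq0 hab.2//; apply/eqP.
    transitivity (\int[mu]_(t in `[y, z]) (0 : R)); last by rewrite Icst// mul0r.
    apply: eq_Rintegral => t _; rewrite /q; field.
    by rewrite !gt_eqF.
  have e0 : al 0 * be 0 * expR (-2 * l 0) = 1 by rewrite l0 divff// gt_eqF// mulr_gt0.
  by have [x0|x0] := leP 0 x; [rewrite (key 0 x)|rewrite -(key x 0)// ltW].
exists (fun x => expR (l x)), q; split => //.
- have := hri; congr AC; apply/funext => x; rewrite mulN1r expRN//.
  by rewrite mulN1r mulrN.
- by move=> x; exact: expR_gt0.
- move=> x; have := e1 x; rewrite -expRM_natr.
  have -> : -2 * l x = - (l x * 2) by ring.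
  by rewrite expRN => /divr1_eq ->.
Qed.

(** ** The energy identity *)

Variables (al be al' be' rho q : R -> R) (d M : R).
Hypothesis co : coefficients al be al' be' rho q d M.

Let al0 x : 0 < al x.
Proof. by case/andP: (c_ald co x) => h _; exact: lt_le_trans (c_d co) h. Qed.

Let be0 x : 0 < be x.
Proof. by case/andP: (c_bed co x) => h _; exact: lt_le_trans (c_d co) h. Qed.

Let M0 : 0 < M.
Proof. by case/andP: (c_ald co 0) => h1 h2; exact: lt_le_trans (c_d co) (le_trans h1 h2). Qed.

Lemma rho_bounds x : d <= rho x <= M.
Proof.
have /andP[a1 a2] := c_ald co x; have /andP[b1 b2] := c_bed co x.
have r0 := ltW (c_rho0 co x); have d0 := ltW (c_d co).
rewrite -(ler_pXn2r (ltn0Sn 1)) ?nnegrE// -[rho x <= M](ler_pXn2r (ltn0Sn 1)) ?nnegrE ?(ltW M0)//.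
by rewrite !(c_rho2 co) !expr2 !ler_pM// ltW.
Qed.

Record weight w w' (W : R) : Prop := {
  w_AC : AC w w';
  w_bound : forall x, `|w x| <= W;
  w_bound' : forall x, `|w' x| <= W }.

(** The Riemann invariants: where the coefficients are constant, fwd vanishes for a wave
    that travels to the right, and bwd for one that travels to the left. *)
Definition fwd (p v : R -> R) x : R := rho x * v x + al x * p x.
Definition bwd (p v : R -> R) x : R := rho x * v x - al x * p x.

(** The integral of (w1 fwd^2 + w2 bwd^2) / al, expanded into bilinear forms in p and v
    so that it can be differentiated in time. *)
Definition energy w1 w2 (p v : R -> R) : R :=
  bil (fun x => (w1 x + w2 x) * be x) v v +
  bil (fun x => 2 * (w1 x - w2 x) * rho x) v p +
  bil (fun x => (w1 x + w2 x) * al x) p p.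

Section FixedWeights.
Variables (w1 w1' w2 w2' : R -> R) (W : R).
Hypotheses (hw1 : weight w1 w1' W) (hw2 : weight w2 w2' W).

Let mw1 := AC_mfun (w_AC hw1).
Let mw2 := AC_mfun (w_AC hw2).

Lemma normM_le (x y X Y : R) : `|x| <= X -> `|y| <= Y -> `|x * y| <= X * Y.
Proof. by move=> hx hy; rewrite normrM ler_pM. Qed.

Let alM x : `|al x| <= M.
Proof. by rewrite gtr0_norm//; case/andP: (c_ald co x). Qed.
Let beM x : `|be x| <= M.
Proof. by rewrite gtr0_norm//; case/andP: (c_bed co x). Qed.
Let rhoM x : `|rho x| <= M.
Proof. by rewrite gtr0_norm ?(c_rho0 co)//; case/andP: (rho_bounds x). Qed.

Let WD x : `|w1 x + w2 x| <= W + W.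
Proof. by rewrite (le_trans (ler_normD _ _))// lerD ?(w_bound hw1) ?(w_bound hw2). Qed.
Let WB x : `|w1 x - w2 x| <= W + W.
Proof. by rewrite (le_trans (ler_normB _ _))// lerD ?(w_bound hw1) ?(w_bound hw2). Qed.

Let mal := AC_mfun (c_al co).
Let mbe := AC_mfun (c_be co).
Let mrho := AC_mfun (c_rho co).

Let mk11 : mfun setT (fun x => (w1 x + w2 x) * be x).
Proof. by apply: measurable_funM => //; exact: measurable_funD. Qed.
Let mk12 : mfun setT (fun x => 2 * (w1 x - w2 x) * rho x).
Proof. by apply: measurable_funM => //; apply: measurable_funM => //; exact: measurable_funB. Qed.
Let mk22 : mfun setT (fun x => (w1 x + w2 x) * al x).
Proof. by apply: measurable_funM => //; exact: measurable_funD. Qed.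

Let K := 2 * (W + W) * M.
Let bk11 x : `|(w1 x + w2 x) * be x| <= K.
Proof.
apply: (le_trans (normM_le (WD x) (beM x))); rewrite /K ler_wpM2r ?(ltW M0)//.
by have := le_trans (normr_ge0 _) (WD x); lra.
Qed.
Let bk12 x : `|2 * (w1 x - w2 x) * rho x| <= K.
Proof. by apply: normM_le => //; apply: normM_le; rewrite ?WB// ger0_norm. Qed.
Let bk22 x : `|(w1 x + w2 x) * al x| <= K.
Proof.
apply: (le_trans (normM_le (WD x) (alM x))); rewrite /K ler_wpM2r ?(ltW M0)//.
by have := le_trans (normr_ge0 _) (WD x); lra.
Qed.

Lemma energyE p v : sqint p -> sqint v ->
  rint setT (fun x => (w1 x * fwd p v x ^+ 2 + w2 x * bwd p v x ^+ 2) / al x) /\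
  energy w1 w2 p v =
  \int[mu]_x ((w1 x * fwd p v x ^+ 2 + w2 x * bwd p v x ^+ 2) / al x).
Proof.
move=> hp hv; have i1 := bil_rint mk11 bk11 hv hv.
have i2 := bil_rint mk12 bk12 hv hp; have i3 := bil_rint mk22 bk22 hp hp.
have e : (fun x => (w1 x + w2 x) * be x * (v x * v x) +
    2 * (w1 x - w2 x) * rho x * (v x * p x) + (w1 x + w2 x) * al x * (p x * p x)) =
  (fun x => (w1 x * fwd p v x ^+ 2 + w2 x * bwd p v x ^+ 2) / al x).
  apply/funext => x; apply: (mulIf (lt0r_neq0 (al0 x))).
  rewrite divfK ?gt_eqF// /fwd /bwd.
  have -> : be x = rho x ^+ 2 / al x by rewrite (c_rho2 co) mulrAC divff ?mul1r// gt_eqF.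
  by field; rewrite gt_eqF.
split; first by rewrite -e; apply: rintD => //; exact: rintD.
rewrite -e /energy /bil -RintegralD// -RintegralD//; exact: rintD.
Qed.

(** The energies of the increments over [t, t + h], divided by h^2, tend to the energy at
    time t; this is the limit for each of its three terms. *)
Lemma bil_increment k K1 (f g : R -> R -> R) (t : R) (f' g' : R -> R) :
  mfun setT k -> (forall x, `|k x| <= K1) -> 0 <= t ->
  (forall s, 0 <= s -> sqint (f s)) -> (forall s, 0 <= s -> sqint (g s)) ->
  sqint f' -> sqint g' -> L2_deriv_at f t f' -> L2_deriv_at g t g' ->
  forall e, 0 < e -> exists2 r : R, 0 < r & forall h : R, 0 < h -> h < r ->
    `|bil k (fun x => f (t + h) x - f t x) (fun x => g (t + h) x - g t x)
      - h ^+ 2 * bil k f' g'| <= h ^+ 2 * e.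
Proof.
move=> mk kK t0 sf sg sf' sg' df dg e e0.
have K0 : 0 <= K1 by apply: le_trans (kK 0).
set A := n2 f'; set B := n2 g'.
have A0 : 0 <= A := n2_ge0 _; have B0 : 0 <= B := n2_ge0 _.
pose C := K1 * (B + 1 + A) + 1.
have C0 : 0 < C by rewrite ltr_wpDl// mulr_ge0// !addr_ge0.
pose r := Num.min 1 (e / C); have r0 : 0 < r by rewrite lt_min ltr01 divr_gt0.
have r1 : r <= 1 by rewrite ge_min lexx.
have rC : r * C <= e by rewrite -ler_pdivlMr// ge_min lexx orbT.
clearbody r.
have [d1 d10 h1] := df r r0; have [d2 d20 h2] := dg r r0.
exists (Num.min d1 d2); first by rewrite lt_min d10.
move=> h h0; rewrite lt_min => /andP[hd1 hd2].
have th : t + h - t = h by rewrite addrC addKr.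
have k1 := h1 (t + h); rewrite th ger0_norm ?(ltW h0)// in k1.
have {}k1 := k1 (addr_ge0 t0 (ltW h0)) hd1.
have k2 := h2 (t + h); rewrite th ger0_norm ?(ltW h0)// in k2.
have {}k2 := k2 (addr_ge0 t0 (ltW h0)) hd2.
have th0 : 0 <= t + h := addr_ge0 t0 (ltW h0).
set F1 := (fun x => f (t + h) x - f t x); set G1 := (fun x => g (t + h) x - g t x).
pose u x := F1 x - h * f' x; pose v x := G1 x - h * g' x.
have sF : sqint F1 by apply: sqintB; apply: sf.
have sG : sqint G1 by apply: sqintB; apply: sg.
have su : sqint u by apply/sqintB/sqintZ.
have sv : sqint v by apply/sqintB/sqintZ.
have nG : n2 G1 <= h * (B + 1).
  have -> : G1 = (fun x => v x + h * g' x) by apply/funext => x; rewrite /v subrK.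
  apply: (le_trans (n2_triangle sv (sqintZ _ sg'))).
  rewrite n2Z// gtr0_norm// -/B; rewrite -/v in k2.
  have : r * h <= 1 * h by rewrite ler_wpM2r// ltW.
  by move: k2; rewrite -/G1 -/v; lra.
have -> : bil k F1 G1 - h ^+ 2 * bil k f' g' = bil k u G1 + h * bil k f' v.
  have -> : bil k F1 G1 = bil k u G1 + h * bil k f' G1.
    rewrite -(bilZl mk kK)// -(bilDl mk kK)//; last exact: sqintZ.
    by congr (bil k _ _); apply/funext => x; rewrite /u subrK.
  have -> : bil k f' G1 = bil k f' v + h * bil k f' g'.
    rewrite ![bil k f' _]bilC -(bilZl mk kK)// -(bilDl mk kK)//; last exact: sqintZ.
    by congr (bil k _ _); apply/funext => x; rewrite /v subrK.
  by ring.
have b1 := bil_le mk kK su sG; have b2 := bil_le mk kK sf' sv.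
apply: (le_trans (ler_normD _ _)).
apply: (@le_trans _ _ (K1 * (r * h * (h * (B + 1))) + h * (K1 * (A * (r * h))))); last first.
  have -> : K1 * (r * h * (h * (B + 1))) + h * (K1 * (A * (r * h))) = h ^+ 2 * (r * (C - 1)).
    by rewrite /C; ring.
  by rewrite ler_wpM2l ?sqr_ge0//; have := ltW r0; lra.
apply: lerD.
- by apply: (le_trans b1); rewrite ler_wpM2l// ler_pM ?n2_ge0.
- by rewrite normrM gtr0_norm// ler_wpM2l ?(ltW h0)// (le_trans b2)// ler_wpM2l// ler_wpM2l.
Qed.

Lemma limit_bookkeeping (E z y b1 b2 b3 b4 : R) : b1 <= E * b2 ->
  - (z * y) <= b1 - z * b4 -> E * (b2 - z * b3) <= E * (z * y) ->
  z * b4 <= z * (E * b3 + (y + E * y)).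
Proof. by move=> h1 h2 h3; nra. Qed.

Section Decay.
Variables (u0 u1 : R -> R) (u v P U Pi S : R -> R -> R) (Z1 Z2 : R -> Prop) (la : R).
Hypothesis data : wave_data al be u0 u1 u v P U Pi S.
Hypothesis hZ1 : forall t, 0 <= t ->
  {ae mu, forall x, Z1 x -> fwd (Pi t) (fun z => U t z - U 0 z) x = 0}.
Hypothesis hZ2 : forall t, 0 <= t ->
  {ae mu, forall x, Z2 x -> bwd (Pi t) (fun z => U t z - U 0 z) x = 0}.
Hypothesis cond : {ae mu, forall x, forall A B : R, (Z1 x -> A = 0) -> (Z2 x -> B = 0) ->
  - w1' x * A ^+ 2 + w2' x * B ^+ 2 - (w1 x - w2 x) * q x * A * B <=
  - (la * (rho x / al x) * (w1 x * A ^+ 2 + w2 x * B ^+ 2)) }.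

Section TimeStep.
Variables (t h : R).
Hypotheses (t0 : 0 <= t) (h0 : 0 <= h).

Let p x := Pi (t + h) x - Pi t x.
Let V x := U (t + h) x - U t x.
Let p' x := P (t + h) x - P t x.
Let V' x := v (t + h) x - v t x.

Let th0 : 0 <= t + h. Proof. exact: addr_ge0. Qed.

Let sp : sqint p. Proof. by apply: sqintB; apply: (data_Pi data). Qed.
Let sV : sqint V. Proof. by apply: sqintB; apply: (data_sU data). Qed.
Let sp' : sqint p'. Proof. by apply: sqintB; apply: (data_P data). Qed.
Let sV' : sqint V'. Proof. by apply: sqintB; apply: (data_v data). Qed.

Let L := (bil (fun x => (w1 x + w2 x) * be x) V' V + bil (fun x => (w1 x + w2 x) * be x) V V') +
  (bil (fun x => 2 * (w1 x - w2 x) * rho x) V' p + bil (fun x => 2 * (w1 x - w2 x) * rho x) V p') +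
  (bil (fun x => (w1 x + w2 x) * al x) p' p + bil (fun x => (w1 x + w2 x) * al x) p p').

(** L is the time derivative of the energy of the increments over a time step h. With the
    increment sg of the integrated flux, A = rho V + sg and B = rho V - sg are absolutely
    continuous in space, even though p' and V' are only square integrable. Integrating the
    derivative of (w1 A^2 - w2 B^2) / rho over the line turns L into the integral of
    (- w1' A^2 + w2' B^2 - (w1 - w2) q A B) / rho, to which the condition applies. *)
Lemma energy_rate_le : L <= - (la * energy w1 w2 p V).
Proof.
pose sg x := S (t + h) x - S t x.
have hsg : AC sg (fun x => be x * V' x).
  have := AC_sub (data_S data th0) (data_S data t0); congr AC; apply/funext => x.
  by rewrite /V'; ring.
have sgp : {ae mu, forall x, sg x = al x * p x}.
  apply: ae_imp2 (data_SPi data th0) (data_SPi data t0) => x e1 e2.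
  by rewrite /sg e1 e2 /p; ring.
have hV : AC V p' by exact: AC_sub (data_U data th0) (data_U data t0).
pose A x := rho x * V x + sg x; pose B x := rho x * V x - sg x.
pose A' x := rho x * q x * V x + rho x * p' x + be x * V' x.
pose B' x := rho x * q x * V x + rho x * p' x - be x * V' x.
have hA : AC A A' by exact: AC_add (AC_mul (c_rho co) hV) hsg.
have hB : AC B B' by exact: AC_sub (AC_mul (c_rho co) hV) hsg.
have ssg : sqint sg.
  apply: (@sqint_ae _ (fun x => al x * p x)); first exact: AC_mfun hsg.
    by apply: ae_imp sgp => x ->.
  exact: (sqint_bounded mal alM).
have srV : sqint (fun x => rho x * V x) by exact: (sqint_bounded mrho rhoM).
have sA : sqint A by exact: sqintD.
have sB : sqint B by exact: sqintB.
have mq := c_mq co; have qM := c_q co.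
have srqV : sqint (fun x => rho x * q x * V x).
  apply: (@sqint_bounded _ _ (M * (M / d))) => //; first exact: measurable_funM.
  by move=> x; exact: normM_le.
have srp : sqint (fun x => rho x * p' x) by exact: (sqint_bounded mrho rhoM).
have sbV : sqint (fun x => be x * V' x) by exact: (sqint_bounded mbe beM).
have sA' : sqint A' by apply: sqintD => //; exact: sqintD.
have sB' : sqint B' by apply: sqintB => //; exact: sqintD.
have mri : mfun setT (fun x => (rho x)^-1) := AC_mfun (c_rho_inv co).
have riM x : `|(rho x)^-1| <= d^-1.
  rewrite normfV gtr0_norm ?(c_rho0 co)// lef_pV2 ?posrE ?(c_rho0 co) ?(c_d co)//.
  by case/andP: (rho_bounds x).
have mw1' := AC_mfun' (w_AC hw1); have mw2' := AC_mfun' (w_AC hw2).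
pose ka w w' x := (w' x - w x * q x) / rho x; pose kb w x := 2 * w x / rho x.
have mka w w' : weight w w' W -> mfun setT (ka w w').
  move=> hw; apply: measurable_funM => //; apply: measurable_funB; first exact: AC_mfun' (w_AC hw).
  by apply: measurable_funM => //; exact: AC_mfun (w_AC hw).
have mkb w w' : weight w w' W -> mfun setT (kb w).
  move=> hw; apply: measurable_funM => //; apply: measurable_funM => //; exact: AC_mfun (w_AC hw).
have bka w w' : weight w w' W -> forall x, `|ka w w' x| <= (W + W * (M / d)) / d.
  move=> hw x; apply: normM_le => //; apply: (le_trans (ler_normB _ _)); apply: lerD.
    exact: (w_bound' hw).
  by apply: normM_le => //; exact: (w_bound hw).
have bkb w w' : weight w w' W -> forall x, `|kb w x| <= 2 * W / d.
  move=> hw x; apply: normM_le => //; apply: normM_le; first by rewrite ger0_norm.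
  exact: (w_bound hw).
pose g x := (ka w1 w1' x * (A x * A x) + kb w1 x * (A x * A' x)) -
            (ka w2 w2' x * (B x * B x) + kb w2 x * (B x * B' x)).
have ig1 : rint setT (fun x => ka w1 w1' x * (A x * A x)) by exact: bil_rint (mka _ _ hw1) (bka _ _ hw1) _ _.
have ig2 : rint setT (fun x => kb w1 x * (A x * A' x)) by exact: bil_rint (mkb _ _ hw1) (bkb _ _ hw1) _ _.
have ig3 : rint setT (fun x => ka w2 w2' x * (B x * B x)) by exact: bil_rint (mka _ _ hw2) (bka _ _ hw2) _ _.
have ig4 : rint setT (fun x => kb w2 x * (B x * B' x)) by exact: bil_rint (mkb _ _ hw2) (bkb _ _ hw2) _ _.
have ig : rint setT g by apply: rintB => //; exact: rintD.
pose G x := kb w1 x * (A x * A x) - kb w2 x * (B x * B x).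
have iG : rint setT G.
  apply: rintB => //; first exact: bil_rint (mkb _ _ hw1) (bkb _ _ hw1) _ _.
  exact: bil_rint (mkb _ _ hw2) (bkb _ _ hw2) _ _.
have hG : AC (fun x => 2^-1 * G x) g.
  have h1 := AC_mul (AC_mul (w_AC hw1) (c_rho_inv co)) (AC_mul hA hA).
  have h2 := AC_mul (AC_mul (w_AC hw2) (c_rho_inv co)) (AC_mul hB hB).
  have := AC_sub h1 h2; congr AC; apply/funext => x; rewrite /G /g /ka /kb; field;
    by rewrite gt_eqF// (c_rho0 co).
have g0 : \int[mu]_x g x = 0.
  exact: Rintegral_AC_deriv_eq0 hG (rintZ _ measurableT iG) ig.
pose ell x := ((w1 x + w2 x) * be x * (V' x * V x) + (w1 x + w2 x) * be x * (V x * V' x)) +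
  (2 * (w1 x - w2 x) * rho x * (V' x * p x) + 2 * (w1 x - w2 x) * rho x * (V x * p' x)) +
  ((w1 x + w2 x) * al x * (p' x * p x) + (w1 x + w2 x) * al x * (p x * p' x)).
have il : rint setT ell /\ L = \int[mu]_x ell x.
  have j1 := bil_rint mk11 bk11 sV' sV; have j2 := bil_rint mk11 bk11 sV sV'.
  have j3 := bil_rint mk12 bk12 sV' sp; have j4 := bil_rint mk12 bk12 sV sp'.
  have j5 := bil_rint mk22 bk22 sp' sp; have j6 := bil_rint mk22 bk22 sp sp'.
  have j12 := rintD measurableT j1 j2; have j34 := rintD measurableT j3 j4.
  have j56 := rintD measurableT j5 j6; have j14 := rintD measurableT j12 j34.
  split; first exact: rintD j14 j56.
  rewrite /L /bil -(RintegralD measurableT j1 j2) -(RintegralD measurableT j3 j4).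
  rewrite -(RintegralD measurableT j5 j6) -(RintegralD measurableT j12 j34).
  by rewrite -(RintegralD measurableT j14 j56).
have [iell Lell] := il.
have [iE eE] := energyE sp sV.
have -> : L = \int[mu]_x (ell x - g x) by rewrite RintegralB// g0 subr0.
rewrite eE.
rewrite -mulNr -RintegralZl//.
apply: ae_le_Rintegral => //; [exact: rintB|exact: rintZ|].
have hx : {ae mu, forall x, (Z1 x -> A x = 0) /\ (Z2 x -> B x = 0)}.
  have e1 := ae_imp2 (fun x p1 p2 => conj p1 p2) (hZ1 th0) (hZ1 t0).
  have e2 := ae_imp2 (fun x p1 p2 => conj p1 p2) (hZ2 th0) (hZ2 t0).
  have e12 := ae_imp2 (fun x p1 p2 => conj p1 p2) e1 e2.
  apply: ae_imp2 e12 sgp => x [[z1 z2] [z3 z4]] es.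
  split => Zx.
    have := z1 Zx; have := z2 Zx; rewrite /A es /fwd /V /p => y1 y2.
    by transitivity (0 - 0 : R); [rewrite -{1}y2 -[X in _ = _ - X]y1; ring|rewrite subrr].
  have := z3 Zx; have := z4 Zx; rewrite /B es /bwd /V /p => y1 y2.
  by transitivity (0 - 0 : R); [rewrite -{1}y2 -[X in _ = _ - X]y1; ring|rewrite subrr].
have hx2 := ae_imp2 (fun x p1 p2 => conj p1 p2) hx sgp.
apply: ae_imp2 hx2 cond => x [[z1 z2] es] /(_ _ _ z1 z2) c _.
have r0 := c_rho0 co x; have a0 := al0 x.
have -> : ell x - g x = (- w1' x * A x ^+ 2 + w2' x * B x ^+ 2 - (w1 x - w2 x) * q x * A x * B x) / rho x.
  rewrite /ell /g /ka /kb /A' /B' /A /B es.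
  have -> : be x = rho x ^+ 2 / al x by rewrite (c_rho2 co) mulrAC divff ?mul1r// gt_eqF.
  by field; rewrite !gt_eqF.
have -> : fwd p V x = A x by rewrite /A es.
have -> : bwd p V x = B x by rewrite /B es.
rewrite ler_pdivrMr//; apply: (le_trans c); rewrite le_eqVlt; apply/orP; left; apply/eqP.
by field; rewrite gt_eqF.
Qed.

End TimeStep.

(** Gronwall's inequality for the increments over a time step h, divided by h^2, as h
    tends to 0. *)
Lemma energy_decay t : 0 <= t ->
  energy w1 w2 (P t) (v t) <= expR (- (la * t)) * energy w1 w2 (P 0) (v 0).
Proof.
move=> t0.
have dPi := data_dPi data; have dU := data_dU data.
have step h : 0 < h -> energy w1 w2 (fun x => Pi (t + h) x - Pi t x) (fun x => U (t + h) x - U t x) <=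
    expR (- (la * t)) * energy w1 w2 (fun x => Pi (0 + h) x - Pi 0 x) (fun x => U (0 + h) x - U 0 x).
  move=> h0; have h00 := ltW h0.
  pose qh s := energy w1 w2 (fun x => Pi (s + h) x - Pi s x) (fun x => U (s + h) x - U s x).
  apply: (@deriv_at_decay _ qh la) => // s s0.
  have sh0 : 0 <= s + h by exact: addr_ge0.
  have sp r : 0 <= r -> sqint (fun x => Pi (r + h) x - Pi r x).
    by move=> r0; apply: sqintB; apply: (data_Pi data) => //; exact: addr_ge0.
  have sV r : 0 <= r -> sqint (fun x => U (r + h) x - U r x).
    by move=> r0; apply: sqintB; apply: (data_sU data) => //; exact: addr_ge0.
  have sp' : sqint (fun x => P (s + h) x - P s x) by apply: sqintB; apply: (data_P data).
  have sV' : sqint (fun x => v (s + h) x - v s x) by apply: sqintB; apply: (data_v data).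
  have dp : L2_deriv_at (fun r x => Pi (r + h) x - Pi r x) s (fun x => P (s + h) x - P s x).
    apply: L2_deriv_sub (L2_deriv_shift h00 (dPi _ sh0)) (dPi _ s0) => //.
    - by move=> r r0; apply: (data_Pi data); exact: addr_ge0.
    - exact: (data_Pi data).
    - exact: (data_P data).
    - exact: (data_P data).
  have dV : L2_deriv_at (fun r x => U (r + h) x - U r x) s (fun x => v (s + h) x - v s x).
    apply: L2_deriv_sub (L2_deriv_shift h00 (dU _ sh0)) (dU _ s0) => //.
    - by move=> r r0; apply: (data_sU data); exact: addr_ge0.
    - exact: (data_sU data).
    - exact: (data_v data).
    - exact: (data_v data).
  eexists; last exact: (energy_rate_le s0 h00).
  apply: deriv_atD; [apply: deriv_atD|].
  - exact: (bil_deriv mk11 bk11 s0 sV sV sV' sV' dV dV).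
  - exact: (bil_deriv mk12 bk12 s0 sV sp sV' sp' dV dp).
  - exact: (bil_deriv mk22 bk22 s0 sp sp sp' sp' dp dp).
have lim s e : 0 <= s -> 0 < e -> exists2 r : R, 0 < r & forall h : R, 0 < h -> h < r ->
   `|energy w1 w2 (fun x => Pi (s + h) x - Pi s x) (fun x => U (s + h) x - U s x)
     - h ^+ 2 * energy w1 w2 (P s) (v s)| <= h ^+ 2 * e.
  move=> s0 e0; have e30 : 0 < e / 3 by rewrite divr_gt0.
  have sPs := data_P data s0; have svs := data_v data s0.
  have [r1 r10 h1] := bil_increment mk11 bk11 s0 (data_sU data) (data_sU data) svs svs (dU _ s0) (dU _ s0) e30.
  have [r2 r20 h2] := bil_increment mk12 bk12 s0 (data_sU data) (data_Pi data) svs sPs (dU _ s0) (dPi _ s0) e30.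
  have [r3 r30 h3] := bil_increment mk22 bk22 s0 (data_Pi data) (data_Pi data) sPs sPs (dPi _ s0) (dPi _ s0) e30.
  exists (Num.min (Num.min r1 r2) r3); first by rewrite !lt_min r10 r20.
  move=> h h0; rewrite !lt_min => /andP[/andP[/(h1 h h0) k1 /(h2 h h0) k2] /(h3 h h0) k3].
  rewrite /energy; move: k1 k2 k3; rewrite !ler_norml => /andP[k1 k1'] /andP[k2 k2'] /andP[k3 k3'].
  by apply/andP; split; lra.
apply/ler_addgt0Pr => e e0; set E := expR _.
have E0 : 0 < E := expR_gt0 _.
have e10 : 0 < e / (1 + E) by rewrite divr_gt0// addr_gt0.
have [r1 r10 h1] := lim _ _ t0 e10; have [r2 r20 h2] := lim 0 _ (lexx 0) e10.
pose h := Num.min r1 r2 / 2.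
have m0 : 0 < Num.min r1 r2 by rewrite lt_min r10.
have h0 : 0 < h by rewrite divr_gt0.
have hm : h < Num.min r1 r2 by rewrite ltr_pdivrMr// ltr_pMr// ltrDl.
move: (hm); rewrite lt_min => /andP[hr1 hr2].
have := h1 h h0 hr1; have := h2 h h0 hr2; have := step h h0.
rewrite !ler_norml -/E; set a1 := energy _ _ _ _; set a2 := energy _ _ _ _.
set a3 := energy _ _ _ _; set a4 := energy _ _ _ _.
move=> s1 /andP[_ k1'] /andP[k2 _].
have hh : 0 < h ^+ 2 by rewrite exprn_gt0.
rewrite -(ler_pM2l hh).
have eE : e = e / (1 + E) + E * (e / (1 + E)) by field; rewrite gt_eqF// addr_gt0.
move: k1' k2 eE; move: (e / (1 + E)) => y k1' k2 ->.
have k3 : E * (a2 - h ^+ 2 * a3) <= E * (h ^+ 2 * y) by rewrite ler_wpM2l// ltW.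
exact: (limit_bookkeeping s1 k2 k3).
Qed.

End Decay.
End FixedWeights.
End WeightedEnergy.

(** * Weights for the energy *)
Section Decay.
Context {R : realType}.
Local Notation mu := (@lebesgue_measure R).
Local Notation TR := (measurableTypeR R).
Local Notation mset D := (@measurable _ TR D).
Local Notation mfun D f := (@measurable_fun _ _ TR R D f).
Local Notation F := (R -> R^o).
Local Notation L2n := (L2_norm setT : F -> \bar R).
Implicit Types (f g w k : R -> R) (a b c x K : R).

Lemma ae_eq0_of_Rintegral_le0 f : rint setT f -> {ae mu, forall x, 0 <= f x} ->
  \int[mu]_x f x <= 0 -> {ae mu, forall x, f x = 0}.
Proof.
move=> hf f0 If.
have mf := rint_measurable hf.
have e : (\int[mu]_x `|f x|%:E)%E = (\int[mu]_x f x)%:E.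
  transitivity (\int[mu]_x (f x)%:E)%E; last first.
    by rewrite /Rintegral fineK//; exact: integrable_fin_num.
  apply: ae_eq_integral => //; first by apply/measurable_EFinP; exact: measurableT_comp.
    exact/measurable_EFinP.
  by apply: ae_imp f0 => x x0 _; rewrite ger0_norm.
have e0 : (\int[mu]_x `|(EFin \o f) x|)%E = 0%E.
  apply/eqP; rewrite eq_le; apply/andP; split; last exact: integral_ge0.
  by rewrite /= e lee_fin.
have := (ae_eq_integral_abs mu measurableT ((measurable_EFinP _ _).2 mf)).1 e0.
by apply: ae_imp => x /(_ I) /= /eqP; rewrite eqe => /eqP.
Qed.

Lemma n2_eq0 f : sqint f -> n2 f = 0 -> {ae mu, forall x, f x = 0}.
Proof.
move=> hf f0; have := @ae_eq0_of_Rintegral_le0 (fun x => f x ^+ 2) hf.2.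
rewrite -sqr_n2 f0 expr0n lexx => /(_ _ isT) h.
have {h} := h (ae_all (fun x => sqr_ge0 (f x))).
by apply: ae_imp => x /eqP; rewrite sqrf_eq0 => /eqP.
Qed.

Definition primitive_at c f x : R := primitive f x - primitive f c.

Lemma AC_primitive_at c f : lint f -> AC (primitive_at c f) f.
Proof.
move=> hf; have := AC_sub (AC_primitive hf) (AC_cst (primitive f c)).
by congr AC; apply/funext => x; rewrite subr0.
Qed.

Lemma primitive_at_ge c f x : lint f -> c <= x -> primitive_at c f x = \int[mu]_(z in `[c, x]) f z.
Proof. by move=> hf cx; rewrite /primitive_at primitiveB. Qed.

Lemma primitive_at_le c f x : lint f -> x <= c -> primitive_at c f x = - \int[mu]_(z in `[x, c]) f z.
Proof. by move=> hf cx; rewrite -primitiveB// opprB. Qed.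

Lemma int_ge0 f a b : (forall x, a <= x <= b -> 0 <= f x) -> 0 <= \int[mu]_(x in `[a, b]) f x.
Proof. by move=> h; apply: Rintegral_ge0 => x; rewrite /= in_itv/=; exact: h. Qed.

Lemma bounded_lint f K : mfun setT f -> (forall x, `|f x| <= K) -> lint f.
Proof.
move=> mf fK; have := lint_bounded mf fK (lint_cst 1); congr lint.
by apply/funext => x; rewrite mulr1.
Qed.

Lemma mfun_indic f (I : set R) : mset I -> mfun setT f -> mfun setT (fun x => f x * \1_I x).
Proof. by move=> mI mf; apply: measurable_funM => //; exact: measurable_indic. Qed.

Lemma indic_bounded f (I : set R) K : (forall x, `|f x| <= K) -> forall x, `|f x * \1_I x| <= K.
Proof.
move=> fK x; rewrite indicE; case: (_ \in _); rewrite ?mulr1// mulr0 normr0.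
exact: le_trans (fK x).
Qed.

Variables (al be al' be' rho q : R -> R) (d M : R).
Hypothesis co : coefficients al be al' be' rho q d M.

Let al0 x : 0 < al x.
Proof. by case/andP: (c_ald co x) => h _; exact: lt_le_trans (c_d co) h. Qed.

Let M0 : 0 < M.
Proof. by case/andP: (c_ald co 0) => h1 h2; exact: lt_le_trans (c_d co) (le_trans h1 h2). Qed.

Let alM x : `|al x| <= M.
Proof. by rewrite gtr0_norm//; case/andP: (c_ald co x). Qed.

Let rhoM x : `|rho x| <= M.
Proof. by rewrite gtr0_norm ?(c_rho0 co)//; case/andP: (rho_bounds co x). Qed.

Let mal := AC_mfun (c_al co).
Let mrho := AC_mfun (c_rho co).

(** ** Weights *)

(** The coupling term is at most 2 kappa s (E - eta) (A^2 + B^2), which leaves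
    2 kappa s eta (A^2 + B^2) out of the derivative of the weights. *)
Lemma core_weight_inequality (kappa eta E s qx A B : R) : 0 <= kappa -> 0 < eta ->
  eta <= E <= 1 -> 0 <= s -> `|qx| <= 2 * kappa * s ->
  - (2 * kappa * s * E) * A ^+ 2 + - (2 * kappa * s * E) * B ^+ 2 -
    ((1 + eta - E) - (1 - eta + E)) * qx * A * B <=
  - (kappa * eta * s * ((1 + eta - E) * A ^+ 2 + (1 - eta + E) * B ^+ 2)).
Proof.
move=> k0 e0 /andP[eE E1] s0 qk.
have ks : 0 <= kappa * s by rewrite mulr_ge0.
have AB : `|qx * (2 * (A * B))| <= 2 * (kappa * s) * (A ^+ 2 + B ^+ 2).
  rewrite normrM [2 * (kappa * s)]mulrA; apply: ler_pM => //.
  rewrite ler_norml; apply/andP; split; first by have := sqr_ge0 (A + B); nra.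
  by have := sqr_ge0 (A - B); nra.
have h1 : (E - eta) * (qx * (2 * (A * B))) <= (E - eta) * (2 * (kappa * s) * (A ^+ 2 + B ^+ 2)).
  by rewrite ler_wpM2l ?subr_ge0// (le_trans (ler_norm _) AB).
have A2 := sqr_ge0 A; have B2 := sqr_ge0 B.
have h2 : eta * (kappa * s) * ((1 + eta - E) * A ^+ 2 + (1 - eta + E) * B ^+ 2) <=
    eta * (kappa * s) * (2 * (A ^+ 2 + B ^+ 2)).
  rewrite ler_wpM2l ?mulr_ge0 ?(ltW e0)//.
  have : (1 + eta - E) * A ^+ 2 <= 2 * A ^+ 2 by rewrite ler_wpM2r//; lra.
  have : (1 - eta + E) * B ^+ 2 <= 2 * B ^+ 2 by rewrite ler_wpM2r//; lra.
  by lra.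
move: h1 h2; move: (A ^+ 2) (B ^+ 2) => a2 b2; lra.
Qed.

Lemma lint_indic f (I : set R) K : mset I -> mfun setT f -> (forall x, `|f x| <= K) ->
  lint (fun x => f x * \1_I x).
Proof.
move=> mI mf fK; apply: (@bounded_lint _ K); first exact: mfun_indic.
exact: indic_bounded.
Qed.

(** This weight isolates the waves on one side of c, where it is positive; sg, which is 1
    or -1, selects the side. *)
Lemma ramp_weight (sg c : R) : `|sg| <= 1 ->
  weight (fun x => flat 0 (sg * (x - c))) (fun x => sg * flat 2 (sg * (x - c))) 2.
Proof.
move=> sg1; split.
- have cflat (k : nat) : continuous (flat k : R -> R).
    move=> x; have df := is_derive_flat k x.
    by apply: differentiable_continuous; apply/derivable1_diffP; case: df.
  apply: AC_of_derive => x.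
    apply: cvgM; first exact: cvg_cst.
    have cl : {for x, continuous (fun y : R => sg * (y - c))}.
      by apply: cvgM; [exact: cvg_cst|apply: cvgB; [exact: cvg_id|exact: cvg_cst]].
    exact: (@continuous_comp _ _ _ (fun y : R => sg * (y - c)) (flat 2) x cl (cflat 2 _)).
  have dl : is_derive x 1 (fun y : R => sg * (y - c)) sg.
    by apply: is_derive_eq; rewrite -![_ *: _]/(_ * _); ring.
  have := @is_derive1_comp _ (flat 0) (fun y => sg * (y - c)) _ _ _ (is_derive_flat 0 _) dl.
  by move=> df; refine (is_derive1_eq df _); rewrite mul0r subr0 mulrC.
- by move=> x; rewrite ger0_norm ?flat_ge0// (le_trans (flat0_le1 _))// ler1n.
- move=> x; rewrite normrM [`|flat _ _|]ger0_norm ?flat_ge0// -[leRHS]mul1r.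
  by apply: ler_pM => //; [exact: flat_ge0|exact: (flat_le_fact 2)].
Qed.

Lemma flat0_gt0 x : 0 < x -> 0 < flat 0 x.
Proof. by move=> x0; rewrite /flat x0 expr0 mul1r expR_gt0. Qed.

Lemma flat0_eq0 x : x <= 0 -> flat 0 x = 0.
Proof. by move=> x0; rewrite /flat ltNge x0. Qed.

Lemma weight0 W : 0 <= W -> weight (fun=> 0) (fun=> 0) (W : R).
Proof. by move=> W0; split => [|x|x]; [exact: AC_cst|rewrite normr0|rewrite normr0]. Qed.

Lemma weight_mul m m' g g' (X X' Y Y' : R) : AC m m' -> AC g g' ->
  (forall x, `|m x| <= X) -> (forall x, `|m' x| <= X') ->
  (forall x, `|g x| <= Y) -> (forall x, `|g' x| <= Y') ->
  weight (fun x => m x * g x) (fun x => m' x * g x + m x * g' x) (X * Y + (X' * Y + X * Y')).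
Proof.
move=> hm hg mX mX' gY gY'.
have h (z z' W W' : R) : `|z| <= W -> `|z'| <= W' -> 0 <= W * W'.
  by move=> zW zW'; rewrite mulr_ge0 ?(le_trans _ zW) ?(le_trans _ zW').
split; first exact: AC_mul.
- move=> x; apply: (le_trans (normM_le (mX x) (gY x))); rewrite lerDl addr_ge0//.
    exact: (h (m' x) (g x)).
  exact: (h (m x) (g' x)).
- move=> x; apply: (le_trans (ler_normD _ _)).
  apply: (@le_trans _ _ (X' * Y + X * Y')); first by apply: lerD; exact: normM_le.
  by rewrite lerDr; exact: (h (m x) (g x)).
Qed.

(** The inverse of the wave speed; its integral is the travel time. *)
Definition slowness x : R := rho x / al x.

Lemma slowness_gt0 x : 0 < slowness x.
Proof. by rewrite divr_gt0 ?(c_rho0 co). Qed.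

Lemma slowness_le x : slowness x <= M / d.
Proof.
have /andP[r1 r2] := rho_bounds co x; have /andP[a1 a2] := c_ald co x.
rewrite /slowness ler_pM ?invr_ge0 ?(ltW (al0 x)) ?(ltW (c_rho0 co x))//.
by rewrite lef_pV2 ?posrE ?(c_d co).
Qed.

Lemma slowness_continuous : continuous slowness.
Proof.
move=> x; apply: cvgM; first exact: (AC_continuous (c_rho co)).
by apply: cvgV; [rewrite gt_eqF|exact: (AC_continuous (c_al co))].
Qed.

(** The weights that give the decay rate kappa * eta for the energy. On [l, r],
    which contains all the inhomogeneities, w1 = 1 + m and w2 = 1 - m with
    m = eta - exp(-2 kappa y), y being the travel time from l. Outside [l, r]
    they are continued by the exponentials of travel time that make the equality
    hold for outgoing waves; incoming waves only occur in [a, b], and beyond this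
    interval the weight of the incoming wave is kept constant, so that both
    weights are bounded. *)
Lemma ex_decay_weights a b l r kappa : a <= l -> l <= r -> r <= b -> 0 <= kappa ->
  {ae mu, forall x, (x < l) || (r < x) -> q x = 0} ->
  {ae mu, forall x, `|q x| <= 2 * kappa * slowness x} ->
  let eta := expR (- (2 * kappa * \int[mu]_(x in `[l, r]) slowness x)) in
  exists w1 w1' w2 w2' W, [/\ weight w1 w1' W, weight w2 w2' W,
    (forall x, 0 < w1 x), (forall x, 0 < w2 x) &
    {ae mu, forall x, forall A B : R, (b < x -> A = 0) -> (x < a -> B = 0) ->
      - w1' x * A ^+ 2 + w2' x * B ^+ 2 - (w1 x - w2 x) * q x * A * B <=
      - (kappa * eta * (rho x / al x) * (w1 x * A ^+ 2 + w2 x * B ^+ 2)) }].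
Proof.
move=> al_ lr rb k0 q0 qk eta.
have ms : mfun setT slowness := continuous_measurable_fun slowness_continuous.
have sM x : `|slowness x| <= M / d by rewrite gtr0_norm ?slowness_gt0// slowness_le.
have s0 x : 0 <= slowness x := ltW (slowness_gt0 x).
pose J := [set` `[l, r]].
pose I1 := [set` `]-oo, b]] `\` J; pose I2 := [set` `[a, +oo[] `\` J.
have mJ : mset J by exact: measurable_itv.
have mI1 : mset I1 by apply: measurableD; exact: measurable_itv.
have mI2 : mset I2 by apply: measurableD; exact: measurable_itv.
pose fJ x := slowness x * \1_J x; pose f1 x := slowness x * \1_I1 x; pose f2 x := slowness x * \1_I2 x.
have hJ : lint fJ by exact: lint_indic sM.
have h1 : lint f1 by exact: lint_indic sM.
have h2 : lint f2 by exact: lint_indic sM.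
have ind0 (I : set R) x : 0 <= slowness x * \1_I x.
  by rewrite mulr_ge0// indicE; case: (_ \in _).
have indM (I : set R) x : `|slowness x * \1_I x| <= M / d by exact: indic_bounded.
pose y := primitive_at l fJ; pose z1 := primitive_at l f1; pose z2 := primitive_at l f2.
have ay : AC y fJ := AC_primitive_at l hJ.
have az1 : AC z1 f1 := AC_primitive_at l h1.
have az2 : AC z2 f2 := AC_primitive_at l h2.
have mono g c x x' : AC (primitive_at c g) g -> (forall x, 0 <= g x) -> x <= x' ->
    primitive_at c g x <= primitive_at c g x'.
  by move=> hg g0 xx; rewrite -subr_ge0 hg.2//; apply: int_ge0 => z _.
have at0 g c : primitive_at c g c = 0 by rewrite /primitive_at subrr.
set T := \int[mu]_(x in `[l, r]) slowness x in eta *.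
have Jx x : l <= x <= r -> [/\ fJ x = slowness x, f1 x = 0 & f2 x = 0].
  move=> lxr; have JJ : J x by rewrite /J /= in_itv.
  rewrite /fJ /f1 /f2 !indicE mem_set// !memNset ?mulr1 ?mulr0//; by move=> [].
have nJx x : (x < l) || (r < x) -> ~ J x.
  move=> h; rewrite /J /= in_itv/= => /andP[h3 h4]; move: h; rewrite ltNge h3/= ltNge h4//.
have yr : y r = T.
  rewrite /y primitive_at_ge//; apply: eq_Rintegral => x; rewrite inE/= in_itv/= => lxr.
  by have [-> _ _] := Jx _ lxr.
have yT x : 0 <= y x <= T.
  have [xl|lx] := leP x l.
    rewrite /y primitive_at_le// int_eq0 ?oppr0 ?lexx ?int_ge0//=.
    by move=> z /andP[_ zl]; rewrite /fJ indicE memNset ?mulr0//; apply: nJx; rewrite zl.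
  rewrite -{1}(at0 fJ l) mono ?(ltW lx)//=; last exact: ind0.
  have [xr|rx] := leP x r; first by rewrite -yr mono//; exact: ind0.
  rewrite -yr -subr_le0 /y (AC_primitive_at l hJ).2 ?(ltW rx)// int_eq0//.
  by move=> z /andP[rz _]; rewrite /fJ indicE memNset ?mulr0//; apply: nJx; rewrite rz orbT.
pose E x := expR (- (2 * kappa) * y x).
have k20 : 0 <= 2 * kappa by rewrite mulr_ge0.
have Ebd x : eta <= E x <= 1.
  have /andP[y0 y1] := yT x; rewrite /eta /E mulNr -[X in _ && (_ <= X)]expR0 !ler_expR.
  by rewrite lerN2 ler_wpM2l//= oppr_le0 mulr_ge0.
have eta0 : 0 < eta := expR_gt0 _.
have aE : AC E (fun x => E x * (- (2 * kappa) * fJ x)) := AC_exp (AC_scale _ ay).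
set la := kappa * eta; have la0 : 0 <= la by rewrite mulr_ge0// ltW.
pose g1 x := expR (la * z1 x); pose g2 x := expR (- la * z2 x).
have ag1 : AC g1 (fun x => g1 x * (la * f1 x)) := AC_exp (AC_scale _ az1).
have ag2 : AC g2 (fun x => g2 x * (- la * f2 x)) := AC_exp (AC_scale _ az2).
have z1b x : z1 x <= z1 b.
  have [xb|bx] := leP x b; first by apply: mono => //; exact: ind0.
  rewrite -subr_le0 (AC_primitive_at l h1).2 ?(ltW bx)// int_eq0//.
  by move=> z /andP[bz _]; rewrite /f1 indicE memNset ?mulr0// => -[]; rewrite /= in_itv/= leNgt bz.
have z2a x : z2 a <= z2 x.
  have [ax|xa] := leP a x; first by apply: mono => //; exact: ind0.
  rewrite -subr_le0 (AC_primitive_at l h2).2 ?(ltW xa)// int_eq0//.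
  by move=> z /andP[_ za]; rewrite /f2 indicE memNset ?mulr0// => -[]; rewrite /= in_itv/= andbT leNgt za.
pose G := Num.max (g1 b) (g2 a).
have g1G x : 0 < g1 x <= G.
  by rewrite expR_gt0 le_max; apply/orP; left; rewrite ler_expR ler_wpM2l.
have g2G x : 0 < g2 x <= G.
  by rewrite expR_gt0 le_max; apply/orP; right; rewrite ler_expR !mulNr lerN2 ler_wpM2l.
have G0 : 0 < G by have /andP[h3 h4] := g1G 0; exact: lt_le_trans h4.
have JI x : l <= x <= r -> g1 x = 1 /\ g2 x = 1.
  move=> lxr; have zz g : AC (primitive_at l g) g -> (forall z, l <= z <= r -> g z = 0) -> primitive_at l g x = 0.
    move=> hg gz; case/andP: lxr => lx xr; rewrite primitive_at_ge//; last exact: AC_lint hg.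
    rewrite int_eq0//; first exact: AC_lint hg.
    by move=> z /andP[lz zx]; apply: gz; rewrite (ltW lz) (le_trans (ltW zx)).
  have zz1 : z1 x = 0 by apply: zz => // z /Jx[].
  have zz2 : z2 x = 0 by apply: zz => // z /Jx[].
  by split; rewrite /g1 /g2 ?zz1 ?zz2 mulr0 expR0.
have off x : (x < l) || (r < x) ->
    [/\ fJ x = 0, x <= b -> f1 x = slowness x & a <= x -> f2 x = slowness x].
  move=> /nJx nJ; split=> [|xb|ax]; first by rewrite /fJ indicE memNset ?mulr0.
    by rewrite /f1 indicE mem_set ?mulr1//; split => //; rewrite /= in_itv.
  by rewrite /f2 indicE mem_set ?mulr1//; split => //; rewrite /= in_itv/= andbT.
have fJM x : `|fJ x| <= M / d by exact: indM.
have f1M x : `|f1 x| <= M / d by exact: indM.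
have f2M x : `|f2 x| <= M / d by exact: indM.
have laE : la = kappa * eta by [].
clearbody G E g1 g2 la.
clear mono at0 yr yT z1b z2a ay az1 az2 y z1 z2 nJx ind0 indM.
clear hJ h1 h2 ms mJ mI1 mI2; clearbody fJ f1 f2; clear J I1 I2; clearbody eta; clear T.
pose w1 x : R := (1 + eta - E x) * g1 x; pose w2 x : R := (1 - eta + E x) * g2 x.
pose w1' x : R := (0 - E x * (- (2 * kappa) * fJ x)) * g1 x + (1 + eta - E x) * (g1 x * (la * f1 x)).
pose w2' x : R := (0 + E x * (- (2 * kappa) * fJ x)) * g2 x + (1 - eta + E x) * (g2 x * (- la * f2 x)).
pose W : R := 2 * G + (2 * kappa * (M / d) * 1 * G + 2 * (G * (la * (M / d)))).
have Md0 : 0 <= M / d := le_trans (normr_ge0 _) (sM 0).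
have E12 x : eta <= 1 + eta - E x <= 1 by have /andP[e1 e2] := Ebd x; apply/andP; split; lra.
have eta1 : eta <= 1 by have /andP[e1 e2] := Ebd 0; exact: le_trans e2.
have E22 x : 1 <= 1 - eta + E x <= 2 by have /andP[e1 e2] := Ebd x; apply/andP; split; lra.
have E12a x : `|1 + eta - E x| <= 2.
  by have /andP[e1 e2] := E12 x; rewrite ger0_norm; lra.
have E22a x : `|1 - eta + E x| <= 2.
  by have /andP[e1 e2] := E22 x; rewrite ger0_norm; lra.
have Ea x : `|E x| <= 1 by have /andP[e1 e2] := Ebd x; rewrite gtr0_norm// (lt_le_trans eta0).
have g1a x : `|g1 x| <= G by have /andP[e1 e2] := g1G x; rewrite gtr0_norm.
have g2a x : `|g2 x| <= G by have /andP[e1 e2] := g2G x; rewrite gtr0_norm.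
have mE' x : `|E x * (- (2 * kappa) * fJ x)| <= 2 * kappa * (M / d) * 1.
  rewrite mulrC; apply: normM_le => //; apply: normM_le; last exact: fJM.
  by rewrite normrN ger0_norm.
have g1' x : `|g1 x * (la * f1 x)| <= G * (la * (M / d)).
  by apply: normM_le => //; apply: normM_le; [rewrite ger0_norm|exact: f1M].
have g2' x : `|g2 x * (- la * f2 x)| <= G * (la * (M / d)).
  by apply: normM_le => //; apply: normM_le; [rewrite normrN ger0_norm|exact: f2M].
have hw1 : weight w1 w1' W.
  apply: weight_mul ag1 E12a _ g1a g1'; first exact: AC_sub (AC_cst (1 + eta)) aE.
  by move=> x; rewrite sub0r normrN.
have hw2 : weight w2 w2' W.
  apply: weight_mul ag2 E22a _ g2a g2'; first exact: AC_add (AC_cst (1 - eta)) aE.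
  by move=> x; rewrite add0r.
exists w1, w1', w2, w2', W; split => //.
- move=> x; rewrite mulr_gt0//; last by case/andP: (g1G x).
  by case/andP: (E12 x) => e1 _; exact: lt_le_trans e1.
- move=> x; rewrite mulr_gt0//; last by case/andP: (g2G x).
  by case/andP: (E22 x) => e1 _; exact: lt_le_trans e1.
have hx := ae_imp2 (fun x p1 p2 => conj p1 p2) q0 qk.
apply: ae_imp hx => x [qx0 qxk] A B A0 B0.
rewrite -/(slowness x).
have sx := s0 x; have [lxr|] := boolP (l <= x <= r).
  have [eJ e1 e2] := Jx _ lxr.
  have [gx1 gx2] := JI _ lxr.
  rewrite /w1' /w2' /w1 /w2 eJ e1 e2 gx1 gx2 !mulr0 !mulr1 !addr0 sub0r add0r.
  have -> : E x * (- (2 * kappa) * slowness x) = - (2 * kappa * slowness x * E x) by ring.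
  by rewrite opprK laE; exact: core_weight_inequality.
rewrite negb_and -!ltNge => nx; have qq := qx0 nx; have [eJ f1x f2x] := off _ nx.
rewrite qq !mulr0 !mul0r subr0.
have c1 : - w1' x * A ^+ 2 = - (la * slowness x * (w1 x * A ^+ 2)).
  have [xb|bx] := leP x b; last by rewrite A0// expr0n/= !mulr0 oppr0.
  by rewrite /w1' /w1 eJ (f1x xb); ring.
have c2 : w2' x * B ^+ 2 = - (la * slowness x * (w2 x * B ^+ 2)).
  have [ax|xa] := leP a x; last by rewrite B0// expr0n/= !mulr0 oppr0.
  by rewrite /w2' /w2 eJ (f2x ax); ring.
by rewrite c1 c2 le_eqVlt; apply/orP; left; apply/eqP; ring.
Qed.

(** ** Time integrals of outgoing waves *)
Section Solution.
Variables (u0 u1 : R -> R) (u v P U Pi S : R -> R -> R).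
Hypothesis data : wave_data al be u0 u1 u v P U Pi S.

(** Tested against the function g = 1_Z (rho (U T - U 0) + sg al Pi T), the left hand
    side at time t has the relation for the solution at time t as its derivative, and it
    vanishes at time 0. At time T it is the square of the norm of g. *)
Lemma integral_vanish (sg : R) (Z : set R) : mset Z ->
  (forall t, 0 <= t -> {ae mu, forall x, Z x -> rho x * v t x + sg * (al x * P t x) = 0}) ->
  forall t, 0 <= t ->
    {ae mu, forall x, Z x -> rho x * (U t x - U 0 x) + sg * (al x * Pi t x) = 0}.
Proof.
move=> mZ h T T0.
pose one x : R := \1_Z x.
pose k1 x : R := rho x * one x; pose k2 x : R := sg * (al x * one x).
have mk1 : mfun setT k1 by exact: mfun_indic.
have k1M x : `|k1 x| <= M by exact: indic_bounded rhoM x.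
have mk2 : mfun setT k2 by apply: measurable_funM => //; exact: mfun_indic.
have k2M x : `|k2 x| <= `|sg| * M by apply: normM_le => //; exact: indic_bounded alM x.
pose D t x := U t x - U 0 x.
have sD t : 0 <= t -> sqint (D t) by move=> t0; apply: sqintB; exact: (data_sU data).
pose g x := k1 x * D T x + k2 x * Pi T x.
have sg_ : sqint g.
  by apply: sqintD; [exact: sqint_bounded mk1 k1M (sD T T0)|exact: sqint_bounded mk2 k2M (data_Pi data T0)].
have dD t : 0 <= t -> L2_deriv_at D t (v t).
  move=> t0 e e0; have [r r0 hr] := data_dU data t0 e0; exists r => // z z0 zt.
  have := hr z z0 zt; congr (n2 _ <= _); apply/funext => x; rewrite /D; ring.
have dg t : 0 <= t -> L2_deriv_at (fun=> g) t (fun=> 0).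
  move=> _ e e0; exists 1 => // z _ _; rewrite (_ : (fun x => _) = (fun=> 0)).
    by rewrite n2_0 mulr_ge0// ltW.
  by apply/funext => x; rewrite mulr0 !subrr.
have bil0 k K f : mfun setT k -> (forall x, `|k x| <= K) -> sqint f -> bil k f (fun=> 0) = 0.
  by move=> mk kK sf; have := bil_le mk kK sf sqint0; rewrite n2_0 !mulr0 normr_le0 => /eqP.
pose w t := bil k1 (D t) g + bil k2 (Pi t) g.
have dw t : 0 <= t -> exists2 l, deriv_at w t l & l <= - (0 * w t).
  move=> t0; eexists.
    apply: deriv_atD; [exact: (bil_deriv mk1 k1M t0 sD (fun _ _ => sg_) (data_v data t0) sqint0 (dD t t0) (dg t t0))|].
    exact: (bil_deriv mk2 k2M t0 (data_Pi data) (fun _ _ => sg_) (data_P data t0) sqint0 (data_dPi data t0) (dg t t0)).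
  rewrite (bil0 k1 M)//; last exact: sD.
  rewrite (bil0 k2 (`|sg| * M))//; last exact: (data_Pi data).
  rewrite mul0r oppr0 !addr0.
  have i1 := bil_rint mk1 k1M (data_v data t0) sg_; have i2 := bil_rint mk2 k2M (data_P data t0) sg_.
  rewrite /bil -RintegralD// le_eqVlt; apply/orP; left; apply/eqP.
  transitivity (\int[mu]_(x in [set: R]) (0 : R)); last by rewrite /Rintegral integral0.
  apply: ae_eq_Rintegral => //; first exact: rint_measurable (rintD measurableT i1 i2).
  apply: ae_imp (h t t0) => x hx _; rewrite /k1 /k2 /one indicE.
  have [Zx|nZ] := pselect (Z x); last by rewrite memNset// !mulr0 !mul0r addr0.
  rewrite mem_set// !mulr1; transitivity ((rho x * v t x + sg * (al x * P t x)) * g x); first by ring.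
  by rewrite hx// mul0r.
have := deriv_at_decay dw T0; rewrite mul0r oppr0 expR0 mul1r.
have -> : w 0 = 0.
  rewrite /w ![bil _ _ g]bilC (_ : D 0 = (fun=> 0)); last by apply/funext => x; rewrite /D subrr.
  rewrite (bil0 k1 M)// add0r; apply/eqP; rewrite -normr_le0.
  by apply: (le_trans (bil_le mk2 k2M sg_ (data_Pi data (lexx 0)))); rewrite (data_Pi0 data) !mulr0.
have -> : w T = n2 g ^+ 2.
  have i1 := bil_rint mk1 k1M (sD T T0) sg_; have i2 := bil_rint mk2 k2M (data_Pi data T0) sg_.
  rewrite sqr_n2 /w /bil -RintegralD//; apply: eq_Rintegral => x _; rewrite /g; ring.
move=> g0; have {g0} /(n2_eq0 sg_) : n2 g = 0 by apply/eqP; rewrite -sqrf_eq0 eq_le g0 sqr_ge0.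
apply: ae_imp => x; rewrite /g /k1 /k2 /one /D indicE => + Zx.
by rewrite mem_set// !mulr1 => e; rewrite -[RHS]e; ring.
Qed.

End Solution.
End Decay.

(** * Decay on a bounded interval *)
Section LocalDecay.
Context {R : realType}.
Local Notation mu := (@lebesgue_measure R).
Local Notation TR := (measurableTypeR R).
Local Notation mset D := (@measurable _ TR D).
Local Notation mfun D f := (@measurable_fun _ _ TR R D f).
Local Notation F := (R -> R^o).
Implicit Types (f g w k : R -> R) (a b c x K : R) (Omega : set R).

(** ** Local norms *)

Lemma L2_norm_local_le Omega f g a b c : mset Omega -> Omega `<=` [set` `[a, b]] ->
  mfun Omega g -> {ae mu, forall x, Omega x -> g x = f x} ->
  rint `[a, b] (fun x => f x ^+ 2) -> 0 <= c -> \int[mu]_(x in `[a, b]) f x ^+ 2 <= c ^+ 2 ->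
  (L2_norm Omega g <= c%:E)%E.
Proof.
move=> mO sub mg gf hf c0 hc.
have mI : mset [set` `[a, b]] by exact: measurable_itv.
have hfO : rint Omega (fun x => f x ^+ 2) by exact: rintS mI sub hf.
have mg2 : mfun Omega (fun x => g x ^+ 2) by exact: measurable_funX.
have gf2 : {ae mu, forall x, Omega x -> f x ^+ 2 = g x ^+ 2}.
  by apply: ae_imp gf => x h Ox; rewrite h.
have hg2 := ae_eq_rint mO mg2 gf2 hfO.
have e2 : (fun x => (g \_ Omega) x ^+ 2) = (fun x => g x ^+ 2) \_ Omega.
  by apply/funext => x; rewrite !patchE; case: ifP => // _; rewrite expr0n.
have sg : sqint (g \_ Omega).
  split; first exact: ((measurable_restrictT g mO).1 mg).
  rewrite e2 /rint -restrict_EFin.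
  exact: ((@integrable_mkcond _ TR R mu Omega (EFin \o (fun x => g x ^+ 2)) mO).1 hg2).
rewrite L2_norm_restrict// lee_fin; apply: n2_le => //.
rewrite e2 -Rintegral_mkcond -(ae_eq_Rintegral mO (rint_measurable hfO) mg2 gf2).
by apply: le_trans hc; apply: ge0_Rintegral_subset => // x _; exact: sqr_ge0.
Qed.

(** Cauchy-Schwarz in its additive form, with the decaying factor k as weight. *)
Lemma int_abs_le f a b (k : R) K : 0 < k -> a <= b -> lint f -> rint `[a, b] (fun x => f x ^+ 2) ->
  \int[mu]_(x in `[a, b]) f x ^+ 2 <= K * k ^+ 2 ->
  \int[mu]_(x in `[a, b]) `|f x| <= (b - a + K) * k.
Proof.
move=> k0 ab lf hf hK.
have mI : mset [set` `[a, b]] by exact: measurable_itv.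
apply: (@le_trans _ _ (\int[mu]_(x in `[a, b]) (k + k^-1 * f x ^+ 2))).
  apply: le_Rintegral => //; first exact: (lint_norm lf).2.
    by apply: rintD => //; [exact: rint_cst|exact: rintZ].
  move=> x _; rewrite -(ler_pM2l k0) mulrDr mulrA divff ?gt_eqF// mul1r.
  by rewrite -[f x ^+ 2]real_normK ?num_real//; move: `|f x| => y; nra.
rewrite RintegralD//; [|exact: rint_cst|exact: rintZ].
rewrite Icst// RintegralZl// mulrDl [k * _]mulrC lerD2l mulrC ler_pdivrMr//.
by rewrite -mulrA -expr2.
Qed.

Lemma positive_lower_bound w a b : a <= b -> continuous w -> (forall x, 0 < w x) ->
  exists2 m : R, 0 < m & forall x, a <= x <= b -> m <= w x.
Proof.
move=> ab cw w0; have [c _ hc] := EVT_min ab (continuous_subspaceT cw).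
by exists (w c) => // x xab; apply: hc; rewrite in_itv.
Qed.

Variables (al be al' be' rho q : R -> R) (d M : R).
Hypothesis co : coefficients al be al' be' rho q d M.

Let al0 x : 0 < al x.
Proof. by case/andP: (c_ald co x) => h _; exact: lt_le_trans (c_d co) h. Qed.

Let M0 : 0 < M.
Proof. by case/andP: (c_ald co 0) => h1 h2; exact: lt_le_trans (c_d co) (le_trans h1 h2). Qed.

Variables (u0 u1 : R -> R) (u v P U Pi S : R -> R -> R).
Hypothesis data : wave_data al be u0 u1 u v P U Pi S.

(** ** Finite speed of propagation *)

Lemma energy_stays_zero w1 w1' w2 w2' (W : R) :
  weight w1 w1' W -> weight w2 w2' W -> (forall x, 0 <= w1 x) -> (forall x, 0 <= w2 x) ->
  {ae mu, forall x, forall A B : R,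
    - w1' x * A ^+ 2 + w2' x * B ^+ 2 - (w1 x - w2 x) * q x * A * B <= 0} ->
  {ae mu, forall x, w1 x * fwd al rho (P 0) (v 0) x ^+ 2 + w2 x * bwd al rho (P 0) (v 0) x ^+ 2 = 0} ->
  forall t, 0 <= t ->
  {ae mu, forall x, w1 x * fwd al rho (P t) (v t) x ^+ 2 + w2 x * bwd al rho (P t) (v t) x ^+ 2 = 0}.
Proof.
move=> hw1 hw2 w10 w20 cond h0 t t0.
have cond' : {ae mu, forall x, forall A B : R, (False -> A = 0) -> (False -> B = 0) ->
    - w1' x * A ^+ 2 + w2' x * B ^+ 2 - (w1 x - w2 x) * q x * A * B <=
    - (0 * (rho x / al x) * (w1 x * A ^+ 2 + w2 x * B ^+ 2)) }.
  by apply: ae_imp cond => x h A B _ _; rewrite !mul0r oppr0.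
have tr s : 0 <= s -> {ae mu, forall x, False -> fwd al rho (Pi s) (fun z => U s z - U 0 z) x = 0}.
  by move=> _; exact: ae_all.
have tr' s : 0 <= s -> {ae mu, forall x, False -> bwd al rho (Pi s) (fun z => U s z - U 0 z) x = 0}.
  by move=> _; exact: ae_all.
have := energy_decay co hw1 hw2 data tr tr' cond' t0.
have [i0 ->] := energyE co hw1 hw2 (data_P data (lexx 0)) (data_v data (lexx 0)).
have [it ->] := energyE co hw1 hw2 (data_P data t0) (data_v data t0).
rewrite mul0r oppr0 expR0 mul1r.
have -> : \int[mu]_x ((w1 x * fwd al rho (P 0) (v 0) x ^+ 2 +
    w2 x * bwd al rho (P 0) (v 0) x ^+ 2) / al x) = 0.
  transitivity (\int[mu]_(x in [set: R]) (0 : R)); last by rewrite /Rintegral integral0.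
  apply: ae_eq_Rintegral => //; first exact: (rint_measurable i0).
  by apply: ae_imp h0 => x -> _; rewrite mul0r.
move=> it0; have it_ge0 x : 0 <= (w1 x * fwd al rho (P t) (v t) x ^+ 2 +
    w2 x * bwd al rho (P t) (v t) x ^+ 2) / al x.
  by rewrite divr_ge0 ?(ltW (al0 x))// addr_ge0// mulr_ge0 ?sqr_ge0.
apply: ae_imp (ae_eq0_of_Rintegral_le0 it (ae_all it_ge0) it0) => x /eqP.
by rewrite mulf_eq0 invr_eq0 (gt_eqF (al0 x)) orbF => /eqP.
Qed.

(** Where the coefficients are constant no incoming wave is created: with a weight
    that vanishes elsewhere, its energy does not increase. *)
Lemma no_incoming_right b :
  {ae mu, forall x, b < x -> q x = 0} ->
  {ae mu, forall x, b < x -> fwd al rho (P 0) (v 0) x = 0} ->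
  forall t, 0 <= t -> {ae mu, forall x, b < x -> fwd al rho (P t) (v t) x = 0}.
Proof.
move=> q0 h0 t t0; have hw := @ramp_weight R 1 b; rewrite normr1 in hw.
have wl x : x <= b -> flat 0 (1 * (x - b)) = 0 by move=> xb; rewrite flat0_eq0// mul1r subr_le0.
have := @energy_stays_zero _ _ (fun=> 0) (fun=> 0) 2 (hw (lexx _)) (weight0 _) (fun=> flat_ge0 _ _)
  (fun=> lexx _).
move=> /(_ (ler0n _ 2)) h; apply: ae_imp (h _ _ t t0) => [x||].
- rewrite mul0r addr0 => /eqP; rewrite mulf_eq0 => /orP[/eqP e|]; last by rewrite sqrf_eq0 => /eqP.
  by move=> bx; have := @flat0_gt0 R (1 * (x - b)); rewrite e mul1r subr_gt0 ltxx => /(_ bx).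
- apply: ae_imp q0 => x qx A B; rewrite subr0 mul0r addr0.
  have -> : flat 0 (1 * (x - b)) * q x = 0 by have [/wl ->|/qx ->] := leP x b; rewrite ?mul0r ?mulr0.
  by rewrite !mul0r subr0 mulNr oppr_le0 mulr_ge0 ?sqr_ge0// mul1r flat_ge0.
- apply: ae_imp h0 => x hx; rewrite mul0r addr0.
  by have [/wl ->|/hx ->] := leP x b; rewrite ?expr0n ?mul0r ?mulr0.
Qed.

Lemma no_incoming_left a :
  {ae mu, forall x, x < a -> q x = 0} ->
  {ae mu, forall x, x < a -> bwd al rho (P 0) (v 0) x = 0} ->
  forall t, 0 <= t -> {ae mu, forall x, x < a -> bwd al rho (P t) (v t) x = 0}.
Proof.
move=> q0 h0 t t0; have hw := @ramp_weight R (-1) a; rewrite normrN1 in hw.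
have wl x : a <= x -> flat 0 (-1 * (x - a)) = 0.
  by move=> xb; rewrite flat0_eq0// mulN1r oppr_le0 subr_ge0.
have := @energy_stays_zero (fun=> 0) (fun=> 0) _ _ 2 (weight0 _) (hw (lexx _)) (fun=> lexx _)
  (fun=> flat_ge0 _ _).
move=> /(_ (ler0n _ 2)) h; apply: ae_imp (h _ _ t t0) => [x||].
- rewrite mul0r add0r => /eqP; rewrite mulf_eq0 => /orP[/eqP e|]; last by rewrite sqrf_eq0 => /eqP.
  by move=> xa; have := @flat0_gt0 R (-1 * (x - a)); rewrite e mulN1r oppr_gt0 subr_lt0 ltxx => /(_ xa).
- apply: ae_imp q0 => x qx A B.
  have : flat 0 (-1 * (x - a)) * q x = 0 by have [/wl ->|/qx ->] := leP a x; rewrite ?mul0r ?mulr0.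
  have := flat_ge0 2 (-1 * (x - a)); move: (flat 0 _) (flat 2 _) => y z z0 yq.
  by rewrite sub0r !mulNr opprK yq !mul0r oppr0 add0r addr0 mul1r oppr_le0 mulr_ge0 ?sqr_ge0.
- apply: ae_imp h0 => x hx; rewrite mul0r add0r.
  by have [/wl ->|/hx ->] := leP a x; rewrite ?expr0n ?mul0r ?mulr0.
Qed.

(** ** Decay of the energy and of the solution on [a, b] *)

Variables (a b l r kappa : R).
Hypotheses (al_ : a <= l) (lr : l <= r) (rb : r <= b) (k0 : 0 <= kappa).
Hypothesis q0 : {ae mu, forall x, (x < l) || (r < x) -> q x = 0}.
Hypothesis qk : {ae mu, forall x, `|q x| <= 2 * kappa * slowness al rho x}.
Variables p0 v0 : R -> R.
Hypotheses (sp0 : sqint p0) (sv0 : sqint v0).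
Hypotheses (P0E : {ae mu, forall x, P 0 x = p0 x}) (v0E : {ae mu, forall x, v 0 x = v0 x}).
Hypothesis supp : {ae mu, forall x, (x < a) || (b < x) -> p0 x = 0 /\ v0 x = 0}.

Let ab : a <= b.
Proof. exact: le_trans al_ (le_trans lr rb). Qed.

Let outgoing_right t : 0 <= t -> {ae mu, forall x, b < x -> fwd al rho (P t) (v t) x = 0}.
Proof.
apply: no_incoming_right.
  by apply: ae_imp q0 => x h bx; apply: h; rewrite (le_lt_trans rb bx) orbT.
have h0 := ae_imp2 (fun x h1 h2 => conj h1 h2) P0E v0E.
apply: ae_imp2 h0 supp => x; rewrite /fwd /bwd => -[-> ->] h bx; have [|-> ->] := h; first by rewrite bx orbT.
by rewrite !mulr0 addr0.
Qed.

Let outgoing_left t : 0 <= t -> {ae mu, forall x, x < a -> bwd al rho (P t) (v t) x = 0}.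
Proof.
apply: no_incoming_left.
  by apply: ae_imp q0 => x h xa; apply: h; rewrite (lt_le_trans xa al_).
have h0 := ae_imp2 (fun x h1 h2 => conj h1 h2) P0E v0E.
apply: ae_imp2 h0 supp => x; rewrite /fwd /bwd => -[-> ->] h xa; have [|-> ->] := h; first by rewrite xa.
by rewrite !mulr0 subr0.
Qed.

Let integral_outgoing_right t : 0 <= t ->
  {ae mu, forall x, b < x -> fwd al rho (Pi t) (fun z => U t z - U 0 z) x = 0}.
Proof.
move=> t0; have mZ : mset [set` `]b, +oo[] by exact: measurable_itv.
have h s : 0 <= s -> {ae mu, forall x, [set` `]b, +oo[] x -> rho x * v s x + 1 * (al x * P s x) = 0}.
  move=> s0; apply: ae_imp (outgoing_right s0) => x + /=.
  by rewrite in_itv/= andbT mul1r.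
apply: ae_imp (integral_vanish co data mZ h t0) => x + bx.
by rewrite mul1r; apply; rewrite /= in_itv/= andbT.
Qed.

Let integral_outgoing_left t : 0 <= t ->
  {ae mu, forall x, x < a -> bwd al rho (Pi t) (fun z => U t z - U 0 z) x = 0}.
Proof.
move=> t0; have mZ : mset [set` `]-oo, a[] by exact: measurable_itv.
have h s : 0 <= s -> {ae mu, forall x, [set` `]-oo, a[] x -> rho x * v s x + (-1) * (al x * P s x) = 0}.
  move=> s0; apply: ae_imp (outgoing_left s0) => x + /=.
  by rewrite in_itv/= mulN1r.
apply: ae_imp (integral_vanish co data mZ h t0) => x + xa.
by rewrite mulN1r; apply; rewrite /= in_itv.
Qed.

Lemma energy_ae w1 w1' w2 w2' (W : R) p p' w w' : weight w1 w1' W -> weight w2 w2' W ->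
  sqint p -> sqint p' -> sqint w -> sqint w' ->
  {ae mu, forall x, p x = p' x} -> {ae mu, forall x, w x = w' x} ->
  energy al be rho w1 w2 p w = energy al be rho w1 w2 p' w'.
Proof.
move=> hw1 hw2 hp hp' hw hw' ep ew.
have [i1 ->] := energyE co hw1 hw2 hp hw; have [i2 ->] := energyE co hw1 hw2 hp' hw'.
apply: ae_eq_Rintegral => //; [exact: rint_measurable i1|exact: rint_measurable i2|].
by apply: ae_imp2 ep ew => x e1 e2 _; rewrite /fwd /bwd e1 e2.
Qed.

Definition decay_condition w1 w1' w2 w2' (la : R) : Prop :=
  {ae mu, forall x, forall A B : R, (b < x -> A = 0) -> (x < a -> B = 0) ->
      - w1' x * A ^+ 2 + w2' x * B ^+ 2 - (w1 x - w2 x) * q x * A * B <=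
      - (la * (rho x / al x) * (w1 x * A ^+ 2 + w2 x * B ^+ 2)) }.

(** On [a, b] the weights are bounded below by m, and
    fwd^2 + bwd^2 = 2 (rho^2 v^2 + al^2 p^2) is at least 2 d^2 (v^2 + p^2). *)
Lemma local_energy_decay w1 w1' w2 w2' (W m la : R) :
  weight w1 w1' W -> weight w2 w2' W -> (forall x, 0 < w1 x) -> (forall x, 0 < w2 x) ->
  0 < m -> (forall x, a <= x <= b -> m <= w1 x) -> (forall x, a <= x <= b -> m <= w2 x) ->
  decay_condition w1 w1' w2 w2' la ->
  forall t, 0 <= t ->
  \int[mu]_(x in `[a, b]) (P t x ^+ 2 + v t x ^+ 2) <=
    (2 * m * d ^+ 2 / M)^-1 * `|energy al be rho w1 w2 p0 v0| * expR (- (la * t)).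
Proof.
move=> hw1 hw2 w10 w20 m0 hm1 hm2 cond t t0; set c := 2 * m * d ^+ 2 / M.
have c0 : 0 < c by rewrite divr_gt0 ?mulr_gt0 ?exprn_gt0 ?(c_d co).
have E0E := energy_ae hw1 hw2 (data_P data (lexx 0)) sp0 (data_v data (lexx 0)) sv0 P0E v0E.
rewrite -E0E; set E0 := energy _ _ _ _ _ (P 0) _.
have hP := data_P data t0; have hv := data_v data t0.
have mI : mset [set` `[a, b]] by exact: measurable_itv.
have hPv : rint setT (fun x => P t x ^+ 2 + v t x ^+ 2) by apply: rintD; [|exact: hP.2|exact: hv.2].
have hPvI : rint `[a, b] (fun x => P t x ^+ 2 + v t x ^+ 2) by exact: rintS hPv.
have dec := energy_decay co hw1 hw2 data integral_outgoing_right integral_outgoing_left cond t0.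
have [iE eE] := energyE co hw1 hw2 hP hv.
rewrite -[leRHS]mulrA ler_pdivlMl//.
apply: (@le_trans _ _ (energy al be rho w1 w2 (P t) (v t))); last first.
  by apply: (le_trans dec); rewrite [leLHS]mulrC ler_wpM2r ?expR_ge0// ler_norm.
have dens_ge0 x : 0 <= (w1 x * fwd al rho (P t) (v t) x ^+ 2 + w2 x * bwd al rho (P t) (v t) x ^+ 2) / al x.
  by rewrite divr_ge0 ?(ltW (al0 x))// addr_ge0// mulr_ge0 ?sqr_ge0// ltW.
rewrite eE -RintegralZl//.
apply: (@le_trans _ _ (\int[mu]_(x in `[a, b]) ((w1 x * fwd al rho (P t) (v t) x ^+ 2 +
    w2 x * bwd al rho (P t) (v t) x ^+ 2) / al x))); last exact: ge0_Rintegral_subset.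
have iEI := rintS mI measurableT (@subsetT _ _) iE.
apply: le_Rintegral => //; first exact: rintZ.
move=> x; rewrite /= in_itv/= => xab.
have mw1 := hm1 x xab; have mw2 := hm2 x xab.
have /andP[r1 _] := rho_bounds co x; have /andP[a1 a2] := c_ald co x.
have dd := c_d co.
apply: (@le_trans _ _ (m * (fwd al rho (P t) (v t) x ^+ 2 + bwd al rho (P t) (v t) x ^+ 2) / al x)).
  have -> : fwd al rho (P t) (v t) x ^+ 2 + bwd al rho (P t) (v t) x ^+ 2 =
      2 * (rho x ^+ 2 * v t x ^+ 2 + al x ^+ 2 * P t x ^+ 2) by rewrite /fwd /bwd; ring.
  have -> : c * (P t x ^+ 2 + v t x ^+ 2) = 2 * m * (d ^+ 2 * (P t x ^+ 2 + v t x ^+ 2)) / M.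
    by rewrite /c; ring.
  rewrite [m * (2 * _)]mulrA [m * 2]mulrC; apply: ler_pM => //.
  - by apply: mulr_ge0; apply: mulr_ge0 => //; rewrite ?addr_ge0 ?sqr_ge0 ?ltW.
  - by rewrite invr_ge0 ltW.
  - rewrite ler_wpM2l ?mulr_ge0 ?(ltW m0)// addrC mulrDr; apply: lerD; rewrite ler_wpM2r ?sqr_ge0//.
      by rewrite lerXn2r ?nnegrE ?(ltW dd)// ltW// (c_rho0 co).
    by rewrite lerXn2r ?nnegrE ?(ltW dd)// ltW.
  - by rewrite lef_pV2 ?posrE.
rewrite ler_wpM2r ?invr_ge0 ?(ltW (al0 x))// mulrDr.
by apply: lerD; rewrite ler_wpM2r ?sqr_ge0.
Qed.

Variable rho0 : R.
Hypotheses (rhoa : rho a = rho0) (rhob : rho b = rho0).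
Hypotheses (U0a : U 0 a = 0) (U0b : U 0 b = 0).

Let uoo := (2 * rho0)^-1 * \int[mu]_(x in `[a, b]) (be x * v0 x).

Let rho00 : 0 < rho0. Proof. by rewrite -rhoa (c_rho0 co). Qed.

Let lv t : 0 <= t -> lint (v t).
Proof.
move=> t0; have [mv iv] := data_v data t0; split => // x y; have [xy|yx] := leP x y.
  have h : rint `[x, y] (fun z => 1 + v t z ^+ 2).
    by apply: rintD => //; [exact: rint_cst|exact: rintS iv].
  apply: (rint_dominated _ _ h) => //; first exact: (measurable_funS measurableT).
  move=> z _; rewrite -[v t z ^+ 2]real_normK ?num_real//; move: `|v t z| => w.
  by have := sqr_ge0 (w - 1); nra.
by rewrite set_itv_ge ?bnd_simp -?ltNge//; exact: integrable_set0.
Qed.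

Let lbv t : 0 <= t -> lint (fun x => be x * v t x).
Proof. by move=> t0; apply: lint_continuousM; [exact: (AC_continuous (c_be co))|exact: lv]. Qed.

(** The boundary conditions at a and b are integrated in time: the waves leaving
    [a, b] carry away the total momentum, which determines the limit. *)
Lemma boundary_mean t : 0 <= t ->
  (U t a + U t b) / 2 - uoo = - ((2 * rho0)^-1 * \int[mu]_(x in `[a, b]) (be x * v t x)).
Proof.
move=> t0.
have hS := data_S data t0; have cS := AC_continuous hS.
have cr := AC_continuous (c_rho co).
have cU s : 0 <= s -> continuous (U s) by move=> s0; exact: AC_continuous (data_U data s0).
have cdU x : {for x, continuous (fun z => rho z * (U t z - U 0 z))}.
  by apply: cvgM; [exact: cr|apply: cvgB; apply: cU].
have eb : rho b * (U t b - U 0 b) + S t b = 0.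
  have bb : b < b + 1 by rewrite ltrDl.
  apply: (@ae_continuous_eq0 _ (fun x => rho x * (U t x - U 0 x) + S t x) _ _ bb).
  - by move=> x; apply: cvgD; [exact: cdU|exact: cS].
  - apply: ae_imp2 (integral_outgoing_right t0) (data_SPi data t0) => x h -> /andP[bx _].
    exact: h.
  - by rewrite lexx ltW.
have ea : rho a * (U t a - U 0 a) - S t a = 0.
  have aa : a - 1 < a by rewrite gtrBl.
  apply: (@ae_continuous_eq0 _ (fun x => rho x * (U t x - U 0 x) - S t x) _ _ aa).
  - by move=> x; apply: cvgB; [exact: cdU|exact: cS].
  - apply: ae_imp2 (integral_outgoing_left t0) (data_SPi data t0) => x h -> /andP[_ xa].
    exact: h.
  - by rewrite lexx ltW.
have eS := hS.2 _ _ ab.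
have e2 : \int[mu]_(x in `[a, b]) (be x * (v t x - v 0 x)) =
    \int[mu]_(x in `[a, b]) (be x * v t x) - \int[mu]_(x in `[a, b]) (be x * v 0 x).
  rewrite -RintegralB//; [|exact: (lbv t0).2|exact: (lbv (lexx 0)).2].
  by apply: eq_Rintegral => x _; rewrite mulrBr.
have e0 : \int[mu]_(x in `[a, b]) (be x * v 0 x) = \int[mu]_(x in `[a, b]) (be x * v0 x).
  apply: ae_eq_Rintegral => //.
  - exact: (measurable_funS measurableT (@subsetT _ _) (lbv (lexx 0)).1).
  - apply: (measurable_funS measurableT) => //; apply: measurable_funM; [exact: AC_mfun (c_be co)|exact: sv0.1].
  - by apply: ae_imp v0E => x ->.
rewrite e2 e0 in eS; rewrite /uoo; move: eS ea eb; rewrite rhoa rhob U0a U0b !subr0.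
move: (\int[mu]_(x in `[a, b]) (be x * v t x)) (\int[mu]_(x in `[a, b]) (be x * v0 x)) => J J0 eS ea eb.
have r0 : 2 * rho0 != 0 by rewrite mulf_neq0 ?gt_eqF// pnatr_eq0.
apply: (mulfI r0); rewrite mulrBr mulrN !mulVKf//.
have -> : 2 * rho0 * ((U t a + U t b) / 2) = rho0 * U t a + rho0 * U t b by field.
by lra.
Qed.

(** The distance to the mean of the boundary values is at most half the variation
    over [a, b]. *)
Lemma sup_bound t x : 0 <= t -> a <= x <= b ->
  `|U t x - uoo| <= \int[mu]_(z in `[a, b]) `|P t z| +
    (2 * rho0)^-1 * (M * \int[mu]_(z in `[a, b]) `|v t z|).
Proof.
move=> t0 /andP[ax xb]; have hU := data_U data t0; have hb := boundary_mean t0.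
have -> : U t x - uoo = ((U t x - U t a) - (U t b - U t x)) / 2 + ((U t a + U t b) / 2 - uoo).
  by field.
apply: (le_trans (ler_normD _ _)); apply: lerD.
  have := AC_dist hU ax; have := AC_dist hU xb.
  rewrite (Iadd (lint_norm hU.1) ax xb); move: (\int[mu]_(_ in `[a, x]) _) => I1.
  move: (\int[mu]_(_ in `[x, b]) _) => I2 h2 h1.
  rewrite normrM [`|2^-1|]ger0_norm// ler_pdivrMr//.
  apply: (le_trans (ler_normB _ _)).
  by have := normr_ge0 (U t x - U t a); have := normr_ge0 (U t b - U t x); lra.
rewrite hb normrN normrM [`|_^-1|]ger0_norm ?invr_ge0 ?mulr_ge0 ?(ltW rho00)//.
rewrite ler_wpM2l ?invr_ge0 ?mulr_ge0 ?(ltW rho00)//.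
apply: (le_trans (Inorm _ _ (lbv t0))); rewrite -RintegralZl//; last exact: (lint_norm (lv t0)).2.
apply: Ile; [exact: lint_norm (lbv t0)|exact/lintZ/lint_norm/lv|].
move=> z _; rewrite normrM ler_wpM2r//; have /andP[b1 b2] := c_bed co z.
by rewrite ger0_norm// (le_trans _ b1)// ltW// (c_d co).
Qed.

Variables (A B : R).
Hypotheses (aA : a <= A) (Bb : B <= b).

Variables (K la : R).
Hypothesis K0 : 0 <= K.
Hypothesis hK : forall t, 0 <= t ->
  \int[mu]_(x in `[a, b]) (P t x ^+ 2 + v t x ^+ 2) <= K * expR (- (la * t)).

Let N := (b - a + K) + (2 * rho0)^-1 * (M * (b - a + K)).

Lemma local_decay t : 0 <= t ->
  (H1_norm [set` `]A, B[] (fun x => u t x - uoo)%R + L2_norm [set` `]A, B[] (v t)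
   <= (((b - a + 1) * N + (K + 1) + (K + 1)) * expR (- (la / 2 * t)))%:E)%E.
Proof.
move=> t0.
pose Omega := [set` `]A, B[]; rewrite -/Omega.
have mO : mset Omega by exact: measurable_itv.
have sub : Omega `<=` [set` `[a, b]].
  move=> x; rewrite /Omega /= !in_itv/= => /andP[Ax xB].
  by rewrite (le_trans aA (ltW Ax)) (le_trans (ltW xB) Bb).
have mI : mset [set` `[a, b]] by exact: measurable_itv.
have baK : 0 <= b - a + K by rewrite addr_ge0 ?subr_ge0.
have N0 : 0 <= N by rewrite addr_ge0// mulr_ge0 ?invr_ge0 ?mulr_ge0 ?(ltW rho00) ?(ltW M0).
have ba0 : 0 <= b - a by rewrite subr_ge0.
pose k := expR (- (la / 2 * t)).
have kp : 0 < k := expR_gt0 _.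
have k2 : expR (- (la * t)) = k ^+ 2.
  by rewrite /k -expRM_natr; congr expR; field.
have hPv := hK t0; rewrite k2 in hPv.
have iPv : rint `[a, b] (fun x => P t x ^+ 2 + v t x ^+ 2).
  by apply: (rintS mI measurableT (@subsetT _ _)); apply: rintD; [|exact: (data_P data t0).2|exact: (data_v data t0).2].
have iP : rint `[a, b] (fun x => P t x ^+ 2) by exact: rintS (data_P data t0).2.
have iv : rint `[a, b] (fun x => v t x ^+ 2) by exact: rintS (data_v data t0).2.
have IP : \int[mu]_(x in `[a, b]) P t x ^+ 2 <= K * k ^+ 2.
  by apply: le_trans hPv; apply: le_Rintegral => // x _; rewrite lerDl sqr_ge0.
have Iv : \int[mu]_(x in `[a, b]) v t x ^+ 2 <= K * k ^+ 2.
  by apply: le_trans hPv; apply: le_Rintegral => // x _; rewrite lerDr sqr_ge0.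
have hU := data_U data t0.
have aP := int_abs_le kp ab hU.1 iP IP.
have av := int_abs_le kp ab (lv t0) iv Iv.
have sup x : a <= x <= b -> `|U t x - uoo| <= N * k.
  move=> xab; apply: (le_trans (sup_bound t0 xab)).
  have -> : N * k = (b - a + K) * k + (2 * rho0)^-1 * (M * ((b - a + K) * k)) by rewrite /N; ring.
  apply: lerD => //.
  by rewrite ler_wpM2l ?invr_ge0 ?mulr_ge0 ?(ltW rho00)// ler_wpM2l// ltW.
have KK : K * k ^+ 2 <= ((K + 1) * k) ^+ 2.
  by rewrite exprMn ler_wpM2r ?sqr_ge0//; nra.
have Kk0 : 0 <= (K + 1) * k by rewrite mulr_ge0 ?addr_ge0 ?(ltW kp).
have Nk0 : 0 <= (b - a + 1) * N * k.
  by apply: mulr_ge0 (ltW kp); apply: mulr_ge0 N0; exact: addr_ge0.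
have muo : mfun Omega (fun x => u t x - uoo).
  by apply: (measurable_funS measurableT) => //; apply: measurable_funB => //; exact: (data_mu data).
have b1 : (L2_norm Omega (fun x => u t x - uoo)%R <= ((b - a + 1) * N * k)%:E)%E.
  have cU : continuous (fun x => (U t x - uoo) ^+ 2).
    by have hD := AC_sub hU (AC_cst uoo); exact: (AC_continuous (AC_mul hD hD)).
  have i2 : rint `[a, b] (fun x => (U t x - uoo) ^+ 2) := (continuous_lint cU).2 a b.
  apply: (L2_norm_local_le mO sub muo _ i2).
  - by apply: ae_imp (data_u data t0) => x ->.
  - exact: Nk0.
  - apply: (@le_trans _ _ (\int[mu]_(x in `[a, b]) (N * k) ^+ 2)).
      apply: Ile; [exact: continuous_lint|exact: lint_cst|].
      move=> x /sup h; rewrite -[leLHS]real_normK ?num_real//.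
      by rewrite lerXn2r ?nnegrE// (le_trans _ h).
    have -> : \int[mu]_(_ in `[a, b]) (N * k) ^+ 2 = (N * k) ^+ 2 * (b - a) by rewrite Icst.
    have -> : ((b - a + 1) * N * k) ^+ 2 = (N * k) ^+ 2 * (b - a + 1) ^+ 2 by ring.
    by rewrite ler_wpM2l ?sqr_ge0//; move: ba0; move: (b - a) => z z0; nra.
have b2 : (L2_norm Omega (weak_deriv Omega (fun x => u t x - uoo)%R) <= ((K + 1) * k)%:E)%E.
  have w1 : is_weak_deriv setT (fun x => u t x - uoo) (P t).
    have mu1 : mfun setT (fun x => u t x - uoo) by apply: measurable_funB => //; exact: (data_mu data).
    apply: (@weak_deriv_of_AC _ _ (fun x => U t x - uoo)) => //.
      have := AC_sub hU (AC_cst uoo); congr AC; apply/funext => x; exact: subr0.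
    by apply: ae_imp (data_u data t0) => x ->.
  have oO : open Omega by exact: interval_open.
  have w2 := weak_deriv_restrict oO w1; have w3 := weak_derivP w2.
  have e := weak_deriv_unique_itv w3 w2.
  apply: (L2_norm_local_le mO sub _ _ iP) => //; last exact: le_trans KK.
    by case: w3 => _ [].
have b3 : (L2_norm Omega (v t) <= ((K + 1) * k)%:E)%E.
  apply: (L2_norm_local_le mO sub _ _ iv) => //; last exact: le_trans KK.
    by apply: (measurable_funS measurableT) => //; exact: (data_v data t0).1.
  exact: ae_all.
have := leeD (H1_norm_le _ Kk0 b1 b2) b3.
move=> h; apply: (le_trans (h _)).
  exact: Nk0.
by rewrite -EFinD lee_fin -/k !mulrDl.
Qed.

End LocalDecay.

(** * The rate and the constant *)
Section UniformDecay.
Context {R : realType}.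
Local Notation mu := (@lebesgue_measure R).
Local Notation TR := (measurableTypeR R).
Local Notation mset D := (@measurable _ TR D).
Local Notation mfun D f := (@measurable_fun _ _ TR R D f).
Local Notation F := (R -> R^o).
Implicit Types (f g w : R -> R) (a b c x K : R) (Omega : set R).

(** The constant is the same for all solutions with the initial data (p0, v0),
    since the weights are chosen before the solution. *)
Lemma uniform_local_decay (al be al' be' rho q : R -> R) (d M a b l r kappa rho0 A B : R)
    (p0 v0 : R -> R) :
  coefficients al be al' be' rho q d M ->
  a <= l -> l <= r -> r <= b -> 0 <= kappa ->
  {ae mu, forall x, (x < l) || (r < x) -> q x = 0} ->
  {ae mu, forall x, `|q x| <= 2 * kappa * slowness al rho x} ->
  sqint p0 -> sqint v0 ->
  {ae mu, forall x, (x < a) || (b < x) -> p0 x = 0 /\ v0 x = 0} ->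
  rho a = rho0 -> rho b = rho0 -> a <= A -> B <= b ->
  exists2 C : R, 0 < C & forall (u0 u1 : R -> R) (u v P U Pi S : R -> R -> R),
    wave_data al be u0 u1 u v P U Pi S ->
    {ae mu, forall x, P 0 x = p0 x} -> {ae mu, forall x, v 0 x = v0 x} ->
    U 0 a = 0 -> U 0 b = 0 -> forall t, 0 <= t ->
    (H1_norm [set` `]A, B[]
       (fun x => u t x - (2 * rho0)^-1 * \int[mu]_(x in `[a, b]) (be x * v0 x))%R
     + L2_norm [set` `]A, B[] (v t)
     <= (C * expR (- (kappa * expR (- (2 * kappa * \int[mu]_(x in `[l, r]) slowness al rho x))
           / 2 * t)))%:E)%E.
Proof.
move=> co al_ lr rb k0 q0 qk sp0 sv0 supp ra rb0 aA Bb.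
have ab : a <= b := le_trans al_ (le_trans lr rb).
have [w1 [w1' [w2 [w2' [W [hw1 hw2 w10 w20 cond]]]]]] := ex_decay_weights co al_ lr rb k0 q0 qk.
have [m1 m10 hm1] := positive_lower_bound ab (AC_continuous (w_AC hw1)) w10.
have [m2 m20 hm2] := positive_lower_bound ab (AC_continuous (w_AC hw2)) w20.
pose m := Num.min m1 m2; have m0 : 0 < m by rewrite lt_min m10.
have mw1 x : a <= x <= b -> m <= w1 x by move=> /hm1; apply: le_trans; rewrite ge_min lexx.
have mw2 x : a <= x <= b -> m <= w2 x by move=> /hm2; apply: le_trans; rewrite ge_min lexx orbT.
pose K := (2 * m * d ^+ 2 / M)^-1 * `|energy al be rho w1 w2 p0 v0|.
have M0 : 0 < M.
  by case/andP: (c_ald co 0) => h1 h2; exact: lt_le_trans (c_d co) (le_trans h1 h2).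
have K0 : 0 <= K.
  rewrite mulr_ge0// invr_ge0 divr_ge0 ?(ltW M0)// mulr_ge0 ?sqr_ge0//.
  by rewrite mulr_ge0// ltW.
have baK : 0 <= b - a + K by rewrite addr_ge0 ?subr_ge0.
have r0 : 0 < rho0 by rewrite -ra (c_rho0 co).
pose N := (b - a + K) + (2 * rho0)^-1 * (M * (b - a + K)).
have N0 : 0 <= N.
  apply: addr_ge0 => //; apply: mulr_ge0; first by rewrite invr_ge0 mulr_ge0// ltW.
  exact: mulr_ge0 (ltW M0) baK.
exists ((b - a + 1) * N + (K + 1) + (K + 1)).
  have : 0 <= (b - a + 1) * N by apply: mulr_ge0 N0; rewrite addr_ge0 ?subr_ge0.
  by move: ((b - a + 1) * N) => y y0; lra.
move=> u0 u1 u v P U Pi S data P0 v0E Ua Ub t t0.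
have dec := local_energy_decay co data al_ rb q0 sp0 sv0 P0 v0E supp hw1 hw2 w10 w20 m0 mw1 mw2 cond.
exact: (local_decay co data al_ lr rb q0 sv0 P0 v0E supp ra rb0 Ua Ub aA Bb K0 dec t0).
Qed.

(** The product of f - k and a ramp that is supported where f = k vanishes, and so
    does its derivative. *)
Lemma AC_const_deriv f g (sg c k : R) : `|sg| <= 1 -> AC f g ->
  (forall x, 0 < sg * (x - c) -> f x = k) -> {ae mu, forall x, 0 < sg * (x - c) -> g x = 0}.
Proof.
move=> sg1 hf fk; have hp := AC_mul (AC_sub hf (AC_cst k)) (w_AC (ramp_weight c sg1)).
have p0 x : (f x - k) * flat 0 (sg * (x - c)) = 0.
  by have [h|/fk ->] := leP (sg * (x - c)) 0; [rewrite flat0_eq0// mulr0|rewrite subrr mul0r].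
have /(ae_eq0_of_int0 hp.1) : forall x y, x <= y -> \int[mu]_(z in `[x, y])
    ((g z - 0) * flat 0 (sg * (z - c)) + (f z - k) * (sg * flat 2 (sg * (z - c)))) = 0.
  by move=> x y xy; rewrite -hp.2// !p0 subrr.
apply: ae_imp => x + hx; rewrite fk// subrr mul0r addr0 subr0 => /eqP.
by rewrite mulf_eq0 (gt_eqF (flat0_gt0 hx)) orbF => /eqP.
Qed.

Lemma AC_const_off_deriv f g l r k : AC f g -> (forall x, (x < l) || (r < x) -> f x = k) ->
  {ae mu, forall x, (x < l) || (r < x) -> g x = 0}.
Proof.
move=> hf fk; have n1 : `|-1 : R| <= 1 by rewrite normrN1.
have p1 : `|1 : R| <= 1 by rewrite normr1.
have hl x : 0 < -1 * (x - l) -> f x = k by rewrite mulN1r oppr_gt0 subr_lt0 => xl; rewrite fk ?xl.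
have hr x : 0 < 1 * (x - r) -> f x = k by rewrite mul1r subr_gt0 => rx; rewrite fk ?rx ?orbT.
apply: ae_imp2 (AC_const_deriv n1 hf hl) (AC_const_deriv p1 hf hr) => x.
by rewrite mulN1r oppr_gt0 subr_lt0 mul1r subr_gt0 => h1 h2 /orP[/h1|/h2].
Qed.

(** The complement of the support is a countable union of rational intervals on
    which f vanishes almost everywhere. *)
Lemma ae_eq0_off_support f Omega : ess_support f `<=` Omega ->
  {ae mu, forall x, ~ Omega x -> f x = 0}.
Proof.
move=> sub; pose Q (n : nat) x := match unpickle n with
  | Some pq => {ae mu, forall y, ratr (pq : rat * rat).1 < y < ratr pq.2 -> f y = 0} ->
      ratr pq.1 < x < ratr pq.2 -> f x = 0
  | None => True end.
have hQ n : {ae mu, forall x, Q n x}.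
  rewrite /Q; case: (unpickle n) => [pq|]; last exact: ae_all.
  have [h|nh] := pselect {ae mu, forall y, ratr pq.1 < y < ratr pq.2 -> f y = 0}.
    by apply: ae_imp h => x h _.
  by apply: ae_all => x /nh.
have hall := @ae_foralln _ TR R mu Q hQ.
apply: ae_imp hall => x hx nOx.
have : ~ ess_support f x by move=> /sub.
move=> /existsNP[V /not_implyP[nV /contrapT fV]].
have [e /= e0 he] := nV.
have [p] := rat_in_itvoo (ltac:(by rewrite gtrBl) : x - e < x).
rewrite in_itv/= => /andP[p1 p2].
have [p'] := rat_in_itvoo (ltac:(by rewrite ltrDl) : x < x + e).
rewrite in_itv/= => /andP[p3 p4].
have := hx (pickle (p, p')); rewrite /Q pickleK /=; apply; last by rewrite p2.
apply: ae_imp fV => y h /andP[y1 y2]; apply: h; apply: he.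
by rewrite /= ltr_distlC; apply/andP; split; [exact: lt_trans y1|exact: lt_trans p4].
Qed.

Lemma continuous_cst_off f g A B k : continuous g -> {ae mu, forall x, f x = g x} ->
  {ae mu, forall x, ~ [set` `]A, B[] x -> f x = k} ->
  forall x, ~ (A < x < B) -> g x = k.
Proof.
move=> cg fg fk x nx; have ck : continuous (fun x => g x - k).
  by move=> z; apply: cvgB; [exact: cg|exact: cvg_cst].
have hk : {ae mu, forall x, ~ (A < x < B) -> g x - k = 0}.
  by apply: ae_imp2 fg fk => z <- h nz; rewrite h ?subrr.
have near c e : c < e -> c <= x <= e -> (forall z, c < z < e -> ~ (A < z < B)) -> g x = k.
  move=> ce cxe off; apply/eqP; rewrite -subr_eq0; apply/eqP.
  by apply: (ae_continuous_eq0 ce ck _ cxe); apply: ae_imp hk => z h /off.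
have [xA|Ax] := leP x A.
  apply: (near (x - 1) x); rewrite ?gtrBl ?lexx ?gerBl ?ler01// => z /andP[_ zx] /andP[Az _].
  by have := lt_trans Az (lt_le_trans zx xA); rewrite ltxx.
have Bx : B <= x by rewrite leNgt; apply/negP => xB; apply: nx; rewrite Ax.
apply: (near x (x + 1)); rewrite ?ltrDl ?lexx ?lerDl ?ler01// => z /andP[xz _] /andP[_ zB].
by have := lt_trans zB (le_lt_trans Bx xz); rewrite ltxx.
Qed.

(** The smallest interval off which the coefficients are constant lies in the closure of
    each admissible inhomogeneous region; the energy decay is measured on it, since the
    constant must not depend on the region. If the coefficients are constant everywhere,
    it is reduced to a point. *)
Lemma ex_core_interval (f g : R -> R) (f0 g0 A B : R) : A < B ->
  (forall x, ~ (A < x < B) -> f x = f0) -> (forall x, ~ (A < x < B) -> g x = g0) ->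
  exists l r, [/\ A <= l, l <= r, r <= B,
    (forall x, (x < l) || (r < x) -> f x = f0 /\ g x = g0) &
    forall A' B', A' < B' -> (forall x, ~ (A' < x < B') -> f x = f0) ->
      (forall x, ~ (A' < x < B') -> g x = g0) -> l = r \/ (A' <= l /\ r <= B')].
Proof.
move=> AB hf hg; pose N := [set x | ~ (f x = f0 /\ g x = g0)].
have Nsub A' B' : (forall x, ~ (A' < x < B') -> f x = f0) ->
    (forall x, ~ (A' < x < B') -> g x = g0) -> forall x, N x -> A' < x < B'.
  move=> hf' hg' x Nx; apply/negP => /negP nx; apply: Nx.
  by split; [apply: hf'|apply: hg'] => h; move: nx; rewrite h.
have [[n0 Nn0]|N0] := pselect (exists x, N x); last first.
  have all x : f x = f0 /\ g x = g0 by apply: contrapT => h; apply: N0; exists x.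
  exists A, A; split => //; first exact: ltW.
  by move=> A' B' _ _ _; left.
have NAB := Nsub A B hf hg.
have hi : has_inf N.
  by split; [exists n0|exists A => x /NAB /andP[/ltW]].
have hs : has_sup N.
  by split; [exists n0|exists B => x /NAB /andP[_ /ltW]].
have lN x : N x -> inf N <= x := inf_lbound hi.2 (x:=x).
have Nr x : N x -> x <= sup N by move=> Nx; exact: (ub_le_sup hs.2).
have off x : (x < inf N) || (sup N < x) -> f x = f0 /\ g x = g0.
  move=> h; apply: contrapT => Nx; case/orP: h.
    by rewrite ltNge lN.
  by rewrite ltNge Nr.
exists (inf N), (sup N); split.
- by apply: lb_le_inf; [exists n0|move=> x /NAB /andP[/ltW]].
- exact: le_trans (lN _ Nn0) (Nr _ Nn0).
- by apply: ge_sup; [exists n0|move=> x /NAB /andP[_ /ltW]].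
- exact: off.
- move=> A' B' _ hf' hg'; right; have NA' := Nsub A' B' hf' hg'; split.
    by apply: lb_le_inf; [exists n0|move=> x /NA' /andP[/ltW]].
  by apply: ge_sup; [exists n0|move=> x /NA' /andP[_ /ltW]].
Qed.

(** ** The rate *)

Section Rate.
Variables (alpha beta al be al' be' rho q : R -> R) (Ma Mb d M : R).
Hypotheses (ra : W1inf_rep alpha al al' Ma) (rb : W1inf_rep beta be be' Mb).
Hypothesis co : coefficients al be al' be' rho q d M.
Hypotheses (ma : mfun setT alpha) (mb : mfun setT beta).
Hypotheses (alpha0 : forall x, 0 < alpha x) (beta0 : forall x, 0 < beta x).

Let al0 x : 0 < al x.
Proof. by case/andP: (c_ald co x) => h _; exact: lt_le_trans (c_d co) h. Qed.

Let be0 x : 0 < be x.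
Proof. by case/andP: (c_bed co x) => h _; exact: lt_le_trans (c_d co) h. Qed.

Lemma sqrt_slowness x : Num.sqrt (be x / al x) = slowness al rho x.
Proof.
have r0 := c_rho0 co x.
have -> : be x / al x = slowness al rho x ^+ 2.
  by rewrite /slowness expr_div_n (c_rho2 co); field; rewrite gt_eqF.
by rewrite sqrtr_sqr gtr0_norm// divr_gt0.
Qed.

(** Twice the reflection coefficient per unit of travel time: this is the function whose
    supremum norm defines gamma0. *)
Definition contrast x : R := 2 * q x / slowness al rho x.

Lemma contrast_ae : {ae mu, forall x,
  weak_deriv setT alpha x / Num.sqrt (alpha x * beta x) +
    Num.sqrt (alpha x / beta x ^+ 3) * weak_deriv setT beta x = contrast x}.
Proof.
have h1 := ae_imp2 (fun x h1 h2 => conj h1 h2) (rep_ae ra) (rep_weak ra).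
have h2 := ae_imp2 (fun x h1 h2 => conj h1 h2) (rep_ae rb) (rep_weak rb).
apply: ae_imp2 h1 h2 => x [-> ->] [-> ->]; have r0 := c_rho0 co x.
rewrite -(c_rho2 co) sqrtr_sqr gtr0_norm//.
have -> : al x / be x ^+ 3 = (rho x / be x ^+ 2) ^+ 2.
  by rewrite expr_div_n (c_rho2 co); field; rewrite gt_eqF.
rewrite sqrtr_sqr gtr0_norm ?divr_gt0 ?exprn_gt0// /contrast /slowness (c_qE co).
have -> : rho x / be x ^+ 2 = al x / (be x * rho x).
  have -> : al x = rho x ^+ 2 / be x by rewrite (c_rho2 co) mulfK// gt_eqF.
  by field; rewrite !gt_eqF.
by field; rewrite !gt_eqF.
Qed.

(** The value of gamma0 / t0, which does not depend on the inhomogeneous region. *)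
Definition kappa : R := fine (ess_sup mu (abse \o (EFin \o contrast))) / 4.

Lemma contrast_bounded : exists K, forall x, `|contrast x| <= K.
Proof.
exists (2 * (M / d) * (M / d)) => x; rewrite /contrast; apply: normM_le.
  by apply: normM_le; [rewrite ger0_norm|exact: (c_q co)].
have /andP[r1 r2] := rho_bounds co x; have /andP[a1 a2] := c_ald co x.
rewrite /slowness invf_div gtr0_norm ?divr_gt0 ?(c_rho0 co)//.
by rewrite ler_pM ?(ltW (al0 x)) ?invr_ge0 ?(ltW (c_rho0 co x))// lef_pV2 ?posrE ?(c_rho0 co) ?(c_d co).
Qed.

Let ess_sup_contrast_ge0 : (0 <= ess_sup mu (abse \o (EFin \o contrast)))%E.
Proof.
apply: ess_sup_gee; first exact: mu_setT_gt0.
by apply: ae_all => x; exact: abse_ge0.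
Qed.

Let kappaE : ess_sup mu (abse \o (EFin \o contrast)) = (4 * kappa)%:E.
Proof.
have [K hK] := contrast_bounded.
have le : (ess_sup mu (abse \o (EFin \o contrast)) <= K%:E)%E.
  by apply/ess_supP; apply: ae_all => x; rewrite /= lee_fin.
have ge := ess_sup_contrast_ge0.
rewrite /kappa mulrC divfK ?pnatr_eq0// fineK// ge0_fin_numE//.
exact: le_lt_trans le (ltry _).
Qed.

Lemma kappa_ge0 : 0 <= kappa.
Proof.
have := ess_sup_contrast_ge0.
by rewrite kappaE lee_fin pmulr_rge0.
Qed.

Lemma q_le_kappa : {ae mu, forall x, `|q x| <= 2 * kappa * slowness al rho x}.
Proof.
apply: ae_imp (@ess_sup_ge _ TR R mu (abse \o (EFin \o contrast))) => x.
rewrite kappaE /= lee_fin /contrast => h.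
have s0 : 0 < slowness al rho x by rewrite divr_gt0 ?(c_rho0 co).
move: h; rewrite !normrM normfV (gtr0_norm s0) [`|2|]ger0_norm// ler_pdivrMr//; lra.
Qed.

Lemma Linfty_norm_contrast A B :
  {ae mu, forall x, ~ (A < x < B) -> q x = 0} ->
  Lp_norm [set` `]A, B[] +oo%E (fun x => weak_deriv setT alpha x / Num.sqrt (alpha x * beta x) +
    Num.sqrt (alpha x / beta x ^+ 3) * weak_deriv setT beta x) = (4 * kappa)%:E.
Proof.
move=> q0; rewrite -kappaE /Lp_norm unlock /= mu_setT_gt0; apply: eq_ess_sup.
apply: ae_imp2 q0 contrast_ae => x hq e /=; rewrite patchE.
case: ifPn => [_|]; first by rewrite e.
rewrite notin_setE /= in_itv/= => /hq qx.
by rewrite /contrast qx mulr0 mul0r.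
Qed.

Lemma travel_time_le A B l r : l <= r -> A <= l -> r <= B ->
  \int[mu]_(x in `[l, r]) slowness al rho x <= t0 alpha beta [set` `]A, B[].
Proof.
move=> lr Al rB; have cs := slowness_continuous co.
have ls := continuous_lint cs.
have mI : mset [set` `]A, B[] by exact: measurable_itv.
have sub : [set` `]A, B[] `<=` [set` `[A, B]].
  by move=> x /=; rewrite !in_itv/= => /andP[/ltW -> /ltW ->].
have mO : mset [set` `]A, B[] by exact: measurable_itv.
have io : rint [set` `]A, B[] (slowness al rho) by exact: rintS (ls.2 A B).
have s0 x : 0 <= slowness al rho x by rewrite divr_ge0 ?ltW ?(c_rho0 co).
have ioc : rint [set` `]A, B]] (slowness al rho).
  apply: rintS (ls.2 A B) => //.
  by move=> x /=; rewrite !in_itv/= => /andP[/ltW -> ->].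
have e : {ae mu, forall x, [set` `]A, B[] x -> slowness al rho x = Num.sqrt (beta x / alpha x)}.
  by apply: ae_imp2 (rep_ae ra) (rep_ae rb) => x -> -> _; rewrite sqrt_slowness.
apply: (@le_trans _ _ (\int[mu]_(x in `[A, B]) slowness al rho x)).
  apply: ge0_Rintegral_subset => //; last exact: ls.2.
  move=> x /=; rewrite !in_itv/= => /andP[lx xr].
  by rewrite (le_trans Al lx) (le_trans xr rB).
rewrite -(Rintegral_itv_obnd_cbnd ioc) -(Rintegral_itv_bndo_bndc io).
rewrite le_eqVlt; apply/orP; left; apply/eqP; rewrite /t0.
apply: ae_eq_Rintegral e => //; first exact: rint_measurable io.
apply: (measurable_funS measurableT) => //.
have -> : (fun x => Num.sqrt (beta x / alpha x)) =
    (fun x => beta x `^ 2^-1 * alpha x `^ (- 2^-1)).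
  apply/funext => x; rewrite powRN !powR12_sqrt ?ltW//.
  by rewrite sqrtrM ?ltW// sqrtrV// ltW.
apply: measurable_funM.
  exact: (@measurableT_comp _ _ _ TR R R _ _ _ (measurable_powR _) mb).
exact: (@measurableT_comp _ _ _ TR R R _ _ _ (measurable_powR _) ma).
Qed.

(** The square root in the definition of the rate is at most 1, and e^(-2 kappa T)
    decreases in the travel time T. *)
Lemma Lambda_le A B T : {ae mu, forall x, ~ (A < x < B) -> q x = 0} ->
  T <= t0 alpha beta [set` `]A, B[] ->
  Lambda alpha beta [set` `]A, B[] <= kappa * expR (- (2 * kappa * T)) / 2.
Proof.
move=> q0 Tt; rewrite /Lambda /gamma0 Linfty_norm_contrast//= .
set t1 := t0 _ _ _ in Tt *; have t10 : 0 <= t1 by apply: Rintegral_ge0 => x _; exact: sqrtr_ge0.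
have k0 := kappa_ge0.
have -> : t1 / 4 * (4 * kappa) = t1 * kappa by field.
have tk0 : 0 <= t1 * kappa by exact: mulr_ge0.
have sq1 : Num.sqrt (1 - 4 * (t1 * kappa) * expR (- (4 * (t1 * kappa)))) <= 1.
  rewrite -[leRHS]sqrtr1; apply: ler_wsqrtr; rewrite gerBl.
  by rewrite mulr_ge0 ?expR_ge0// mulr_ge0.
have h1 : t1 * kappa / (2 * t1) <= kappa / 2.
  have [->|t1n] := eqVneq t1 0; first by rewrite !mul0r divr_ge0.
  by rewrite le_eqVlt; apply/orP; left; apply/eqP; field.
have h10 : 0 <= t1 * kappa / (2 * t1) by rewrite divr_ge0// mulr_ge0.
have h2 : expR (- (2 * (t1 * kappa))) <= expR (- (2 * kappa * T)).
  by rewrite ler_expR lerN2 -mulrA [t1 * _]mulrC ler_wpM2l// ler_wpM2l.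
have h3 : t1 * kappa / (2 * t1) * expR (- (2 * (t1 * kappa))) <= kappa * expR (- (2 * kappa * T)) / 2.
  by rewrite [leRHS]mulrAC; apply: ler_pM => //; exact: expR_ge0.
apply: le_trans h3; rewrite ler_piMr//; apply: mulr_ge0 => //; exact: expR_ge0.
Qed.

End Rate.

(** ** The constant *)

Record configuration (alpha beta u0 u1 : R -> R) (A B A0 B0 am bm alpha0 beta0 : R) : Prop := {
  cf_AB : A < B;
  cf_AB0 : A0 < B0;
  cf_am : 0 < am;
  cf_bm : 0 < bm;
  cf_al0 : 0 < alpha0;
  cf_be0 : 0 < beta0;
  cf_alpha_ge : forall x, am <= alpha x;
  cf_beta_ge : forall x, bm <= beta x;
  cf_alpha_off : forall x, ~ [set` `]A, B[] x -> alpha x = alpha0;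
  cf_beta_off : forall x, ~ [set` `]A, B[] x -> beta x = beta0;
  cf_u0 : ess_support u0 `<=` [set` `]A0, B0[];
  cf_u1 : ess_support u1 `<=` [set` `]A0, B0[] }.

Lemma uniform_decay (alpha beta u0 u1 : R -> R) (Ao Bo A B A0 B0 am bm alpha0 beta0 : R) :
  in_W1p setT +oo%E alpha -> in_W1p setT +oo%E beta -> in_H1 setT u0 -> in_L2 setT u1 ->
  configuration alpha beta u0 u1 A B A0 B0 am bm alpha0 beta0 ->
  exists2 C : R, 0 < C &
    forall (A' B' A0' B0' am' bm' alpha0' beta0' : R) (u ut : R -> R -> R^o),
    configuration alpha beta u0 u1 A' B' A0' B0' am' bm' alpha0' beta0' ->
    wave_solution alpha beta u0 u1 u ut ->
    forall t : R, 0 <= t ->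
      (H1_norm [set` `]Ao, Bo[]
         (fun x => u t x - u_infty beta alpha0' beta0' [set` `]A0', B0'[] u1)%R
       + L2_norm [set` `]Ao, Bo[] (ut t)
       <= (C * expR (- (Lambda alpha beta [set` `]A', B'[] * t)))%:E)%E.
Proof.
move=> halpha hbeta hu0 hu1 cf.
have [ma mb] : mfun setT alpha /\ mfun setT beta.
  have [_ [ga wa _]] := halpha; have [_ [gb wb _]] := hbeta.
  by split; [exact: (weak_deriv_mfun wa).1|exact: (weak_deriv_mfun wb).1].
have [al [al' [Ma ra]]] := W1inf_repP halpha; have [be [be' [Mb rb]]] := W1inf_repP hbeta.
have cal := AC_continuous (rep_AC ra); have cbe := AC_continuous (rep_AC rb).
have al_am : forall x, am <= al x.
  by apply: (ae_continuous_ge cal); apply: ae_imp (rep_ae ra) => x <-; exact: cf_alpha_ge cf x.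
have be_bm : forall x, bm <= be x.
  by apply: (ae_continuous_ge cbe); apply: ae_imp (rep_ae rb) => x <-; exact: cf_beta_ge cf x.
pose d := Num.min am bm; pose M := Num.max Ma Mb.
have d0 : 0 < d by rewrite lt_min (cf_am cf) (cf_bm cf).
have MaM : Ma <= M by rewrite le_max lexx.
have MbM : Mb <= M by rewrite le_max lexx orbT.
have ald x : d <= al x <= M.
  apply/andP; split; first by rewrite ge_min al_am.
  exact: le_trans (ler_norm _) (le_trans (rep_bound ra x) MaM).
have bed x : d <= be x <= M.
  apply/andP; split; first by rewrite ge_min be_bm orbT.
  exact: le_trans (ler_norm _) (le_trans (rep_bound rb x) MbM).
have [rho [q co]] := ex_coefficients d0 (rep_AC ra) (rep_AC rb) ald bed
  (fun x => le_trans (rep_bound' ra x) MaM) (fun x => le_trans (rep_bound' rb x) MbM).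
have alpha_gt0 x : 0 < alpha x := lt_le_trans (cf_am cf) (cf_alpha_ge cf x).
have beta_gt0 x : 0 < beta x := lt_le_trans (cf_bm cf) (cf_beta_ge cf x).
have same A' B' A0' B0' am' bm' alpha0' beta0' :
    configuration alpha beta u0 u1 A' B' A0' B0' am' bm' alpha0' beta0' ->
    alpha0' = alpha0 /\ beta0' = beta0.
  (* At z, outside both regions, alpha and beta take both pairs of constant values. *)
  move=> cf'; pose z := Num.max B B'.
  have zB : ~ [set` `]A, B[] z by rewrite /= in_itv/= => /andP[_]; rewrite ltNge le_max lexx.
  have zB' : ~ [set` `]A', B'[] z by rewrite /= in_itv/= => /andP[_]; rewrite ltNge le_max lexx orbT.
  by rewrite -(cf_alpha_off cf zB) -(cf_beta_off cf zB) (cf_alpha_off cf' zB') (cf_beta_off cf' zB').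
have al_off A' B' A0' B0' am' bm' alpha0' beta0' :
    configuration alpha beta u0 u1 A' B' A0' B0' am' bm' alpha0' beta0' ->
    (forall x, ~ (A' < x < B') -> al x = alpha0) /\ (forall x, ~ (A' < x < B') -> be x = beta0).
  move=> cf'; have [e1 e2] := same _ _ _ _ _ _ _ _ cf'; split.
    by apply: (continuous_cst_off cal (rep_ae ra)); apply: ae_all => x; rewrite -e1; exact: cf_alpha_off cf' x.
  by apply: (continuous_cst_off cbe (rep_ae rb)); apply: ae_all => x; rewrite -e2; exact: cf_beta_off cf' x.
have [alo beo] := al_off _ _ _ _ _ _ _ _ cf.
have [l [r [Al lr rB off core]]] := ex_core_interval (cf_AB cf) alo beo.
pose a := Num.min (Num.min A A0) Ao; pose b := Num.max (Num.max B B0) Bo.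
have aA : a <= A by rewrite !ge_min lexx.
have aA0 : a <= A0 by rewrite !ge_min lexx orbT.
have aAo : a <= Ao by rewrite !ge_min lexx orbT.
have Bb : B <= b by rewrite !le_max lexx.
have B0b : B0 <= b by rewrite !le_max lexx orbT.
have Bob : Bo <= b by rewrite !le_max lexx orbT.
have al_ := le_trans aA Al; have rb_ := le_trans rB Bb.
have q_off l' r' : (forall x, (x < l') || (r' < x) -> al x = alpha0 /\ be x = beta0) ->
    {ae mu, forall x, (x < l') || (r' < x) -> q x = 0}.
  move=> off'; have e1 := AC_const_off_deriv (c_al co) (fun x h => (off' x h).1).
  have e2 := AC_const_off_deriv (c_be co) (fun x h => (off' x h).2).
  apply: ae_imp2 e1 e2 => x h1 h2 hx.
  by rewrite (c_qE co) h1// h2// !mul0r addr0 mul0r.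
have q0 := q_off _ _ off.
pose kap := kappa al rho q.
have kap0 : 0 <= kap := kappa_ge0 co.
have qk := q_le_kappa co.
have [su0 w0 sp0] := in_H1_weak_deriv hu0; set p0 := weak_deriv setT u0 in w0 sp0.
have su1 : sqint u1 by apply/in_L2P.
have [U0 hU0 u0U0] := weak_deriv_AC w0.
have U0off := continuous_cst_off (AC_continuous hU0) u0U0 (ae_eq0_off_support (cf_u0 cf)).
have u1off := ae_eq0_off_support (cf_u1 cf).
have supp : {ae mu, forall x, (x < a) || (b < x) -> p0 x = 0 /\ u1 x = 0}.
  have hU : forall x, (x < A0) || (B0 < x) -> U0 x = 0.
    by move=> x xA; apply: U0off => /andP[Ax xB]; move: xA; rewrite !ltNge !ltW.
  apply: ae_imp2 (AC_const_off_deriv hU0 hU) u1off => x h1 h2 hx.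
  have hx0 : (x < A0) || (B0 < x).
    by case/orP: hx => hx; [rewrite (lt_le_trans hx aA0)|rewrite (le_lt_trans B0b hx) orbT].
  split; first exact: h1.
  by apply: h2; rewrite /= in_itv/= => /andP[Ax xB]; move: hx0; rewrite !ltNge !ltW.
pose rho0 := Num.sqrt (alpha0 * beta0).
have rho_off x : ~ (A < x < B) -> rho x = rho0.
  by move=> nx; rewrite /rho0 -(alo _ nx) -(beo _ nx) -(c_rho2 co) sqrtr_sqr gtr0_norm ?(c_rho0 co).
have rhoa : rho a = rho0 by apply: rho_off => /andP[]; rewrite ltNge aA.
have rhob : rho b = rho0 by apply: rho_off => /andP[_]; rewrite ltNge Bb.
have [C C0 hC] := uniform_local_decay co al_ lr rb_ kap0 q0 qk sp0 su1 supp rhoa rhob aAo Bob.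
exists C => // A' B' A0' B0' am' bm' alpha0' beta0' u ut cf' sol t t0.
have [e1 e2] := same _ _ _ _ _ _ _ _ cf'; have [alo' beo'] := al_off _ _ _ _ _ _ _ _ cf'.
have [U [Pi [S data]]] := mild_wave_data ma ra rb beta_gt0 sol.
have hU := data_U data (lexx 0).
have P0E : {ae mu, forall x, weak_deriv setT (u 0) x = p0 x}.
  apply: weak_deriv_unique (weak_deriv_of_AC su0.1 hU _) w0.
  by apply: ae_imp (data_u0 data) => x ->.
have U0E : {ae mu, forall x, u0 x = U 0 x} by apply: ae_imp (data_u0 data) => x ->.
have Uoff := continuous_cst_off (AC_continuous hU) U0E (ae_eq0_off_support (cf_u0 cf)).
have Ua : U 0 a = 0 by apply: Uoff => /andP[]; rewrite ltNge aA0.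
have Ub : U 0 b = 0 by apply: Uoff => /andP[_]; rewrite ltNge B0b.
have uooE : u_infty beta alpha0' beta0' [set` `]A0', B0'[] u1 =
    (2 * rho0)^-1 * \int[mu]_(x in `[a, b]) (be x * u1 x).
  rewrite /u_infty e1 e2; congr (_ * _).
  have mub : mfun setT (fun x => u1 x * beta x) by apply: measurable_funM => //; exact: su1.1.
  have mub' : mfun setT (fun x => be x * u1 x).
    by apply: measurable_funM; [exact: AC_mfun (c_be co)|exact: su1.1].
  have mO : mset [set` `]A0', B0'[] by exact: measurable_itv.
  have mI : mset [set` `[a, b]] by exact: measurable_itv.
  rewrite Rintegral_mkcond [RHS]Rintegral_mkcond; apply: ae_eq_Rintegral => //.
  - exact: ((measurable_restrictT _ mO).1 (measurable_funS measurableT (@subsetT _ _) mub)).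
  - exact: ((measurable_restrictT _ mI).1 (measurable_funS measurableT (@subsetT _ _) mub')).
  have h := ae_imp2 (fun x h1 h2 => conj h1 h2) (ae_eq0_off_support (cf_u1 cf')) supp.
  apply: ae_imp2 h (rep_ae rb) => x [h1 h2] eb _; rewrite !patchE eb.
  case: ifPn => [_|/negP nO]; case: ifPn => [_|/negP nI].
  + by rewrite mulrC.
  + rewrite (h2 _).2 ?mul0r//; apply: contra_notT nI; rewrite negb_or -!leNgt => xab.
    by apply/mem_set; rewrite /= in_itv.
  + by rewrite h1 ?mulr0// => /mem_set.
  + by [].
rewrite uooE; apply: (le_trans (hC _ _ _ _ _ _ _ _ data P0E (data_u1 data) Ua Ub t t0)).
rewrite lee_fin ler_pM2l// ler_expR lerN2 ler_wpM2r//.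
apply: (Lambda_le ra rb co).
- have off' x : (x < A') || (B' < x) -> al x = alpha0 /\ be x = beta0.
    move=> hx; have nx : ~ (A' < x < B').
      by move=> /andP[Ax xB]; move: hx; rewrite !ltNge !ltW.
    by split; [exact: alo'|exact: beo'].
  have h := ae_imp2 (fun x h1 h2 => conj h1 h2) (ae_neq A') (ae_neq B').
  apply: ae_imp2 h (q_off _ _ off') => x [xA xB] + nx; apply.
  rewrite !lt_neqAle; move/eqP: xA => ->; move/eqP: xB; rewrite eq_sym => -> /=.
  by rewrite !leNgt -negb_and; apply/negP.
- have [lr_|[A'l rB']] := core _ _ (cf_AB cf') alo' beo'.
    by rewrite lr_ Ipt; apply: Rintegral_ge0 => x _; exact: sqrtr_ge0.
  exact: (travel_time_le ra rb co ma mb alpha_gt0 beta_gt0 lr A'l rB').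
Qed.

End UniformDecay.

Theorem theorem1p4 (R : realType) (alpha beta u0 u1 : R -> R)
    (len_in len_0 : R) (Omega : set R)
    (halpha : in_W1p setT +oo%E alpha) (hbeta : in_W1p setT +oo%E beta)
    (hu0 : in_H1 setT u0) (hu1 : in_L2 setT u1)
    (hOmega : open_bounded_interval Omega) :
  exists C : R, 0 < C /\
    forall (Omega_in Omega_0 : set R)
        (alpha_min beta_min alpha0 beta0 : R) (u ut : R -> R -> R^o),
      open_bounded_interval Omega_in ->
      lebesgue_measure Omega_in = len_in%:E ->
      open_bounded_interval Omega_0 ->
      lebesgue_measure Omega_0 = len_0%:E ->
      0 < alpha_min -> 0 < beta_min -> 0 < alpha0 -> 0 < beta0 ->
      (forall x, alpha_min <= alpha x) ->
      (forall x, beta_min <= beta x) ->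
      (forall x, ~ Omega_in x -> alpha x = alpha0) ->
      (forall x, ~ Omega_in x -> beta x = beta0) ->
      ess_support u0 `<=` Omega_0 ->
      ess_support u1 `<=` Omega_0 ->
      wave_solution alpha beta u0 u1 u ut ->
      forall t : R, 0 <= t ->
        (H1_norm Omega (fun x => u t x - u_infty beta alpha0 beta0 Omega_0 u1)%R
         + L2_norm Omega (ut t)
         <= (C * expR (- (Lambda alpha beta Omega_in * t)))%:E)%E.
Proof.
have [Ao [Bo [_ ->]]] := hOmega.
have [[A [B [A0 [B0 [am [bm [alpha0 [beta0 cf]]]]]]]]|none] := pselect (exists
  A B A0 B0 am bm alpha0 beta0, configuration alpha beta u0 u1 A B A0 B0 am bm alpha0 beta0).
  have [C C0 hC] := uniform_decay Ao Bo halpha hbeta hu0 hu1 cf.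
  exists C; split => // _ _ am' bm' alpha0' beta0' u ut [A' [B' [AB' ->]]] _ [A0' [B0' [AB0' ->]]] _.
  move=> a1 a2 a3 a4 h1 h2 h3 h4 h5 h6 sol t t0.
  have cf' : configuration alpha beta u0 u1 A' B' A0' B0' am' bm' alpha0' beta0' by split.
  exact: hC cf' sol t t0.
(* Without an admissible configuration any constant will do. *)
exists 1; split => // _ _ am' bm' alpha0' beta0' u ut [A' [B' [AB' ->]]] _ [A0' [B0' [AB0' ->]]] _.
move=> a1 a2 a3 a4 h1 h2 h3 h4 h5 h6 sol t t0; exfalso; apply: none.
by exists A', B', A0', B0', am', bm', alpha0', beta0'.
Qed.
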